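(* Let $F(q)$ be a smooth function on an open interval such that $F''$ vanishes nowhere, let $c_{F(q)}$ be the conformal structure on $M_{F(q)}$ induced by the generic $2$-plane field $D_{F(q)}$, let $$\widetilde g_{F(q)}=2\rho\,dt^2+2t\,dt\,d\rho+t^2\left(g_{F(q)}-\rho\,\frac{17F^{(4)}F''-56(F''')^2}{5(F'')^2}(\omega^4)^2\right)$$ be its Ricci-flat ambient metric on $\mathbb{R}_+\times M_{F(q)}\times\mathbb{R}$, and let $\nabla^{\mathcal T}_{F(q)}$ denote the tractor connection of $c_{F(q)}$. Let $A_{F(q)}$ be the Cartan curvature of $D_{F(q)}$. (1) If $A_{F(q)}=0$ (identically), that is, if $D_{F(q)}$ is locally flat, then $\mathrm{Hol}(\nabla^{\mathcal T}_{F(q)})\cong\mathrm{Hol}(\widetilde g_{F(q)})\cong\{e\}$. (2) If $A_{F(q)}\ne0$ (i.e. $A_{F(q)}$ is not identically zero), then $\mathrm{Hol}(\nabla^{\mathcal T}_{F(q)})\cong\mathrm{Hol}(\widetilde g_{F(q)})\cong\mathrm H_5$, the $5$-dimensional Heisenberg group.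
   Context: $M_{F(q)}=\{(x,y,p,q,z)\in\mathbb{R}^5:q\in\mathrm{dom}\,F\}$, and $F$ and its derivatives $F',F'',F''',F^{(4)}$ are identified with functions of the coordinate $q$ on $M_{F(q)}$; pullbacks to $\mathbb{R}_+\times M_{F(q)}\times\mathbb{R}$ are suppressed, and $t,\rho$ are the coordinates on the outer factors. Set $$\omega^1=dy-p\,dx,\quad\omega^2=dz-F\,dx-F'(dp-q\,dx),\quad\omega^3=dp-q\,dx,\quad\omega^4=dq,\quad\omega^5=dx .$$ $D_{F(q)}=\ker\{\omega^1,\omega^2,\omega^3\}$ is a generic $2$-plane field (i.e. $[D,[D,D]]=TM$), encoding the ODE $z'=F(y'')$. The canonical (Nurowski) conformal structure of signature $(2,3)$ that it induces is $c_{F(q)}=[g_{F(q)}]$ with $$g_{F(q)}=30(F'')^4\omega^1\omega^4+\left[-3F^{(4)}F''+4(F''')^2\right](\omega^2)^2-10F'''(F'')^2\omega^2\omega^3+30(F'')^3\omega^2\omega^5-20(F'')^4(\omega^3)^2,$$ where $\omega^i\omega^j=\tfrac12(\omega^i\otimes\omega^j+\omega^j\otimes\omega^i)$. The Cartan curvature of a generic $2$-plane field $D$ is its fundamental invariant, a section $A$ of $\odot^4D^*$, which vanishes identically iff $D$ is locally flat, i.e. locally equivalent to the flat model (equivalently, to the $2$-plane field on $\mathbb{R}^5$, with coordinates $(x,y,p,q,z)$, that is the common kernel of the $1$-forms $dy-p\,dx$, $dz-q^2\,dx-2q(dp-q\,dx)$ and $dp-q\,dx$). For $D_{F(q)}$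 it is $$A_{F(q)}=(F'')^{-4}\,\Psi[F'']\,dq^4,\quad \Psi[U]=10U^{(4)}U^3-80U'''U'U^2-51(U'')^2U^2+336U''(U')^2U-224(U')^4 .$$ Ambient metric. The metric bundle $\mathcal G\to M$ of a conformal manifold $(M,c)$ is the ray bundle of inner products $g_u$, $g\in c$; a choice $g\in c$ identifies $t^2g_u$ with $(t,u)\in\mathbb{R}_+\times M$; $\mathbf g_0=t^2g$; $\mathcal G=\{\rho=0\}\subset\mathbb{R}_+\times M\times\mathbb{R}$; dilations $\delta_s(t,u,\rho)=(st,u,\rho)$. A Ricci-flat ambient metric is a Ricci-flat metric $\widetilde g$ on a dilation-invariant open neighborhood $\widetilde M$ of $\mathcal G$ with $\widetilde g|_{T\mathcal G}=\mathbf g_0$, $\delta_s^*\widetilde g=s^2\widetilde g$, and all curves $s\mapsto\delta_s(p)$ geodesics. Tractor connection. Sections of the tractor bundle $\mathcal T\to M$ are vector fields $\xi$ of $\widetilde M$ along $\mathcal G$ with $T\delta_s\cdot\xi=s\xi$ for $s>0$; $\nabla^{\mathcal T}_\eta X=\widetilde\nabla_{\bar\eta}X$ where $\widetilde\nabla$ is the Levi-Civita connection of $\widetilde g$ and $\bar\eta$ is any dilation-invariant lift of $\eta\in\Gamma(TM)$ to $\mathcal G$. This agrees with the usual normal conformal tractor connection. $\mathrm{Hol}$ denotes the holonomy group of a connection (of the Levi-Civita connection for a metric). $\mathrm H_5$ is the simply connected Lie group whose Lie algebra has basis $a_1,a_2,b_1,b_2,c$ with only nonzero brackets $[a_1,b_1]=[a_2,b_2]=c$.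 *)

(* Defs.v *)
From HB Require Import structures.
From mathcomp Require Import all_boot all_order all_algebra.
From mathcomp Require Import all_classical all_reals all_analysis.
From mathcomp Require Import ring.

Set Implicit Arguments.
Unset Strict Implicit.
Unset Printing Implicit Defensive.

Import Order.TTheory GRing.Theory Num.Theory.
Import numFieldNormedType.Exports.
Local Open Scope ring_scope.
Local Open Scope classical_set_scope.

(* Points of R^n and tangent vectors are columns 'cV[R]_n, covectors are rows
   'rV[R]_n, and a symmetric bilinear form on R^n is its Gram matrix. *)

Section Smoothness.
Context {R : realType}.

Definition pd n {V : normedModType R} (i : 'I_n) (f : 'cV[R]_n -> V)
    (x : 'cV[R]_n) : V :=
  'D_(delta_mx i 0) f x.

(* C^infinity on an open set of the line, resp. on the whole line. *)
Definition smooth_on (I : set R) (f : R -> R) : Prop :=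
  forall n x, I x -> derivable (f^`(n)) x 1.

Definition smooth_curve n (gam : R -> 'cV[R]_n) : Prop :=
  forall k s, derivable (gam^`(k)) s 1.

Fixpoint Ck n (k : nat) (f : 'cV[R]_n -> R) : Prop :=
  match k with
  | 0 => continuous f
  | k'.+1 => continuous f /\
      forall i, (forall x, derivable f x (delta_mx i 0)) /\ Ck k' (pd i f)
  end.

Definition smooth n (f : 'cV[R]_n -> R) : Prop := forall k, Ck k f.

End Smoothness.

(** Connections on the product bundle U x R^r over an open U in R^n.  Such a
    connection is encoded by its coefficient matrices A: the covariant
    derivative along the i-th coordinate field is s |-> d_i s + A x i *m s. *)

Section Connections.
Context {R : realType}.

Definition conn n r := 'cV[R]_n -> 'I_n -> 'M[R]_r.

Definition cov_deriv n r (A : conn n r) (eta : 'cV[R]_n)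
    (s : 'cV[R]_n -> 'cV[R]_r) (x : 'cV[R]_n) : 'cV[R]_r :=
  'D_eta s x + \sum_(i < n) eta i 0 *: (A x i *m s x).

Definition parallel n r (A : conn n r) (gam : R -> 'cV[R]_n)
    (V : R -> 'cV[R]_r) : Prop :=
  forall s, 0 <= s <= 1 ->
    derivable V s 1 /\
    derive1 V s + \sum_(i < n) derive1 gam s i 0 *: (A (gam s) i *m V s) = 0.

(* P is the parallel transport along gam, from the fibre over gam 0 to the
   fibre over gam 1. *)
Definition transport n r (A : conn n r) (gam : R -> 'cV[R]_n) (P : 'M[R]_r) :=
  forall v : 'cV[R]_r, exists V : R -> 'cV[R]_r,
    [/\ parallel A gam V, V 0 = v & V 1 = P *m v].

(* pw_transport U A x y P : P is the parallel transport along some piecewise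
   smooth path in U from x to y, i.e. a finite concatenation of smooth curves,
   each parametrized by [0, 1]. *)
Inductive pw_transport n r (U : set 'cV[R]_n) (A : conn n r) (x : 'cV[R]_n) :
    'cV[R]_n -> 'M[R]_r -> Prop :=
| pw_transport_nil : U x -> pw_transport U A x x 1%:M
| pw_transport_cons (gam : R -> 'cV[R]_n) (P Q : 'M[R]_r) :
    pw_transport U A x (gam 0) P ->
    smooth_curve gam ->
    (forall s, 0 <= s <= 1 -> U (gam s)) ->
    transport A gam Q ->
    pw_transport U A x (gam 1) (Q *m P).

(* The holonomy group at x, as a set of endomorphisms of the fibre over x. *)
Definition hol n r (U : set 'cV[R]_n) (A : conn n r) (x : 'cV[R]_n) :
    set 'M[R]_r :=
  [set P | pw_transport U A x x P].

(* For g x nondegenerate; invmx is a junk value otherwise. *)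
Definition christoffel n (g : 'cV[R]_n -> 'M[R]_n) (x : 'cV[R]_n)
    (k i j : 'I_n) : R :=
  2^-1 * \sum_(l < n) invmx (g x) k l *
    (pd i (fun y => g y j l) x + pd j (fun y => g y i l) x
     - pd l (fun y => g y i j) x).

Definition levi_civita n (g : 'cV[R]_n -> 'M[R]_n) : conn n n :=
  fun x i => \matrix_(k, j) christoffel g x k i j.

End Connections.

(** Ambient coordinates (t, u, rho) on R_+ x M x R with M open in R^n. *)

Section Ambient.
Context {R : realType} {n : nat}.

Definition amb_pt (t : R) (u : 'cV[R]_n) (rho : R) : 'cV[R]_(1 + (n + 1)) :=
  col_mx t%:M (col_mx u rho%:M).

Definition amb_t (p : 'cV[R]_(1 + (n + 1))) : R := usubmx p 0 0.
Definition amb_u (p : 'cV[R]_(1 + (n + 1))) : 'cV[R]_n := usubmx (dsubmx p).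
Definition amb_rho (p : 'cV[R]_(1 + (n + 1))) : R := dsubmx (dsubmx p) 0 0.

Definition amb_dom (U : set 'cV[R]_n) : set 'cV[R]_(1 + (n + 1)) :=
  [set p | 0 < amb_t p /\ U (amb_u p)].

Definition dt_form : 'rV[R]_(1 + (n + 1)) := row_mx 1%:M 0.
Definition drho_form : 'rV[R]_(1 + (n + 1)) := row_mx 0 (row_mx 0 1%:M).

(* The differential of amb_u, used to pull back tensors from M. *)
Definition amb_du : 'M[R]_(n, 1 + (n + 1)) := row_mx 0 (row_mx 1%:M 0).

Definition pullback (B : 'M[R]_n) : 'M[R]_(1 + (n + 1)) :=
  amb_du^T *m B *m amb_du.

(* The differential of the dilation delta_s : (t, u, rho) |-> (s t, u, rho),
   which is itself linear. *)
Definition dilation (s : R) (p : 'cV[R]_(1 + (n + 1))) :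
    'cV[R]_(1 + (n + 1)) :=
  col_mx (s *: usubmx p) (dsubmx p).

(* The fibre of the tractor bundle over u consists of the fields xi along the
   ray {(t, u, 0) : t > 0} such that T delta_s xi = s xi.  Such a field is
   determined by its value at t = 1 (see tractor_field_homog and
   tractor_field_uniq below), which identifies the tractor bundle with
   M x R^(n+2).  tractor_field X is the homogeneous field with value X at
   t = 1; its values off {rho = 0} play no role. *)
Definition tractor_field (X : 'cV[R]_n -> 'cV[R]_(1 + (n + 1)))
    (p : 'cV[R]_(1 + (n + 1))) : 'cV[R]_(1 + (n + 1)) :=
  let v := X (amb_u p) in
  col_mx (usubmx v) ((amb_t p)^-1 *: dsubmx v).

Lemma amb_ptK t u rho :
  [/\ amb_t (amb_pt t u rho) = t, amb_u (amb_pt t u rho) = u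
    & amb_rho (amb_pt t u rho) = rho].
Proof.
rewrite /amb_t /amb_u /amb_rho /amb_pt !col_mxKd !col_mxKu.
by rewrite !mxE !eqxx !mulr1n.
Qed.

Lemma dilation_pt s t u rho :
  dilation s (amb_pt t u rho) = amb_pt (s * t) u rho.
Proof. by rewrite /dilation /amb_pt col_mxKd col_mxKu scale_scalar_mx. Qed.

Lemma tractor_field1 X u rho : tractor_field X (amb_pt 1 u rho) = X u.
Proof.
rewrite /tractor_field; have [-> -> _] := amb_ptK 1 u rho.
by rewrite invr1 scale1r vsubmxK.
Qed.

Lemma tractor_field_homog X s t u : 0 < s -> 0 < t ->
  dilation s (tractor_field X (amb_pt t u 0)) =
  s *: tractor_field X (amb_pt (s * t) u 0).
Proof.
move=> s0 t0; rewrite /tractor_field.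
have [-> -> _] := amb_ptK t u 0; have [-> -> _] := amb_ptK (s * t) u 0.
rewrite /dilation col_mxKu col_mxKd scale_col_mx scalerA; congr col_mx.
by rewrite invfM mulVKf // gt_eqF.
Qed.

Lemma tractor_field_uniq (xi : 'cV[R]_(1 + (n + 1)) -> 'cV[R]_(1 + (n + 1))) :
  (forall s t u, 0 < s -> 0 < t ->
     dilation s (xi (amb_pt t u 0)) = s *: xi (amb_pt (s * t) u 0)) ->
  forall t u, 0 < t ->
    xi (amb_pt t u 0) = tractor_field (fun u => xi (amb_pt 1 u 0)) (amb_pt t u 0).
Proof.
move=> xiE t u t0; have := xiE t 1 u t0 ltr01.
rewrite mulr1 => /(congr1 ( *:%R t^-1)); rewrite scalerA mulVf ?gt_eqF //.
rewrite scale1r => <-; rewrite /tractor_field; have [-> -> _] := amb_ptK t u 0.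
by rewrite /dilation scale_col_mx scalerA mulVf ?gt_eqF // scale1r.
Qed.

(* nabla^T_eta X is the Levi-Civita derivative of the homogeneous field X along
   the dilation-invariant lift (0, eta, 0) of eta, evaluated at t = 1.  For the
   metrics of interest any other dilation-invariant lift gives the same result:
   it differs by a multiple of t d/dt, along which homogeneous fields are
   parallel. *)
Definition tractor_deriv
    (gt : 'cV[R]_(1 + (n + 1)) -> 'M[R]_(1 + (n + 1)))
    (eta : 'cV[R]_n) (X : 'cV[R]_n -> 'cV[R]_(1 + (n + 1))) (u : 'cV[R]_n) :
    'cV[R]_(1 + (n + 1)) :=
  cov_deriv (levi_civita gt) (amb_pt 0 eta 0) (tractor_field X) (amb_pt 1 u 0).

(* Its coefficient matrices: column j is the derivative of the j-th constant
   section. *)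
Definition tractor_conn
    (gt : 'cV[R]_(1 + (n + 1)) -> 'M[R]_(1 + (n + 1))) :
    conn n (1 + (n + 1)) :=
  fun u i => \matrix_(k, j)
    tractor_deriv gt (delta_mx i 0) (fun=> delta_mx j 0) u k 0.

End Ambient.

(** 2-plane fields D_F on the sets M_F; the coordinates of R^5 are
    (x, y, p, q, z), in this order. *)

Section PlaneField.
Context {R : realType}.

Definition ix : 'I_5 := @Ordinal 5 0 isT.
Definition iy : 'I_5 := @Ordinal 5 1 isT.
Definition ip : 'I_5 := @Ordinal 5 2 isT.
Definition iq : 'I_5 := @Ordinal 5 3 isT.
Definition iz : 'I_5 := @Ordinal 5 4 isT.

Definition dform (i : 'I_5) : 'rV[R]_5 := delta_mx 0 i.

Definition M_F (I : set R) : set 'cV[R]_5 := [set u | I (u iq 0)].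

Definition omega1 (u : 'cV[R]_5) : 'rV[R]_5 := dform iy - u ip 0 *: dform ix.

Definition omega3 (u : 'cV[R]_5) : 'rV[R]_5 := dform ip - u iq 0 *: dform ix.

Definition omega2 (F : R -> R) (u : 'cV[R]_5) : 'rV[R]_5 :=
  dform iz - F (u iq 0) *: dform ix - derive1 F (u iq 0) *: omega3 u.

Definition omega4 : 'rV[R]_5 := dform iq.

Definition omega5 : 'rV[R]_5 := dform ix.

Definition D_F (F : R -> R) (u : 'cV[R]_5) : set 'cV[R]_5 :=
  [set X | [/\ omega1 u *m X = 0, omega2 F u *m X = 0 & omega3 u *m X = 0]].

Definition sprod n (a b : 'rV[R]_n) : 'M[R]_n :=
  2^-1 *: (a^T *m b + b^T *m a).

Definition g_F (F : R -> R) (u : 'cV[R]_5) : 'M[R]_5 :=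
  let F2 := F^`(2) (u iq 0) in
  let F3 := F^`(3) (u iq 0) in
  let F4 := F^`(4) (u iq 0) in
  let w1 := omega1 u in
  let w2 := omega2 F u in
  let w3 := omega3 u in
  (30 * F2 ^+ 4) *: sprod w1 omega4
  + (- 3 * F4 * F2 + 4 * F3 ^+ 2) *: sprod w2 w2
  - (10 * F3 * F2 ^+ 2) *: sprod w2 w3
  + (30 * F2 ^+ 3) *: sprod w2 omega5
  - (20 * F2 ^+ 4) *: sprod w3 w3.

Definition amb_g_F (F : R -> R) (p : 'cV[R]_(1 + (5 + 1))) :
    'M[R]_(1 + (5 + 1)) :=
  let u := amb_u p in
  let t := amb_t p in
  let rho := amb_rho p in
  let F2 := F^`(2) (u iq 0) in
  let F3 := F^`(3) (u iq 0) in
  let F4 := F^`(4) (u iq 0) in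
  (2 * rho) *: sprod dt_form dt_form
  + (2 * t) *: sprod dt_form drho_form
  + t ^+ 2 *: pullback
      (g_F F u - (rho * ((17 * F4 * F2 - 56 * F3 ^+ 2) / (5 * F2 ^+ 2)))
                   *: sprod omega4 omega4).

Definition Psi (U : R -> R) (q : R) : R :=
  let U1 := U^`(1) q in
  let U2 := U^`(2) q in
  let U3 := U^`(3) q in
  let U4 := U^`(4) q in
  10 * U4 * U q ^+ 3 - 80 * U3 * U1 * U q ^+ 2 - 51 * U2 ^+ 2 * U q ^+ 2
  + 336 * U2 * U1 ^+ 2 * U q - 224 * U1 ^+ 4.

(* The Cartan curvature of D_F as a quartic form; it is a section of the fourth
   symmetric power of the dual of D_F, so only arguments in D_F matter. *)
Definition cartan_curv (F : R -> R) (u : 'cV[R]_5) (X : 'I_4 -> 'cV[R]_5) : R :=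
  let F2 := F^`(2) in
  F2 (u iq 0) ^- 4 * Psi F2 (u iq 0)
  * \prod_(k < 4) (dform iq *m X k) 0 0.

Definition cartan_curv_vanishes (I : set R) (F : R -> R) : Prop :=
  forall u, M_F I u -> forall X : 'I_4 -> 'cV[R]_5,
    (forall k, D_F F u (X k)) -> cartan_curv F u X = 0.

Definition amb_hol (I : set R) (F : R -> R) (p : 'cV[R]_(1 + (5 + 1))) :=
  hol (amb_dom (M_F I)) (levi_civita (amb_g_F F)) p.

Definition tractor_hol (I : set R) (F : R -> R) (u : 'cV[R]_5) :=
  hol (M_F I) (tractor_conn (amb_g_F F)) u.

End PlaneField.

(** The Heisenberg algebra, on R^5 with basis a1, a2, b1, b2, c, and its simply
    connected group. *)

Section Heisenberg.
Context {R : realType}.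

Definition ia1 : 'I_5 := @Ordinal 5 0 isT.
Definition ia2 : 'I_5 := @Ordinal 5 1 isT.
Definition ib1 : 'I_5 := @Ordinal 5 2 isT.
Definition ib2 : 'I_5 := @Ordinal 5 3 isT.
Definition ic : 'I_5 := @Ordinal 5 4 isT.

Definition h5_bracket (X Y : 'cV[R]_5) : 'cV[R]_5 :=
  (X ia1 0 * Y ib1 0 - X ib1 0 * Y ia1 0
   + (X ia2 0 * Y ib2 0 - X ib2 0 * Y ia2 0)) *: delta_mx ic 0.

(* The algebra is 2-step nilpotent, so its simply connected group is the vector
   space R^5 with the Baker-Campbell-Hausdorff product. *)
Definition H5_mul (X Y : 'cV[R]_5) : 'cV[R]_5 := X + Y + 2^-1 *: h5_bracket X Y.

Lemma h5_bracket_basis (i j : 'I_5) :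
  h5_bracket (delta_mx i 0) (delta_mx j 0) =
  (if ((i == ia1) && (j == ib1)) || ((i == ia2) && (j == ib2)) then 1
   else if ((i == ib1) && (j == ia1)) || ((i == ib2) && (j == ia2)) then -1
   else 0) *: delta_mx ic 0.
Proof.
rewrite /h5_bracket !mxE !eqxx !andbT; congr (_ *: _).
by case: i => -[|[|[|[|[|//]]]]] ?; case: j => -[|[|[|[|[|//]]]]] ? /=;
  rewrite ?mulr0 ?mul0r ?mulr1 ?subr0 ?sub0r ?addr0 ?add0r ?oppr0.
Qed.

Lemma H5_mul0 X : H5_mul 0 X = X.
Proof.
by rewrite /H5_mul /h5_bracket !mxE !mul0r !subr0 addr0 scale0r scaler0 addr0 add0r.
Qed.

Lemma H5_mulN X : H5_mul (- X) X = 0.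
Proof.
rewrite /H5_mul /h5_bracket !mxE addNr add0r.
by rewrite (_ : _ + _ = 0) ?scale0r ?scaler0 //; ring.
Qed.

Lemma H5_mulA : associative H5_mul.
Proof.
move=> X Y Z; apply/matrixP => i j; rewrite /H5_mul /h5_bracket !mxE /=.
by case: (i == ic); case: (j == 0) => /=; ring.
Qed.

(* The lines s |-> s X are the one-parameter subgroups, and the commutator of
   the product is the bracket. *)
Lemma H5_mul_line s t X : H5_mul (s *: X) (t *: X) = (s + t) *: X.
Proof.
suff br0 : h5_bracket (s *: X) (t *: X) = 0.
  by rewrite /H5_mul br0 scaler0 addr0 scalerDl.
by apply/matrixP => i j; rewrite /h5_bracket !mxE; ring.
Qed.

Lemma H5_mul_comm X Y : H5_mul X Y - H5_mul Y X = h5_bracket X Y.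
Proof.
apply/matrixP => i j; rewrite /H5_mul /h5_bracket !mxE.
by case: (i == ic); case: (j == 0) => /=; field.
Qed.

(* A subgroup of GL_r carries at most one structure of (second countable)
   immersed Lie subgroup, and an injective smooth homomorphism of Lie groups is
   an immersion.  Hence G is a Lie subgroup isomorphic to H_5 as a Lie group iff
   it is the image of an injective smooth homomorphism H_5 -> GL_r. *)
Definition isom_H5 r (G : set 'M[R]_r) : Prop :=
  exists phi : 'cV[R]_5 -> 'M[R]_r,
    [/\ forall i j, smooth (fun X => phi X i j),
        phi 0 = 1%:M,
        forall X Y, phi (H5_mul X Y) = phi X *m phi Y,
        injective phi
      & range phi = G].

Definition isom_trivial r (G : set 'M[R]_r) : Prop := G = [set 1%:M].

End Heisenberg.

(* Main.v *)
Require Import Defs.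
From HB Require Import structures.
From mathcomp Require Import all_boot all_order all_algebra.
From mathcomp Require Import all_classical all_reals all_analysis.
From mathcomp Require Import ring lra.

(** The ambient metric is computed in a frame in which its connection form is a
    multiple of dq with values in the Heisenberg algebra.

    There is a map Phi from the ambient space to R^7 whose restriction to each
    slice q = const is an isometric immersion for a constant Gram matrix eta.
    Adding to d Phi a suitable multiple of dq gives a coframe th with
    g = th^T eta th (amb_metric_coframe), and d th + om /\ th = 0 for
    om = N dq with N skew for eta (jet_coframe_torsion).  By Koszul's formula
    (levi_civita_coframe), om is the connection form of g in this coframe.
    Here N is the sum of a matrix in sl_2 that depends on q alone and of a
    nilpotent matrix whose entries are multiples of P Psi / F''^5 and
    P^2 Psi / F''^6, where P = z - F' p + (q F' - F) x and Psi stands for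
    Psi[F''].  Solving the linear equation tau'' = - k(q) tau
    (linear_ode_exists) removes the first summand by a rotation of the frame.
    What is left of the connection form is h5_rep X dq, where the noncentral
    part of X is P Psi / F''^5 times the twisted cubic of (tau1, tau2), and its
    central part is a multiple of P^2 Psi / F''^6 (gauge_levi_civita).

    Upper bound.  The transport equation E' = - h5_rep (q' X) E is solved by
    quadratures inside the Heisenberg group (h5_development), so in the gauge
    every transport is an element of the group, and is the identity if Psi
    vanishes identically.

    Lower bound.  Suppose that Psi does not vanish at q0.  Transport along
    q = const is trivial in the gauge, and so is transport along P = 0; the
    rectangle with a side on which P = z is constant and q varies from q0 to
    q contributes z A(q) + z^2 C(q) c, where A is a primitive of a multiple of
    the twisted cubic.  The twisted cubic is nondegenerate where Psi does not
    vanish (twisted_cubic_span), so the vectors A(q) span the algebra modulo its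
    centre, and commutators give the centre (h5_generated).

    The tractor connection is the pullback of the ambient connection by
    u |-> (1, u, 0) (tractor_transport).  The holonomy argument is made for a
    lift L that is either this map or the identity, and the two groups are
    obtained together. *)

Set Implicit Arguments.
Unset Strict Implicit.
Unset Printing Implicit Defensive.

Import Order.TTheory GRing.Theory Num.Theory.
Import numFieldNormedType.Exports.
Local Open Scope ring_scope.
Local Open Scope classical_set_scope.

(** * Calculus on an interval *)

Section IntervalCalculus.
Context {R : realType}.
Implicit Types (I : set R) (f g df dg : R -> R) (a b x y : R).

Lemma is_derive_continuous f (d : R) x :
  is_derive x 1 f d -> {for x, continuous f}.
Proof. by case=> /derivable1_diffP /differentiable_continuous. Qed.

Lemma derive_within_continuous f df a b :
  (forall x, a <= x <= b -> is_derive x 1 f (df x)) ->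
  {within `[a, b], continuous f}.
Proof.
move=> fd; apply: derivable_within_continuous => x; rewrite in_itv /= => xab.
by have [] := fd x xab.
Qed.

(** Both g - f and g + f have a nonnegative derivative, hence are nondecreasing. *)
Lemma mean_value_domination f g df dg a b : a <= b ->
  (forall x, a <= x <= b -> is_derive x 1 f (df x)) ->
  (forall x, a <= x <= b -> is_derive x 1 g (dg x)) ->
  (forall x, a <= x <= b -> `|df x| <= dg x) ->
  `|f b - f a| <= g b - g a.
Proof.
move=> ab fd gd fg.
have mono (h dh : R -> R) : (forall x, a <= x <= b -> is_derive x 1 h (dh x)) ->
    (forall x, a <= x <= b -> 0 <= dh x) -> 0 <= h b - h a.
  move=> hd h0; have [||c] := @MVT_segment R h dh a b ab.
  - by move=> x; rewrite in_itv /= => /andP[/ltW ax /ltW xb]; apply/hd/andP.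
  - exact: derive_within_continuous hd.
  by rewrite in_itv /= => /h0 c0 ->; rewrite mulr_ge0 // subr_ge0.
have H1 := mono (g - f) (fun x => dg x - df x).
have H2 := mono (g + f) (fun x => dg x + df x).
rewrite ler_norml; apply/andP; split.
- rewrite -subr_ge0 (_ : _ - _ = (g + f) b - (g + f) a); last first.
    by rewrite !fctE; ring.
  apply: H2 => x xab; first by apply: is_deriveD; [exact: gd|exact: fd].
  by have := fg x xab; rewrite ler_norml => /andP[]; rewrite -subr_ge0 opprK addrC.
- rewrite -subr_ge0 (_ : _ - _ = (g - f) b - (g - f) a); last first.
    by rewrite !fctE; ring.
  apply: H1 => x xab; first by apply: is_deriveB; [exact: gd|exact: fd].
  by have := fg x xab; rewrite ler_norml => /andP[_]; rewrite subr_ge0.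
Qed.

Lemma zero_derive_const f a b : a <= b ->
  (forall x, a <= x <= b -> is_derive x 1 f 0) -> f b = f a.
Proof.
move=> ab fd; apply/eqP; rewrite -subr_eq0 -normr_le0 -(subrr 0).
apply: (@mean_value_domination f (cst 0) (cst 0) (cst 0)) => // x _.
by rewrite normr0.
Qed.

Lemma zero_derive_const_itv I f x y : is_interval I -> I x -> I y ->
  (forall s, I s -> is_derive s 1 f 0) -> f x = f y.
Proof.
move=> Iitv; wlog xy : x y / x <= y => [hw Ix Iy fd|Ix Iy fd].
  by case: (leP x y) => [/hw|/ltW /hw] ->.
by symmetry; apply: zero_derive_const => // s /(Iitv _ _ Ix Iy); apply: fd.
Qed.

Lemma open_itv_enlarge I x : open I -> I x ->
  exists2 e, 0 < e & forall y, `|x - y| <= e -> I y.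
Proof.
move=> Io Ix; have /nbhs_closedballP[e eI] : nbhs x I by exact: open_nbhs_nbhs.
exists e%:num => // y xy; apply: eI.
by rewrite closed_ballE // /closed_ball_ /=.
Qed.

(** Continuous functions are bounded and integrable on [a, b], while x and y are
    interior to it, so that derivatives can be taken there. *)
Lemma open_itv_segment I x y : open I -> is_interval I -> I x -> I y ->
  exists a b, [/\ a < x < b, a < y < b & forall s, a <= s <= b -> I s].
Proof.
move=> Io Iitv Ix Iy.
have [e e0 eI] := open_itv_enlarge Io Ix.
have [d d0 dI] := open_itv_enlarge Io Iy.
exists (Num.min (x - e) (y - d)), (Num.max (x + e) (y + d)); split.
- by rewrite gt_min lt_max; apply/andP; split; apply/orP; left; lra.
- by rewrite gt_min lt_max; apply/andP; split; apply/orP; right; lra.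
move=> s; apply: Iitv.
- case: leP => _; [apply: eI|apply: dI]; rewrite ger0_norm; lra.
- case: leP => _; [apply: dI|apply: eI]; rewrite ler0_norm; lra.
Qed.

(** The fundamental theorem of calculus, for a base point q0 on either side of q:
    one of the two integrals below always runs over an empty interval. *)
Lemma primitive_exists I f q0 : open I -> is_interval I -> I q0 ->
  (forall q, I q -> {for q, continuous f}) ->
  exists2 G : R -> R, G q0 = 0 & forall q, I q -> is_derive q 1 G (f q).
Proof.
move=> Io Iitv Iq0 fc.
pose mu := @lebesgue_measure R.
pose int a b := \int[mu]_(t in `[a, b]) f t.
exists (fun q => int q0 q - int q q0) => [|q Iq]; first by rewrite subrr.
have [a [b [/andP[aq0 q0b] /andP[aq qb] abI]]] := open_itv_segment Io Iitv Iq0 Iq.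
have fab c d : a <= c -> d <= b -> mu.-integrable `[c, d] (EFin \o f).
  move=> ac db; apply: continuous_compact_integrable.
    exact: segment_compact.
  apply: continuous_in_subspaceT => x /[1!inE] /=; rewrite in_itv /= => /andP[cx xd].
  by apply/fc/abI; rewrite (le_trans ac cx) (le_trans xd db).
have intB x y : a <= x -> x <= y -> y <= b -> int x y = int a y - int a x.
  move=> ax xy yb; rewrite /int.
  have /= := @Rintegral_itvB R f (BLeft a) (BRight y) x (fab _ _ (lexx a) yb).
  rewrite !bnd_simp => -> //; rewrite Rintegral_itv_obnd_cbnd //.
  apply: integrableS (fab _ _ ax yb) => //.
  by apply: subset_itvr; rewrite bnd_simp.
have intxx x : int x x = 0 by rewrite /int set_itv1 Rintegral_set1.
have intE y : a < y < b -> int q0 y - int y q0 = int a y - int a q0.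
  move=> /andP[ay yb]; have [q0y|yq0] := leP q0 y.
    rewrite (intB _ _ (ltW aq0) q0y (ltW yb)); move: q0y; rewrite le_eqVlt => /predU1P[<-|q0y].
      by rewrite intxx subr0.
    rewrite [X in _ - X](_ : int y q0 = 0) ?subr0 // /int.
    by rewrite set_itv_ge ?Rintegral_set0 // bnd_simp -ltNge.
  rewrite (intB _ _ (ltW ay) (ltW yq0) (ltW q0b)) [X in X - _](_ : int q0 y = 0) ?sub0r ?opprB // /int.
  by rewrite set_itv_ge ?Rintegral_set0 // bnd_simp -ltNge.
have [|dG GE] := @continuous_FTC1_closed R f a q b qb (fab _ _ (lexx a) (lexx b)) aq.
  exact: fc.
have {}dG : is_derive q 1 (fun y => int a y - int a q0) (f q).
  have -> : (fun y => int a y - int a q0) = int a - cst (int a q0) by [].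
  rewrite -[f q]subr0; apply: is_deriveB.
  by rewrite -GE derive1E; exact: derivableP.
apply: near_eq_is_derive dG.
near=> y; rewrite intE //.
near: y; have : nbhs q (`]a, b[ : set R) by apply: near_in_itvoo; rewrite in_itv /= aq qb.
by apply: filterS => y /=; rewrite in_itv.
Unshelve. all: by end_near. Qed.

End IntervalCalculus.

(** * Linear differential equations on an interval *)

Section LinearODE.
Context {R : realType}.
Implicit Types (I : set R) (f df : R -> R) (a b q s : R).

Lemma bounded_derive_growth f df M a b q0 s : a <= q0 <= b -> a <= s <= b ->
  (forall x, a <= x <= b -> is_derive x 1 f (df x)) ->
  (forall x, a <= x <= b -> `|df x| <= M) ->
  `|f s - f q0| <= M * `|s - q0|.
Proof.
move=> /andP[aq0 q0b] /andP[aS sb] fd fM.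
have gd (x : R) : is_derive x 1 (fun y => M * y) M.
  by rewrite -[X in is_derive _ _ _ X]mulr1; exact: is_deriveZ.
have dom x y : a <= x -> x <= y -> y <= b -> `|f y - f x| <= M * (y - x).
  move=> ax xy yb; rewrite mulrBr.
  have sub z : x <= z <= y -> a <= z <= b.
    by move=> /andP[xz zy]; rewrite (le_trans ax xz) (le_trans zy yb).
  apply: (@mean_value_domination R f (fun y => M * y) df (cst M)) => // z /sub zab.
  - exact: fd.
  - exact: fM.
have [q0s|/ltW sq0] := leP q0 s; first by rewrite [in leRHS]ger0_norm ?subr_ge0 ?dom.
by rewrite distrC (distrC s) [in leRHS]ger0_norm ?subr_ge0 ?dom.
Qed.

(** The growth of the Picard iterates in a weighted norm: with the weight
    exp(2 K |x - q0|), integrating K times a function of weighted size c gives a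
    function of weighted size c / 2, whatever the length of the interval. *)
Lemma exp_bounded_derive_growth f df c K a b q0 s : 0 <= c ->
  a <= q0 <= b -> a <= s <= b ->
  (forall x, a <= x <= b -> is_derive x 1 f (df x)) ->
  (forall x, a <= x <= b -> `|df x| <= c * K * expR (2 * K * `|x - q0|)) ->
  `|f s - f q0| <= c / 2 * expR (2 * K * `|s - q0|).
Proof.
move=> c0 /andP[aq0 q0b] /andP[aS sb] fd fM.
have gd (e d x : R) : is_derive x 1 (fun y => e * expR (d * (y - q0)))
    (e * (expR (d * (x - q0)) * d)).
  have dd : is_derive x 1 (fun y => d * (y - q0)) d.
    have -> : (fun y => d * (y - q0)) = d *: (id - cst q0).
      by apply/funext => y; rewrite !fctE.
    rewrite -[X in is_derive _ _ _ X]mulr1 -[X in d * X]subr0.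
    exact: is_deriveZ.
  apply: (@is_deriveZ _ _ _ (expR \o (fun y => d * (y - q0)))).
have [q0s|/ltW sq0] := leP q0 s.
  have sub z : q0 <= z <= s -> a <= z <= b.
    by move=> /andP[xz zy]; rewrite (le_trans aq0 xz) (le_trans zy sb).
  apply: le_trans (@mean_value_domination R f _ df _ q0 s q0s
    (fun x xs => fd x (sub x xs)) (fun x _ => gd (c / 2) (2 * K) x) _) _.
    move=> x xs; apply: le_trans (fM x (sub x xs)) _.
    rewrite ger0_norm ?subr_ge0; last by case/andP: xs.
    by rewrite le_eqVlt; apply/orP; left; apply/eqP; field.
  rewrite ger0_norm ?subr_ge0 // gerDl oppr_le0.
  by rewrite mulr_ge0 ?expR_ge0 // divr_ge0.
have sub z : s <= z <= q0 -> a <= z <= b.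
  by move=> /andP[xz zy]; rewrite (le_trans aS xz) (le_trans zy q0b).
have sgn z : 2 * K * - z = - (2 * K) * z by ring.
rewrite distrC; apply: le_trans (@mean_value_domination R f _ df _ s q0 sq0
  (fun x xs => fd x (sub x xs)) (fun x _ => gd (- (c / 2)) (- (2 * K)) x) _) _.
  move=> x xs; apply: le_trans (fM x (sub x xs)) _.
  rewrite ler0_norm ?subr_le0; last by case/andP: xs.
  by rewrite sgn le_eqVlt; apply/orP; left; apply/eqP; field.
rewrite ler0_norm ?subr_le0 // sgn.
rewrite !mulNr opprK [leLHS]addrC gerDl oppr_le0.
by rewrite mulr_ge0 ?expR_ge0 // divr_ge0.
Qed.

(** The limit is chosen once, from some bound D0; the estimate of the remainder is
    stated for every bound D because the bounds available later depend on the
    segment that is considered. *)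
Lemma dyadic_series_limit (u : nat -> R) (D0 : R) :
  (forall k, `|u k| <= D0 / 2 ^+ k) ->
  exists l, forall D : R, (forall k, `|u k| <= D / 2 ^+ k) ->
    forall n, `|l - \sum_(k < n) u k| <= D * 2 / 2 ^+ n.
Proof.
move=> uD0.
have geo m (D : R) n : \sum_(n <= k < n + m) D / 2 ^+ k = D * 2 * (2 ^- n - 2 ^- (n + m)).
  elim: m => [|m IH]; first by rewrite addn0 big_geq // subrr mulr0.
  rewrite addnS big_nat_recr ?leq_addr //= IH exprS.
  by field; rewrite !expf_neq0 ?pnatr_eq0.
have cu : cvgn (series u).
  apply: normed_cvg; apply: (@series_le_cvg _ _ (geometric D0 2^-1)) => //= k.
  - by rewrite exprVn; exact: le_trans (uD0 k).
  - by rewrite exprVn.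
  - by apply: is_cvg_geometric_series; rewrite ger0_norm ?invr_ge0 // invf_lt1 // ltr1n.
exists (limn (series u)) => D uD n.
have D0' : 0 <= D by have := le_trans (normr_ge0 _) (uD 0); rewrite expr0 divr1.
have cn : (fun m => `|series u m - \sum_(k < n) u k|) @ \oo -->
    `|limn (series u) - \sum_(k < n) u k|.
  by apply: cvg_norm; apply: cvgB => //; exact: cvg_cst.
rewrite -(cvg_lim (@Rhausdorff R) cn); apply: limr_le; first by apply: cvgP cn.
near=> m; have nm : (n <= m)%N by near: m; exact: nbhs_infty_ge.
rewrite seriesEnat /= (big_cat_nat (leq0n n) nm) //= big_mkord addrAC subrr add0r.
apply: le_trans (ler_norm_sum _ _ _) _.
apply: (@le_trans _ _ (\sum_(n <= k < m) D / 2 ^+ k)); first exact: ler_sum.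
rewrite -(subnKC nm) geo ler_wpM2l ?mulr_ge0 // gerDl oppr_le0.
by rewrite invr_ge0 exprn_ge0.
Unshelve. all: by end_near. Qed.

Lemma le_dyadic_le0 (x C : R) : (forall n, x <= C / 2 ^+ n) -> x <= 0.
Proof.
move=> xC; rewrite leNgt; apply/negP => x0.
have cC : (fun n => C * 2^-1 ^+ n) @ \oo --> (0 : R).
  by apply: cvg_geometric; rewrite ger0_norm ?invr_ge0 // invf_lt1 // ltr1n.
have := cvgr_lt _ cC x x0 => -[n _ /(_ n (leqnn n))] /=.
by rewrite exprVn ltNge xC.
Qed.

End LinearODE.

Section LinearODEExistence.
Context {R : realType} (I : set R) (n : nat).
Variables (N : R -> 'M[R]_n) (y0 : 'cV[R]_n) (q0 : R).
Hypotheses (I_open : open I) (I_itv : is_interval I) (I_q0 : I q0).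
Hypothesis N_cont : forall q i j, I q -> {for q, continuous (fun s => N s i j)}.

Let rhs (y : 'I_n -> R -> R) (i : 'I_n) (s : R) := \sum_j N s i j * y j s.

Let rhs_continuous y : (forall i q, I q -> {for q, continuous (y i)}) ->
  forall i q, I q -> {for q, continuous (rhs y i)}.
Proof.
move=> yc i q Iq; rewrite /rhs; apply: cvg_big => [|j _].
  exact: add_continuous.
apply: cvgM; [exact: N_cont|exact: yc].
Qed.

(** The solution is the sum of the Picard increments Y m, where Y m.+1 is the
    primitive of N Y m.  In the weighted norm of exp_bounded_derive_growth each
    increment is half of the preceding one, so the series converges on all of I
    and not only near q0. *)
Lemma linear_ode_exists : exists y : 'I_n -> R -> R,
  (forall i, y i q0 = y0 i 0) /\
  (forall q i, I q -> is_derive q 1 (y i) (\sum_j N q i j * y j q)).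
Proof.
(* P is an operator that picks a primitive vanishing at q0. *)
have [P PE] : exists P : (R -> R) -> R -> R, forall f,
    (forall q, I q -> {for q, continuous f}) ->
    P f q0 = 0 /\ forall q, I q -> is_derive q 1 (P f) (f q).
  suff /choice [P PE] : forall f : R -> R, exists G : R -> R,
      (forall q, I q -> {for q, continuous f}) ->
      G q0 = 0 /\ forall q, I q -> is_derive q 1 G (f q) by exists P.
  move=> f; have [fc|nfc] := pselect (forall q, I q -> {for q, continuous f}).
    by have [G G0 Gd] := primitive_exists I_open I_itv I_q0 fc; exists G.
  by exists f.
pose Y := fix Y (m : nat) : 'I_n -> R -> R :=
  if m is m'.+1 then fun i => P (rhs (Y m') i) else fun i => cst (y0 i 0).
have Yc m : forall i q, I q -> {for q, continuous (Y m i)}.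
  elim: m => [|m IH] i q Iq; first exact: cst_continuous.
  by have [_ /(_ q Iq) /is_derive_continuous] := PE _ (@rhs_continuous _ IH i).
have Y0 m i : Y m.+1 i q0 = 0 by have [] := PE _ (@rhs_continuous _ (@Yc m) i).
have Yd m i q : I q -> is_derive q 1 (Y m.+1 i) (rhs (Y m) i q).
  by have [_] := PE _ (@rhs_continuous _ (@Yc m) i); apply.
have bound (a b : R) : a <= q0 <= b -> (forall s, a <= s <= b -> I s) ->
    exists D K : R, [/\ 0 <= D, 0 < K,
      forall s i, a <= s <= b -> \sum_j `|N s i j| <= K
      & forall m i s, a <= s <= b -> `|Y m i s| <= D / 2 ^+ m].
  move=> aqb abI; have /andP[aq qb] := aqb.
  have [K K0 NK] : exists2 K : R, 0 < K &
      forall s i, a <= s <= b -> \sum_j `|N s i j| <= K.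
    have Nc i j : {within `[a, b], continuous (fun s => `|N s i j|)}.
      apply: continuous_in_subspaceT => s /[1!inE] /=; rewrite in_itv /= => sab.
      by apply: cvg_norm; apply/N_cont/abI.
    have /choice[M MN] (ij : 'I_n * 'I_n) : exists M : R, forall s, a <= s <= b ->
        `|N s ij.1 ij.2| <= M.
      have [c _ cM] := EVT_max (le_trans aq qb) (Nc ij.1 ij.2).
      by eexists => s sab; apply: cM; rewrite in_itv.
    have M0 ij : 0 <= M ij by apply: le_trans (MN ij q0 aqb).
    exists (1 + \sum_ij M ij) => [|s i sab].
      by rewrite ltr_wpDr // sumr_ge0.
    have -> : \sum_ij M ij = \sum_k \sum_j M (k, j).
      by rewrite pair_bigA; apply: eq_bigr; case.
    apply: ler_wpDl => //; rewrite [leRHS](bigD1 i) //=; apply: ler_wpDr.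
      by apply: sumr_ge0 => ? _; rewrite sumr_ge0.
    by apply: ler_sum => j _; apply: (MN (i, j)).
  pose C := \sum_j `|y0 j 0|; have C0 : 0 <= C by apply: sumr_ge0.
  have YE m : forall i s, a <= s <= b ->
      `|Y m i s| <= C / 2 ^+ m * expR (2 * K * `|s - q0|).
    elim: m => [|m IH] i s sab.
      rewrite expr0 divr1 /=; apply: (@le_trans _ _ C).
        by rewrite /C (bigD1 i) //= lerDl sumr_ge0.
      by rewrite ler_peMr // -expR0 ler_expR mulr_ge0 // mulr_ge0 // ltW.
    have c0 : 0 <= C / 2 ^+ m by rewrite divr_ge0 // exprn_ge0.
    have -> : C / 2 ^+ m.+1 = C / 2 ^+ m / 2.
      by rewrite exprS; field; rewrite expf_neq0.
    rewrite -[Y m.+1 i s]subr0 -(Y0 m i).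
    apply: (exp_bounded_derive_growth c0 aqb sab) => x xab.
      exact/Yd/abI.
    rewrite /rhs; apply: le_trans (ler_norm_sum _ _ _) _.
    apply: (@le_trans _ _ (\sum_j `|N x i j| * (C / 2 ^+ m * expR (2 * K * `|x - q0|)))).
      by apply: ler_sum => j _; rewrite normrM ler_wpM2l // IH.
    rewrite -mulr_suml [C / _ * K]mulrC -(mulrA K) ler_wpM2r ?NK //.
    by rewrite mulr_ge0 // expR_ge0.
  exists (C * expR (2 * K * (b - a))), K; split => //.
    by rewrite mulr_ge0 // expR_ge0.
  move=> m i s sab; apply: le_trans (YE m i s sab) _.
  rewrite mulrAC ler_wpM2r ?invr_ge0 ?exprn_ge0 // ler_wpM2l //.
  rewrite ler_expR ler_wpM2l ?mulr_ge0 ?(ltW K0) //.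
  case/andP: sab => aS sb; rewrite ler_norml; apply/andP; split; lra.
have [Z ZE] : exists Z : 'I_n -> R -> R, forall i s D, I s ->
    (forall k, `|Y k i s| <= D / 2 ^+ k) ->
    forall m, `|Z i s - \sum_(k < m) Y k i s| <= D * 2 / 2 ^+ m.
  have /choice[Z ZE] (z : 'I_n * R) : exists l : R, forall D, I z.2 ->
      (forall k, `|Y k z.1 z.2| <= D / 2 ^+ k) ->
      forall m, `|l - \sum_(k < m) Y k z.1 z.2| <= D * 2 / 2 ^+ m.
    have [Is|nIs] := pselect (I z.2); last by exists 0.
    have [a [b [/andP[aq qb] /andP[aS sb] abI]]] :=
      open_itv_segment I_open I_itv I_q0 Is.
    have [|D [K [_ _ _ YD]]] := bound a b _ abI; first by rewrite !ltW.
    have [|l lE] := @dyadic_series_limit R (fun k => Y k z.1 z.2) D.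
      by move=> k; apply: YD; rewrite !ltW.
    by exists l => D' _; apply: lE.
  by exists (fun i s => Z (i, s)) => i s D; apply: (ZE (i, s)).
have Zc i q : I q -> {for q, continuous (Z i)}.
  move=> Iq; have [a [b [/andP[aq0 q0b] /andP[aq qb] abI]]] :=
    open_itv_segment I_open I_itv I_q0 Iq.
  have [|D [K [D0 _ _ YD]]] := bound a b _ abI; first by rewrite !ltW.
  apply/cvgrPdist_lt => e e0.
  have [m mE] : exists m, D * 2 / 2 ^+ m < e / 3.
    apply/not_existsP => H; suff : e / 3 <= 0 by rewrite leNgt divr_gt0.
    by apply: (@le_dyadic_le0 _ _ (D * 2)) => m; rewrite leNgt; apply/negP/H.
  have Sc : {for q, continuous (fun s => \sum_(k < m) Y k i s)}.
    apply: cvg_big => [|k _]; first exact: add_continuous.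
    exact: Yc.
  have /cvgrPdist_lt /(_ (e / 3)) := Sc; rewrite divr_gt0 // => /(_ isT) Sq.
  have qab : \forall s \near q, a < s < b.
    have := @near_in_itvoo R a b q; rewrite in_itv /= aq qb => /(_ isT).
    by apply: filterS => s /=; rewrite in_itv.
  near=> s; have sab : a < s < b by near: s.
  have Ss : `|\sum_(k < m) Y k i q - \sum_(k < m) Y k i s| < e / 3 by near: s.
  have Zq : `|Z i q - \sum_(k < m) Y k i q| < e / 3.
    by apply: le_lt_trans mE; apply: ZE => // k; apply: YD; rewrite !ltW.
  have Zs : `|Z i s - \sum_(k < m) Y k i s| < e / 3.
    have /andP[/ltW aS /ltW sb] := sab.
    by apply: le_lt_trans mE; apply: ZE => [|k]; [apply: abI|apply: YD]; rewrite aS sb.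
  move: Ss Zq Zs; rewrite !ltr_norml => /andP[? ?] /andP[? ?] /andP[? ?].
  by apply/andP; split; lra.
(* Passing to the limit in the integral equation for the partial sums. *)
have ZP i q : I q -> Z i q = y0 i 0 + P (rhs Z i) q.
  move=> Iq; have [a [b [/andP[aq0 q0b] /andP[aq qb] abI]]] :=
    open_itv_segment I_open I_itv I_q0 Iq.
  have aq0b : a <= q0 <= b by rewrite !ltW.
  have aqb : a <= q <= b by rewrite !ltW.
  have [D [K [D0 K0 NK YD]]] := bound a b aq0b abI.
  have [P0 Pd] := PE _ (@rhs_continuous _ Zc i).
  have Td m s : I s -> is_derive s 1 (fun s => \sum_(k < m) Y k.+1 i s)
      (rhs (fun j s => \sum_(k < m) Y k j s) i s).
    move=> Is; have -> : (fun s => \sum_(k < m) Y k.+1 i s) = \sum_(k < m) Y k.+1 i.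
      by apply/funext => x; rewrite fct_sumE.
    have -> : rhs (fun j s => \sum_(k < m) Y k j s) i s = \sum_(k < m) rhs (Y k) i s.
      rewrite /rhs exchange_big /=; apply: eq_bigr => j _.
      by rewrite mulr_sumr.
    by apply: is_derive_sum => k; apply: Yd.
  apply/eqP; rewrite -subr_eq0 -normr_le0.
  apply: (@le_dyadic_le0 _ _ (D * 2 + K * (D * 2) * (b - a))) => m.
  have E1 : `|Z i q - \sum_(k < m.+1) Y k i q| <= D * 2 / 2 ^+ m.
    apply: le_trans (ZE i q D Iq _ m.+1) _; first by move=> k; apply: YD.
    rewrite ler_wpM2l ?mulr_ge0 // lef_pV2 ?posrE ?exprn_gt0 //.
    by rewrite ler_weXn2l // ler1n.
  have E2 : `|P (rhs Z i) q - \sum_(k < m) Y k.+1 i q| <=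
      K * (D * 2) / 2 ^+ m * (b - a).
    have d0 : 0 <= D * 2 / 2 ^+ m by rewrite divr_ge0 ?mulr_ge0 ?exprn_ge0.
    apply: (@le_trans _ _ (K * (D * 2) / 2 ^+ m * `|q - q0|)); last first.
      rewrite ler_wpM2l //; first by rewrite -mulrA mulr_ge0 // ltW.
      by rewrite ler_norml; apply/andP; split; lra.
    have -> : P (rhs Z i) q - \sum_(k < m) Y k.+1 i q =
      (P (rhs Z i) - (fun s => \sum_(k < m) Y k.+1 i s)) q -
      (P (rhs Z i) - (fun s => \sum_(k < m) Y k.+1 i s)) q0.
      have T0 : \sum_(k < m) Y k.+1 i q0 = 0 by rewrite big1.
      by rewrite !fctE P0 T0 !subr0.
    apply: (bounded_derive_growth aq0b aqb) => s sab.
      apply: is_deriveB; first exact/Pd/abI.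
      exact/Td/abI.
    rewrite -mulrA /rhs -sumrB; apply: le_trans (ler_norm_sum _ _ _) _.
    apply: (@le_trans _ _ (\sum_j `|N s i j| * (D * 2 / 2 ^+ m))).
      apply: ler_sum => j _; rewrite -mulrBr normrM ler_wpM2l //.
      by apply: ZE => [|k]; [exact: abI|exact: YD].
    by rewrite -mulr_suml ler_wpM2r // NK.
  rewrite (_ : Z i q - _ = (Z i q - \sum_(k < m.+1) Y k i q) -
      (P (rhs Z i) q - \sum_(k < m) Y k.+1 i q)); last first.
    by rewrite big_ord_recl /=; ring.
  apply: le_trans (ler_normB _ _) _; apply: le_trans (lerD E1 E2) _.
  by rewrite le_eqVlt; apply/orP; left; apply/eqP; field; rewrite expf_neq0.
exists Z; split => [i|q i Iq].
  by rewrite ZP //; have [-> _] := PE _ (@rhs_continuous _ Zc i); rewrite addr0.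
have [_ /(_ q Iq) Pd] := PE _ (@rhs_continuous _ Zc i).
apply: (@near_eq_is_derive _ _ _ (cst (y0 i 0) + P (rhs Z i))).
  have := open_nbhs_nbhs (conj I_open Iq); apply: filterS => s Is.
  by rewrite ZP.
rewrite -[X in is_derive _ _ _ X]add0r; exact: is_deriveD.
Unshelve. all: by end_near. Qed.

End LinearODEExistence.

(** * Matrix calculus and the Levi-Civita connection in a coframe *)

Section MatrixCalculus.
Context {R : realType}.

(** Entry by entry, because the computations are; mx_is_deriveP gives the link with
    derivability for the matrix norm. *)
Definition mx_is_derive m n (s : R) (M : R -> 'M[R]_(m, n)) (dM : 'M[R]_(m, n)) :=
  forall i j, is_derive s 1 (fun u => M u i j) (dM i j).

Lemma mx_is_deriveP m n s (M : R -> 'M[R]_(m, n)) dM :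
  mx_is_derive s M dM <-> derivable M s 1 /\ derive1 M s = dM.
Proof.
split=> [Md|[Md <-] i j].
  have dM' : derivable M s 1 by apply/derivable_mxP => i j; case: (Md i j).
  split=> //; rewrite derive1E derive_mx //.
  by apply/matrixP => i j; rewrite mxE; exact: derive_val.
rewrite derive1E derive_mx // mxE; apply: derivableP.
exact: (derivable_mxP M s 1).1.
Qed.

Lemma is_derive_ext (f g : R -> R) (s d : R) : f =1 g -> is_derive s 1 f d -> is_derive s 1 g d.
Proof. by move=> /funext ->. Qed.

Lemma mx_is_derive_mul m n p s (M : R -> 'M[R]_(m, n)) (L : R -> 'M[R]_(n, p)) dM dL :
  mx_is_derive s M dM -> mx_is_derive s L dL ->
  mx_is_derive s (fun u => M u *m L u) (dM *m L s + M s *m dL).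
Proof.
move=> Md Ld i k; rewrite !mxE -big_split /=.
apply: (@is_derive_ext (\sum_(j < n) ((fun u => M u i j) * (fun u => L u j k)))).
  by move=> u; rewrite mxE fct_sumE; apply: eq_bigr => j _; rewrite fctE.
apply: is_derive_sum => j; have := is_deriveM (Md i j) (Ld j k).
by rewrite /GRing.scale /= addrC (mulrC (dM i j)).
Qed.

Lemma mx_is_derive_cst m n s (M : 'M[R]_(m, n)) : mx_is_derive s (cst M) 0.
Proof. by move=> i j; rewrite mxE; exact: is_derive_cst. Qed.

Lemma mx_zero_derive_const m n (M : R -> 'M[R]_(m, n)) :
  (forall s, 0 <= s <= 1 -> mx_is_derive s M 0) -> M 1 = M 0.
Proof.
move=> Md; apply/matrixP => i j.
apply: (zero_derive_const (f := fun s => M s i j)) => // s s01.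
by have := Md s s01 i j; rewrite mxE.
Qed.

Definition mx_differentiable n k m (M : 'cV[R]_n -> 'M[R]_(k, m)) (x : 'cV[R]_n) :=
  forall a b, differentiable (fun y => M y a b) x.

Definition mx_pd n k m (i : 'I_n) (M : 'cV[R]_n -> 'M[R]_(k, m)) (x : 'cV[R]_n) :
    'M[R]_(k, m) :=
  \matrix_(a, b) pd i (fun y => M y a b) x.

Lemma is_derive_along n (f : 'cV[R]_n -> R) (gam : R -> 'cV[R]_n) (dgam : 'cV[R]_n) s :
  differentiable f (gam s) -> mx_is_derive s gam dgam ->
  is_derive s 1 (f \o gam) (\sum_i dgam i 0 * pd i f (gam s)).
Proof.
move=> fd /mx_is_deriveP[gd gE].
have gdiff : differentiable gam s by apply/derivable1_diffP.
have cd : differentiable (f \o gam) s by exact: differentiable_comp.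
suff -> : \sum_i dgam i 0 * pd i f (gam s) = 'D_1 (f \o gam) s.
  by apply: derivableP; exact: diff_derivable.
rewrite deriveE // diff_comp //=.
have -> : 'd gam s 1 = dgam by rewrite -deriveE // -derive1E.
rewrite [in RHS](matrix_sum_delta dgam) linear_sum /=.
apply: eq_bigr => i _; rewrite big_ord1 linearZ /= -deriveE //.
Qed.

Lemma mx_is_derive_along n k m (M : 'cV[R]_n -> 'M[R]_(k, m)) gam dgam s :
  mx_differentiable M (gam s) -> mx_is_derive s gam dgam ->
  mx_is_derive s (M \o gam) (\sum_i dgam i 0 *: mx_pd i M (gam s)).
Proof.
move=> Md gd a b; rewrite summxE.
rewrite (eq_bigr (fun i => dgam i 0 * pd i (fun y => M y a b) (gam s))).
  exact: (is_derive_along (f := fun y => M y a b)).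
by move=> i _; rewrite !mxE.
Qed.

Lemma mx_differentiable_mul n k m p (M : 'cV[R]_n -> 'M[R]_(k, m))
    (L : 'cV[R]_n -> 'M[R]_(m, p)) x :
  mx_differentiable M x -> mx_differentiable L x ->
  mx_differentiable (fun y => M y *m L y) x.
Proof.
move=> Md Ld a b.
rewrite (_ : (fun _ => _) = \sum_(j < m) ((fun y => M y a j) * (fun y => L y j b))).
  by apply: differentiable_sum => j; exact: differentiableM.
by apply/funext => y; rewrite mxE fct_sumE.
Qed.

Lemma mx_pd_mul n k m p (M : 'cV[R]_n -> 'M[R]_(k, m))
    (L : 'cV[R]_n -> 'M[R]_(m, p)) x i :
  mx_differentiable M x -> mx_differentiable L x ->
  mx_pd i (fun y => M y *m L y) x = mx_pd i M x *m L x + M x *m mx_pd i L x.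
Proof.
move=> Md Ld; apply/matrixP => a b; rewrite !mxE -big_split /=.
rewrite (_ : (fun _ => _) = \sum_(j < m) ((fun y => M y a j) * (fun y => L y j b))); last first.
  by apply/funext => y; rewrite mxE fct_sumE.
rewrite /pd derive_sum => [|j]; last by apply: diff_derivable; exact: differentiableM.
apply: eq_bigr => j _; rewrite deriveM; try exact: diff_derivable.
rewrite !mxE /pd /GRing.scale /= [RHS]addrC; congr (_ + _); exact: mulrC.
Qed.

Lemma mx_pd_tr n k m (M : 'cV[R]_n -> 'M[R]_(k, m)) x i :
  mx_pd i (fun y => (M y)^T) x = (mx_pd i M x)^T.
Proof.
apply/matrixP => a b; rewrite !mxE; congr (derive _ x _).
by apply/funext => y; rewrite mxE.
Qed.

Lemma mx_differentiable_tr n k m (M : 'cV[R]_n -> 'M[R]_(k, m)) x :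
  mx_differentiable M x -> mx_differentiable (fun y => (M y)^T) x.
Proof.
by move=> Md a b; rewrite (_ : (fun _ => _) = fun y => M y b a) //; apply/funext => y; rewrite mxE.
Qed.

(** Koszul's formula.  Put H i = th^T eta (d_i th + om_i th).  Skewness of om for
    eta makes d_k g the symmetrization of H k; the vanishing of the torsion
    d th + om /\ th makes the form index of H exchangeable with its column
    index.  The Christoffel sum then collapses to g^-1 H i. *)
Lemma levi_civita_coframe n (U : set 'cV[R]_n) (g th : 'cV[R]_n -> 'M[R]_n)
    (eta : 'M[R]_n) (om : 'I_n -> 'M[R]_n) (x : 'cV[R]_n) :
  open U -> U x -> (forall y, U y -> g y = (th y)^T *m eta *m th y) ->
  mx_differentiable th x -> th x \in unitmx -> eta \in unitmx -> eta^T = eta ->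
  (forall i, (eta *m om i)^T = - (eta *m om i)) ->
  (forall i j, col j (mx_pd i th x + om i *m th x) =
               col i (mx_pd j th x + om j *m th x)) ->
  forall i, th x *m levi_civita g x i = mx_pd i th x + om i *m th x.
Proof.
move=> Uo Ux gE thd thu etau etaT skew tors i.
pose D i := mx_pd i th x + om i *m th x.
pose H i := (th x)^T *m eta *m D i.
have etad : mx_differentiable (fun=> eta) x by move=> a b; exact: differentiable_cst.
have eta0 k : mx_pd k (fun=> eta) x = 0.
  by apply/matrixP => a b; rewrite !mxE; exact: derive_cst.
have thTd := mx_differentiable_tr thd.
have gpd k a b : pd k (fun y => g y a b) x = H k a b + H k b a.
  have -> : pd k (fun y => g y a b) x =
      mx_pd k (fun y => (th y)^T *m eta *m th y) x a b.
    rewrite mxE; apply: near_eq_derive.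
    by have := open_nbhs_nbhs (conj Uo Ux); apply: filterS => y Uy; rewrite gE.
  rewrite !mx_pd_mul //; last exact: mx_differentiable_mul.
  rewrite eta0 mulmx0 addr0 mx_pd_tr.
  have sk : (om k)^T *m eta = - (eta *m om k) by rewrite -{1}etaT -trmx_mul skew.
  have HT : (H k)^T = (mx_pd k th x)^T *m eta *m th x
      - (th x)^T *m eta *m (om k *m th x).
    rewrite /H /D trmx_mul trmx_mul trmxK etaT linearD /= mulmxDl -mulmxA.
    congr (_ + _).
    by rewrite trmx_mul -!mulmxA (mulmxA (om k)^T) sk mulNmx mulmxN !mulmxA.
  have HTab : H k b a = (H k)^T a b by rewrite [RHS]mxE.
  have split3 (P1 P2 P3 : 'M[R]_n) : (P1 + P2) a b = (P2 + P3) a b + (P1 - P3) a b.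
    by rewrite !mxE; ring.
  by rewrite HTab HT /H /D mulmxDr; exact: split3.
have Hsym k a b : H k a b = H b a k.
  have HE c d : H c a d = ((th x)^T *m eta *m col d (D c)) a 0.
    by rewrite colE mulmxA -colE [RHS]mxE.
  by rewrite !HE tors.
have -> : levi_civita g x i = invmx (g x) *m H i.
  apply/matrixP => k j; rewrite !mxE /christoffel mulr_sumr.
  apply: eq_bigr => l _; rewrite !gpd (Hsym i j l) (Hsym j i l) (Hsym j l i).
  by field.
have gu : invmx (g x) = invmx (th x) *m invmx eta *m invmx (th x)^T.
  rewrite gE //; apply: (@row_free_inj _ _ _ _ ((th x)^T *m eta *m th x)).
    by rewrite row_free_unit !unitmx_mul unitmx_tr thu etau.
  rewrite /= mulVmx ?unitmx_mul ?unitmx_tr ?thu ?etau //.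
  rewrite -!mulmxA (mulmxA (invmx (th x)^T)) mulVmx ?unitmx_tr // mul1mx.
  by rewrite (mulmxA (invmx eta)) mulVmx // mul1mx mulVmx.
rewrite gu /H -!mulmxA (mulmxA (th x) (invmx (th x))) mulmxV // mul1mx.
by rewrite (mulmxA (invmx (th x)^T)) mulVmx ?unitmx_tr // mul1mx mulmxA mulVmx // mul1mx.
Qed.

End MatrixCalculus.

(** * Parallel transport in a moving frame *)

Section Gauge.
Context {R : realType} {n r : nat}.
Variables (U : set 'cV[R]_n) (A : @conn R n r) (G Gi : 'cV[R]_n -> 'M[R]_r)
  (Om : 'cV[R]_n -> 'I_n -> 'M[R]_r).
Hypotheses (U_open : open U) (GK : forall x, U x -> G x *m Gi x = 1%:M)
  (Gd : forall x, U x -> mx_differentiable G x)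
  (Gid : forall x, U x -> mx_differentiable Gi x)
  (GA : forall x i, U x -> G x *m A x i = mx_pd i G x + Om x i *m G x).

Definition gauge_speed (gam : R -> 'cV[R]_n) (s : R) : 'M[R]_r :=
  \sum_i derive1 gam s i 0 *: Om (gam s) i.

(** G turns the covariant derivative with coefficients A into the one with
    coefficients Om; the differentiability of the inverse Gi is what allows V to
    be recovered from G V. *)
Lemma parallel_gauge (gam : R -> 'cV[R]_n) V :
  (forall s, 0 <= s <= 1 -> derivable gam s 1) ->
  (forall s, 0 <= s <= 1 -> U (gam s)) ->
  parallel A gam V <-> (forall s, 0 <= s <= 1 ->
    mx_is_derive s (fun u => G (gam u) *m V u)
      (- gauge_speed gam s *m (G (gam s) *m V s))).
Proof.
move=> gd gU.
have Gam s : 0 <= s <= 1 -> mx_is_derive s gam (derive1 gam s).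
  by move=> s01; apply/mx_is_deriveP; split=> //; exact: gd.
have dG s : 0 <= s <= 1 -> mx_is_derive s (fun u => G (gam u))
    (\sum_i derive1 gam s i 0 *: mx_pd i G (gam s)).
  by move=> s01; apply: mx_is_derive_along; [exact/Gd/gU|exact: Gam].
have key s dV : 0 <= s <= 1 ->
    (\sum_i derive1 gam s i 0 *: mx_pd i G (gam s)) *m V s + G (gam s) *m dV =
    - gauge_speed gam s *m (G (gam s) *m V s) +
    G (gam s) *m (dV + \sum_i derive1 gam s i 0 *: (A (gam s) i *m V s)).
  move=> s01.
  have -> : G (gam s) *m (dV + \sum_i derive1 gam s i 0 *: (A (gam s) i *m V s)) =
      G (gam s) *m dV + ((\sum_i derive1 gam s i 0 *: mx_pd i G (gam s)) *m V s
        + gauge_speed gam s *m (G (gam s) *m V s)).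
    rewrite mulmxDr /gauge_speed !mulmx_suml mulmx_sumr -big_split /=.
    congr (_ + _); apply: eq_bigr => i _.
    rewrite -!scalemxAl -scalemxAr -scalerDr (mulmxA (G _) (A _ _)) GA; last exact: gU.
    by rewrite mulmxDl mulmxA.
  by rewrite mulNmx addrC [RHS]addrC -!addrA subrr addr0.
split=> [Vp s s01|Vg s s01].
  have [Vd V0] := Vp s s01.
  have dV : mx_is_derive s V (derive1 V s) by apply/mx_is_deriveP.
  have := mx_is_derive_mul (dG s s01) dV.
  by rewrite key // V0 mulmx0 addr0.
have GKi x : U x -> Gi x *m G x = 1%:M by move=> Ux; apply/mulmx1C/GK.
have nU : \forall u \near s, U (gam u).
  have gc : {for s, continuous gam}.
    by apply: differentiable_continuous; apply/derivable1_diffP/gd.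
  by apply: gc; apply: open_nbhs_nbhs; split=> //; exact: gU.
have dGi : mx_is_derive s (fun u => Gi (gam u))
    (\sum_i derive1 gam s i 0 *: mx_pd i Gi (gam s)).
  by apply: mx_is_derive_along; [exact/Gid/gU|exact: Gam].
have {dGi} dV := mx_is_derive_mul dGi (Vg s s01).
set dVs := (X in mx_is_derive s _ X) in dV.
have {}dV : mx_is_derive s V dVs.
  move=> i j; apply: near_eq_is_derive (dV i j).
  by apply: filterS nU => u Uu; rewrite mulmxA GKi // mul1mx.
have /mx_is_deriveP[Vd VE] := dV; split=> //; rewrite VE.
have /mx_is_deriveP[_ E1] := mx_is_derive_mul (dG s s01) dV.
have /mx_is_deriveP[_ E2] := Vg s s01.
move: E1; rewrite E2 key // -[LHS]addr0 => /addrI /esym E.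
have := congr1 (mulmx (Gi (gam s))) E.
by rewrite mulmxA GKi ?mul1mx ?mulmx0 //; exact: gU.
Qed.

(** The columns of E are the parallel sections, read in the frame, whose initial
    values form the frame at gam 0. *)
Lemma transport_in_gauge (gam : R -> 'cV[R]_n) Q :
  (forall s, 0 <= s <= 1 -> derivable gam s 1) ->
  (forall s, 0 <= s <= 1 -> U (gam s)) -> transport A gam Q ->
  exists E : R -> 'M[R]_r, [/\ E 0 = 1%:M,
    forall s, 0 <= s <= 1 -> mx_is_derive s E (- gauge_speed gam s *m E s)
    & E 1 = G (gam 1) *m Q *m Gi (gam 0)].
Proof.
move=> gd gU gQ.
have U0 : U (gam 0) by apply: gU; rewrite lexx ler01.
have /choice[V VE] (j : 'I_r) := gQ (col j (Gi (gam 0))).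
pose E s : 'M[R]_r := \matrix_(i, j) (G (gam s) *m V j s) i 0.
have mulE m s (M : 'M[R]_(m, r)) i j : (M *m E s) i j = (M *m (G (gam s) *m V j s)) i 0.
  by rewrite [LHS]mxE [RHS]mxE; apply: eq_bigr => k _; rewrite [E s k j]mxE.
exists E; split.
- apply/matrixP => i j; rewrite [LHS]mxE; have [_ -> _] := VE j.
  by rewrite colE mulmxA GK // mul1mx !mxE eqxx andbT.
- move=> s s01 i j; rewrite mulE.
  have [/(parallel_gauge _ gd gU) /(_ s s01) /(_ i 0) Vd _ _] := VE j.
  by rewrite (_ : (fun _ => _) = fun u => (G (gam u) *m V j u) i 0) //;
    apply/funext => u; rewrite mxE.
- apply/matrixP => i j; rewrite [LHS]mxE; have [_ _ ->] := VE j.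
  by rewrite colE !mulmxA -colE mxE.
Qed.

Lemma gauge_transport (gam : R -> 'cV[R]_n) (E : R -> 'M[R]_r) :
  (forall s, 0 <= s <= 1 -> derivable gam s 1) ->
  (forall s, 0 <= s <= 1 -> U (gam s)) -> E 0 = 1%:M ->
  (forall s, 0 <= s <= 1 -> mx_is_derive s E (- gauge_speed gam s *m E s)) ->
  transport A gam (Gi (gam 1) *m E 1 *m G (gam 0)).
Proof.
move=> gd gU E0 Ed v.
have GKi x : U x -> Gi x *m G x = 1%:M by move=> Ux; apply/mulmx1C/GK.
exists (fun s => Gi (gam s) *m (E s *m (G (gam 0) *m v))); split.
- apply/(parallel_gauge _ gd gU) => s s01.
  have nU : \forall u \near s, U (gam u).
    have gc : {for s, continuous gam}.
      by apply: differentiable_continuous; apply/derivable1_diffP/gd.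
    by apply: gc; apply: open_nbhs_nbhs; split=> //; exact: gU.
  have dE := mx_is_derive_mul (Ed s s01) (mx_is_derive_cst s (G (gam 0) *m v)).
  move=> i j; rewrite (mulmxA (G (gam s))) GK ?mul1mx; last exact: gU.
  have := dE i j; rewrite mulmx0 addr0 -mulmxA => dEij.
  apply: near_eq_is_derive dEij; apply: filterS nU => u Uu.
  by rewrite (mulmxA (G (gam u))) GK // mul1mx.
- by rewrite E0 mul1mx mulmxA GKi ?mul1mx //; apply: gU; rewrite lexx ler01.
- by rewrite !mulmxA.
Qed.

End Gauge.

Section InverseGauge.
Context {R : realType} {n r : nat}.

Lemma differentiable_bigprod (I : Type) (s : seq I) (P : pred I)
    (f : I -> 'cV[R]_n -> R) x :
  (forall i, differentiable (f i) x) ->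
  differentiable (fun y => \prod_(i <- s | P i) f i y) x.
Proof.
move=> fd; rewrite (_ : (fun _ => _) = \prod_(i <- s | P i) f i).
  apply: (big_ind (fun g => differentiable g x)) => //.
  - by move=> g h gd hd; exact: differentiableM.
by apply/funext => y; rewrite fct_prodE.
Qed.

Lemma differentiable_bigsum (I : Type) (s : seq I) (P : pred I)
    (f : I -> 'cV[R]_n -> R) x :
  (forall i, differentiable (f i) x) ->
  differentiable (fun y => \sum_(i <- s | P i) f i y) x.
Proof.
move=> fd; rewrite (_ : (fun _ => _) = \sum_(i <- s | P i) f i).
  apply: (big_ind (fun g => differentiable g x)) => //.
  by move=> g h gd hd; exact: differentiableD.
by apply/funext => y; rewrite fct_sumE.
Qed.

Lemma differentiable_det k (M : 'cV[R]_n -> 'M[R]_k) x :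
  mx_differentiable M x -> differentiable (fun y => \det (M y)) x.
Proof.
move=> Md; apply: differentiable_bigsum => s.
apply: (@differentiableM _ _ (cst _)); first exact: differentiable_cst.
by apply: differentiable_bigprod => i; exact: Md.
Qed.

(** Cramer's formula shows that the inverse of a differentiable matrix function is
    differentiable. *)
Lemma mx_differentiable_adj_inv (M : 'cV[R]_n -> 'M[R]_r) x :
  M x \in unitmx -> mx_differentiable M x ->
  mx_differentiable (fun y => (\det (M y))^-1 *: \adj (M y)) x.
Proof.
move=> Mu Md a b.
rewrite (_ : (fun _ => _) = fun y => (\det (M y))^-1 * cofactor (M y) b a); last first.
  by apply/funext => y; rewrite !mxE.
apply: differentiableM.
  apply: differentiableV; first exact: differentiable_det.
  by rewrite -unitfE -unitmxE.
apply: (@differentiableM _ _ (cst _)); first exact: differentiable_cst.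
apply: differentiable_det => i j.
rewrite (_ : (fun _ => _) = fun y => M y (lift b i) (lift a j)) //.
by apply/funext => y; rewrite !mxE.
Qed.

End InverseGauge.

(** * A representation of the Heisenberg group *)

Section HeisenbergRepresentation.
Context {R : realType}.
Implicit Types (u v w : 'cV[R]_5) (L : seq (seq R)).

(** Rows may be listed without their trailing zeros, which nth supplies. *)
Definition list_mx L : 'M[R]_(1 + (5 + 1)) :=
  \matrix_(i, j) nth 0 (nth [::] L i) j.

Definition sum7 (F : nat -> R) := F 0%N + F 1%N + F 2%N + F 3%N + F 4%N + F 5%N + F 6%N.

Lemma sum_ord7 (F : nat -> R) : \sum_(k < 1 + (5 + 1)) F k = sum7 F.
Proof.
change (\sum_(k < 7) F k = sum7 F).
by rewrite /sum7 !big_ord_recr big_ord0 /= add0r.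
Qed.

Lemma list_mxM L1 L2 i j : (list_mx L1 *m list_mx L2) i j =
  sum7 (fun k => nth 0 (nth [::] L1 i) k * nth 0 (nth [::] L2 k) j).
Proof.
apply: etrans (sum_ord7 (fun k => nth 0 (nth [::] L1 i) k * nth 0 (nth [::] L2 k) j)).
by rewrite mxE; apply: eq_bigr => k _; rewrite !mxE.
Qed.

(** A faithful representation of the Heisenberg algebra, strictly lower triangular
    for the blocks 7 = 2 + 3 + 2.  The scalars make a1, a2, - (10 / 3) b2, 10 b1
    the coefficients of a binary cubic, whose polarizations are the two
    subdiagonal blocks: this is the form in which the curvature appears below. *)
Definition h5_rep v : 'M[R]_(1 + (5 + 1)) :=
  let a1 := v ia1 0 in let a2 := v ia2 0 in
  let b1 := v ib1 0 in let b2 := v ib2 0 in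
  list_mx [:: [::]; [::];
    [:: a2 / 10; - a1 / 10];
    [:: - b2 / 3; - a2 / 10];
    [:: b1; b2 / 3];
    [:: v ic 0; 0; - (10 / 3) * b2; - 2 * a2; a1];
    [:: 0; v ic 0; 10 * b1; 20 / 3 * b2; a2]].

Lemma h5_repM u v : h5_rep u *m h5_rep v =
  let x0 := u ia1 0 in let x1 := u ia2 0 in
  let x2 := - (10 / 3) * u ib2 0 in let x3 := 10 * u ib1 0 in
  let y0 := v ia1 0 in let y1 := v ia2 0 in
  let y2 := - (10 / 3) * v ib2 0 in let y3 := 10 * v ib1 0 in
  list_mx [:: [::]; [::]; [::]; [::]; [::];
    [:: (x2 * y1 - 2 * x1 * y2 + x0 * y3) / 10; (2 * x1 * y1 - x2 * y0 - x0 * y2) / 10];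
    [:: (x3 * y1 - 2 * x2 * y2 + x1 * y3) / 10; (2 * x2 * y1 - x3 * y0 - x1 * y2) / 10]].
Proof.
apply/matrixP => -[i hi] [j hj]; rewrite [LHS]list_mxM [RHS]mxE /sum7 /=.
case: i hi => [|[|[|[|[|[|[|//]]]]]]] _; case: j hj => [|[|[|[|[|[|[|//]]]]]]] _ /=;
  by [ring|field].
Qed.

Lemma h5_rep_mul3 u v w : h5_rep u *m (h5_rep v *m h5_rep w) = 0.
Proof.
rewrite h5_repM; apply/matrixP => -[i hi] [j hj]; rewrite [LHS]list_mxM [RHS]mxE /sum7 /=.
case: i hi => [|[|[|[|[|[|[|//]]]]]]] _; case: j hj => [|[|[|[|[|[|[|//]]]]]]] _ /=;
  by ring.
Qed.

Lemma h5_rep_linear (a : R) v w : h5_rep (a *: v + w) = a *: h5_rep v + h5_rep w.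
Proof.
apply/matrixP => -[i hi] [j hj]; rewrite !mxE /=.
case: i hi => [|[|[|[|[|[|[|//]]]]]]] _; case: j hj => [|[|[|[|[|[|[|//]]]]]]] _ /=;
  by [ring|field].
Qed.

Lemma h5_rep_bracket v w :
  h5_rep (h5_bracket v w) = h5_rep v *m h5_rep w - h5_rep w *m h5_rep v.
Proof.
rewrite !h5_repM; apply/matrixP => -[i hi] [j hj]; rewrite !mxE /=.
case: i hi => [|[|[|[|[|[|[|//]]]]]]] _; case: j hj => [|[|[|[|[|[|[|//]]]]]]] _ /=;
  by [ring|field].
Qed.

(** The exponential series: products of three matrices h5_rep v vanish. *)
Definition h5_exp v : 'M[R]_(1 + (5 + 1)) :=
  1%:M + h5_rep v + 2^-1 *: (h5_rep v *m h5_rep v).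

Lemma h5_repD v w : h5_rep (v + w) = h5_rep v + h5_rep w.
Proof. by rewrite -[v]scale1r h5_rep_linear !scale1r. Qed.

Lemma h5_rep0 : h5_rep 0 = 0.
Proof. by apply: (addrI (h5_rep 0)); rewrite -h5_repD !addr0. Qed.

Lemma h5_repZ (a : R) v : h5_rep (a *: v) = a *: h5_rep v.
Proof. by rewrite -[a *: v]addr0 h5_rep_linear h5_rep0 addr0. Qed.

Lemma h5_repN v : h5_rep (- v) = - h5_rep v.
Proof. by rewrite -scaleN1r h5_repZ scaleN1r. Qed.

Lemma h5_rep_sum v : h5_rep v = \sum_i v i 0 *: h5_rep (delta_mx i 0).
Proof.
rewrite {1}(matrix_sum_delta v).
rewrite (eq_bigr (fun i => v i 0 *: delta_mx i 0)) => [|i _]; last by rewrite big_ord1.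
rewrite (big_morph h5_rep h5_repD h5_rep0).
by apply: eq_bigr => i _; rewrite h5_repZ.
Qed.


Lemma h5_exp0 : h5_exp 0 = 1%:M.
Proof. by rewrite /h5_exp h5_rep0 mulmx0 scaler0 !addr0. Qed.

Lemma h5_rep_bracket_mul u v w : h5_rep (h5_bracket u v) *m h5_rep w = 0.
Proof. by rewrite h5_rep_bracket mulmxBl -!mulmxA !h5_rep_mul3 subrr. Qed.

Lemma mul_h5_rep_bracket u v w : h5_rep u *m h5_rep (h5_bracket v w) = 0.
Proof. by rewrite h5_rep_bracket mulmxBr !h5_rep_mul3 subrr. Qed.

Lemma h5_exp_mul v w : h5_exp (H5_mul v w) = h5_exp v *m h5_exp w.
Proof.
have E3 x y z : h5_rep x *m h5_rep y *m h5_rep z = 0 by rewrite -mulmxA h5_rep_mul3.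
rewrite /h5_exp /H5_mul !h5_repD h5_repZ.
rewrite !(mulmxDl, mulmxDr) -!scalemxAl -!scalemxAr.
rewrite !(h5_rep_bracket_mul, mul_h5_rep_bracket, h5_rep_mul3, E3, mulmxA).
rewrite !(mulmx1, mul1mx, mul0mx, mulmx0, scaler0, addr0) h5_rep_bracket.
move: (h5_rep v) (h5_rep w) => X Y.
move: (X *m X) (X *m Y) (Y *m X) (Y *m Y) => XX XY YX YY.
by apply/matrixP => i j; rewrite !mxE; field.
Qed.

Lemma h5_expN v : h5_exp (- v) *m h5_exp v = 1%:M.
Proof. by rewrite -h5_exp_mul H5_mulN h5_exp0. Qed.

Lemma h5_exp_inj : injective h5_exp.
Proof.
move=> v w vw; apply/colP => i.
pose o k (hk : (k < 1 + (5 + 1))%N) := Ordinal hk.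
have E j k : h5_exp v j k = h5_exp w j k by rewrite vw.
have := E (@o 2 isT) (@o 0 isT); have := E (@o 2 isT) (@o 1 isT).
have := E (@o 4 isT) (@o 0 isT); have := E (@o 4 isT) (@o 1 isT).
have := E (@o 5 isT) (@o 0 isT).
rewrite /h5_exp !h5_repM !mxE /= ?mulr0n ?add0r ?mulr0 ?addr0 => E5 E41 E40 E21 E20.
have a2 : v ia2 0 = w ia2 0 by lra.
have a1 : v ia1 0 = w ia1 0 by lra.
have b1 : v ib1 0 = w ib1 0 by lra.
have b2 : v ib2 0 = w ib2 0 by lra.
have c : v ic 0 = w ic 0 by move: E5; rewrite a1 a2 b1 b2 => /addIr.
case: i => -[|[|[|[|[|//]]]]] hi.
- by rewrite (_ : Ordinal hi = ia1) //; exact: val_inj.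
- by rewrite (_ : Ordinal hi = ia2) //; exact: val_inj.
- by rewrite (_ : Ordinal hi = ib1) //; exact: val_inj.
- by rewrite (_ : Ordinal hi = ib2) //; exact: val_inj.
- by rewrite (_ : Ordinal hi = ic) //; exact: val_inj.
Qed.

End HeisenbergRepresentation.

(** * Curves in the Heisenberg group *)

Section Development.
Context {R : realType}.

Lemma is_derive_h5_rep s (v : R -> 'cV[R]_5) dv :
  mx_is_derive s v dv -> mx_is_derive s (fun u => h5_rep (v u)) (h5_rep dv).
Proof.
move=> vd a b; rewrite h5_rep_sum summxE.
apply: (@is_derive_ext _ (\sum_i (h5_rep (delta_mx i 0) a b *: (fun u => v u i 0)))).
  move=> u; rewrite h5_rep_sum summxE fct_sumE; apply: eq_bigr => i _.
  by rewrite [RHS]mxE mulrC.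
apply: is_derive_sum => i; rewrite [X in is_derive _ _ _ X]mxE mulrC; apply: is_deriveZ; exact: vd.
Qed.

Lemma mx_is_derive_eq m n s (M : R -> 'M[R]_(m, n)) dM dM' :
  mx_is_derive s M dM -> dM = dM' -> mx_is_derive s M dM'.
Proof. by move=> Md <-. Qed.

Lemma mx_is_deriveD m n s (M L : R -> 'M[R]_(m, n)) dM dL :
  mx_is_derive s M dM -> mx_is_derive s L dL ->
  mx_is_derive s (fun u => M u + L u) (dM + dL).
Proof.
move=> Md Ld i j; rewrite mxE.
apply: (@is_derive_ext _ ((fun u => M u i j) + (fun u => L u i j))).
  by move=> u; rewrite mxE.
exact: is_deriveD.
Qed.

Lemma mx_is_deriveZ m n s (a : R) (M : R -> 'M[R]_(m, n)) dM :
  mx_is_derive s M dM -> mx_is_derive s (fun u => a *: M u) (a *: dM).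
Proof.
move=> Md i j; rewrite mxE.
apply: (@is_derive_ext _ (a *: (fun u => M u i j))).
  by move=> u; rewrite mxE.
exact: is_deriveZ.
Qed.

Lemma is_derive_h5_exp s (v : R -> 'cV[R]_5) dv : mx_is_derive s v dv ->
  mx_is_derive s (fun u => h5_exp (v u))
    (h5_rep dv + 2^-1 *: (h5_rep dv *m h5_rep (v s) + h5_rep (v s) *m h5_rep dv)).
Proof.
move=> vd; have rd := is_derive_h5_rep vd.
apply: mx_is_derive_eq.
  apply: mx_is_deriveD; last exact: (mx_is_deriveZ _ (mx_is_derive_mul rd rd)).
  exact: (mx_is_deriveD (mx_is_derive_cst _ _) rd).
by rewrite add0r.
Qed.

(** The logarithmic derivatives of the exponential, on either side; the series of
    brackets stops after one term. *)
Lemma h5_exp_left_derive v dv :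
  h5_rep dv + 2^-1 *: (h5_rep dv *m h5_rep v + h5_rep v *m h5_rep dv) =
  h5_rep (dv + 2^-1 *: h5_bracket v dv) *m h5_exp v :> 'M[R]_(1 + (5 + 1)).
Proof.
rewrite /h5_exp !mulmxDr -scalemxAr h5_rep_mul3 scaler0 addr0 mulmx1.
rewrite h5_repD h5_repZ mulmxDl -scalemxAl h5_rep_bracket_mul scaler0 addr0.
rewrite h5_rep_bracket.
move: (h5_rep v *m h5_rep dv) (h5_rep dv *m h5_rep v) (h5_rep dv) => X Y Z.
by apply/matrixP => i j; rewrite !mxE; field.
Qed.

Lemma h5_exp_right_derive v dv :
  h5_rep dv + 2^-1 *: (h5_rep dv *m h5_rep v + h5_rep v *m h5_rep dv) =
  h5_exp v *m h5_rep (dv - 2^-1 *: h5_bracket v dv) :> 'M[R]_(1 + (5 + 1)).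
Proof.
rewrite /h5_exp !mulmxDl -scalemxAl -mulmxA h5_rep_mul3 scaler0 addr0 mul1mx.
rewrite h5_repD h5_repN h5_repZ mulmxDr mulmxN -scalemxAr mul_h5_rep_bracket scaler0 subr0.
rewrite h5_rep_bracket.
move: (h5_rep v *m h5_rep dv) (h5_rep dv *m h5_rep v) (h5_rep dv) => X Y Z.
by apply/matrixP => i j; rewrite !mxE; field.
Qed.

Lemma primitive_exists_unit (f : R -> R) :
  (forall s : R, 0 <= s <= 1 -> {for s, continuous f}) ->
  exists2 G : R -> R, G 0 = 0 & forall s : R, 0 <= s <= 1 -> is_derive s 1 G (f s).
Proof.
move=> fc; pose clamp (s : R) := Num.max 0 (Num.min 1 s).
have clamp01 s : 0 <= clamp s <= 1.
  by rewrite /clamp le_max lexx ge_max ler01 ge_min lexx.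
have clampE s : 0 <= s <= 1 -> clamp s = s.
  by move=> /andP[s0 s1]; rewrite /clamp (min_idPr s1) (max_idPr s0).
have clampc : continuous clamp.
  move=> s; apply: continuous_max; first exact: cst_continuous.
  by apply: continuous_min; [exact: cst_continuous|exact: id].
have [|||s _|G G0 Gd] := @primitive_exists R setT (f \o clamp) 0.
- exact: openT.
- by [].
- by [].
- by apply: continuous_comp; [exact: clampc|exact/fc/clamp01].
by exists G => // s s01; have := Gd s I; rewrite /= clampE.
Qed.

(** The equation for the canonical coordinates v of E is v' + [v, v'] / 2 = - X.
    It is solved by quadratures: first the noncentral coordinates, in which it
    reads v' = - X, and then the central one.  Uniqueness is the constancy of
    h5_exp (- v) E. *)
Lemma h5_development (X : R -> 'cV[R]_5) (E : R -> 'M[R]_(1 + (5 + 1))) :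
  (forall s i, 0 <= s <= 1 -> {for s, continuous (fun u => X u i 0)}) ->
  E 0 = 1%:M ->
  (forall s, 0 <= s <= 1 -> mx_is_derive s E (- h5_rep (X s) *m E s)) ->
  exists v, E 1 = h5_exp v.
Proof.
move=> Xc E0 Ed.
have /choice[V VE] (i : 'I_5) : exists G : R -> R, G 0 = 0 /\
    forall s : R, 0 <= s <= 1 -> is_derive s 1 G (- X s i 0).
  have [s s01|G G0 Gd] := @primitive_exists_unit (fun s => - X s i 0).
    by apply: continuousN; apply: Xc.
  by exists G.
have Vc i s : 0 <= s <= 1 -> {for s, continuous (V i)}.
  by move=> s01; have [_ /(_ s s01) /is_derive_continuous] := VE i.
pose v0 s : 'cV[R]_5 := \col_i V i s.
pose br s := h5_bracket (v0 s) (- X s) ic 0.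
have brE s : br s = - (V ia1 s * X s ib1 0 - V ib1 s * X s ia1 0
    + (V ia2 s * X s ib2 0 - V ib2 s * X s ia2 0)).
  by rewrite /br /h5_bracket !mxE /=; ring.
have brc s : 0 <= s <= 1 -> {for s, continuous (fun u => - (2^-1 * br u))}.
  move=> s01; rewrite (funext brE).
  have VX i j : {for s, continuous (fun u => V i u * X u j 0)}.
    by apply: continuousM; [exact: Vc|exact: Xc].
  apply: continuousN; apply: continuousM; first exact: cst_continuous.
  by apply: continuousN; apply: continuousD; apply: continuousB; exact: VX.
have [C C0 Cd] := primitive_exists_unit brc.
pose v s := v0 s + C s *: delta_mx ic 0.
have brv s w : h5_bracket (v s) w = h5_bracket (v0 s) w.
  by rewrite /h5_bracket !mxE /= !mulr0 !addr0.
have vd s : 0 <= s <= 1 ->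
    mx_is_derive s v (- X s - 2^-1 *: h5_bracket (v s) (- X s)).
  move=> s01 i j; rewrite ord1 brv.
  have -> : (- X s - 2^-1 *: h5_bracket (v0 s) (- X s)) i 0 =
      - X s i 0 + (i == ic)%:R * - (2^-1 * br s).
    by rewrite /br /h5_bracket !mxE /= !eqxx andbT; ring.
  have -> : (fun u => v u i 0) = V i + (i == ic)%:R *: C.
    by apply/funext => u; rewrite !fctE !mxE eqxx andbT mulrC.
  apply: is_deriveD; first by have [_] := VE i; apply.
  by apply: is_deriveZ; exact: Cd.
have bvv s : h5_bracket (v s) (- X s - 2^-1 *: h5_bracket (v s) (- X s)) =
    h5_bracket (v s) (- X s).
  by rewrite /h5_bracket !mxE /= !mulr0 !subr0.
have FE : h5_exp (- v 1) *m E 1 = h5_exp (- v 0) *m E 0.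
  apply: (mx_zero_derive_const (M := fun s => h5_exp (- v s) *m E s)) => s s01.
  have nvd := mx_is_deriveZ (-1) (vd s s01).
  have := mx_is_derive_mul (is_derive_h5_exp nvd) (Ed s s01).
  rewrite h5_exp_right_derive.
  set Y := _ - 2^-1 *: h5_bracket _ _.
  have -> : Y = X s.
    rewrite /Y !scaleN1r.
    have -> : h5_bracket (- v s) (- (- X s - 2^-1 *: h5_bracket (v s) (- X s))) =
        h5_bracket (v s) (- X s).
      rewrite -[RHS]bvv; apply/matrixP => i j; rewrite /h5_bracket !mxE; ring.
    by rewrite opprB addrAC [X in X - _]addrC opprK; apply/matrixP => i j; rewrite !mxE; ring.
  rewrite !scaleN1r mulNmx mulmxN mulmxA subrr => H i j.
  apply: is_derive_ext (H i j) => u; by rewrite scaleN1r.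
have v00 : v 0 = 0.
  apply/matrixP => i j; rewrite !mxE C0 mul0r addr0.
  by have [] := VE i.
exists (v 1); move: FE; rewrite v00 oppr0 h5_exp0 mul1mx E0 => FE.
by rewrite -[LHS]mul1mx -(mulmx1C (h5_expN (v 1))) -mulmxA FE mulmx1.
Qed.

End Development.

(** * A differential algebra of coordinate functions *)

(** JF n stands for the n-th derivative of F at q and Jinv for 1 / F'' at q, while
    JP and JY stand for the functions P = z - F' p + (q F' - F) x and
    Y = y - p x + q x^2 / 2.  In these coordinates on the slices q = const, together
    with x and p - q x, the coframe is polynomial.
    Formal derivation reduces the structure equations to identities between
    rational functions. *)
Inductive jet_var := Jt | Jx | Jp | Jq | Jrho | JP | JY | Jinv | JF of nat.

Inductive jet (K : Type) := JCst of K | JVar of jet_var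
  | JAdd of jet K & jet K | JMul of jet K & jet K.
Arguments JVar {K}.

Declare Scope jet_scope.
Delimit Scope jet_scope with J.
Notation "x + y" := (JAdd x y) : jet_scope.
Notation "x * y" := (JMul x y) : jet_scope.

Section Jets.
Context {R : realType}.
Local Notation jet := (jet R).

Fixpoint jet_eval (e : jet_var -> R) (f : jet) : R :=
  match f with
  | JCst c => c
  | JVar v => e v
  | JAdd f1 f2 => jet_eval e f1 + jet_eval e f2
  | JMul f1 f2 => jet_eval e f1 * jet_eval e f2
  end.

Definition jet_dvar (i : nat) (v : jet_var) : jet :=
  match v, i with
  | Jt, 0 | Jx, 1 | Jp, 3 | Jq, 4 | Jrho, 6 => JCst 1
  | JP, 1 => (JVar Jq * JVar (JF 1) + JCst (-1) * JVar (JF 0))%J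
  | JP, 3 => (JCst (-1) * JVar (JF 1))%J
  | JP, 4 => ((JVar Jq * JVar Jx + JCst (-1) * JVar Jp) * JVar (JF 2))%J
  | JP, 5 => JCst 1
  | JY, 1 => (JVar Jq * JVar Jx + JCst (-1) * JVar Jp)%J
  | JY, 2 => JCst 1
  | JY, 3 => (JCst (-1) * JVar Jx)%J
  | JY, 4 => (JCst 2^-1 * (JVar Jx * JVar Jx))%J
  | Jinv, 4 => (JCst (-1) * (JVar (JF 3) * (JVar Jinv * JVar Jinv)))%J
  | JF n, 4 => JVar (JF n.+1)
  | _, _ => JCst 0
  end.

Fixpoint jet_der (i : nat) (f : jet) : jet :=
  match f with
  | JCst c => JCst 0
  | JVar v => jet_dvar i v
  | JAdd f1 f2 => (jet_der i f1 + jet_der i f2)%J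
  | JMul f1 f2 => (jet_der i f1 * f2 + f1 * jet_der i f2)%J
  end.

Lemma jet_dvarC e i j v : (i < 7)%N -> (j < 7)%N ->
  jet_eval e (jet_der i (jet_dvar j v)) = jet_eval e (jet_der j (jet_dvar i v)).
Proof.
by case: v => [||||||||n]; case: i => [|[|[|[|[|[|[|//]]]]]]] _;
  case: j => [|[|[|[|[|[|[|//]]]]]]] _ //=; field.
Qed.

Lemma jet_derC e i j f : (i < 7)%N -> (j < 7)%N ->
  jet_eval e (jet_der i (jet_der j f)) = jet_eval e (jet_der j (jet_der i f)).
Proof.
move=> i7 j7; elim: f => [c|v|f1 IH1 f2 IH2|f1 IH1 f2 IH2] //=.
- exact: jet_dvarC.
- by rewrite IH1 IH2.
- by rewrite IH1 IH2; ring.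
Qed.

Definition jet_val (F : R -> R) (p : 'cV[R]_(1 + (5 + 1))) (v : jet_var) : R :=
  let u := amb_u p in
  let x := u ix 0 in let y := u iy 0 in let p' := u ip 0 in
  let q := u iq 0 in let z := u iz 0 in
  let D n := F^`(n) q in
  match v with
  | Jt => amb_t p
  | Jx => x
  | Jp => p'
  | Jq => q
  | Jrho => amb_rho p
  | JP => z + - D 1 * p' + (q * D 1 + - D 0) * x
  | JY => y + - p' * x + q * (2^-1 * (x * x))
  | Jinv => (D 2)^-1
  | JF n => D n
  end.

(** The partial derivatives are indexed by nat, like those of jet_der. *)
Definition has_gradient n (f : 'cV[R]_n -> R) (x : 'cV[R]_n) (df : nat -> R) :=
  differentiable f x /\ forall i : 'I_n, pd i f x = df i.

Lemma has_gradient_eq n (f : 'cV[R]_n -> R) x df df' : has_gradient f x df ->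
  (forall i, (i < n)%N -> df i = df' i) -> has_gradient f x df'.
Proof. by move=> [fd fE] dE; split=> // i; rewrite fE dE. Qed.

Lemma has_gradient_cst n (c : R) (x : 'cV[R]_n) : has_gradient (cst c) x (fun=> 0).
Proof. by split=> [|i]; [exact: differentiable_cst|exact: derive_cst]. Qed.

Lemma has_gradientD n (f g : 'cV[R]_n -> R) x df dg :
  has_gradient f x df -> has_gradient g x dg ->
  has_gradient (fun y => f y + g y) x (fun i => df i + dg i).
Proof.
move=> [fd fE] [gd gE]; split=> [|i]; first exact: differentiableD.
by rewrite /pd deriveD; [rewrite -/(pd i f x) -/(pd i g x) fE gE|exact: diff_derivable..].
Qed.

Lemma has_gradientN n (f : 'cV[R]_n -> R) x df :
  has_gradient f x df -> has_gradient (fun y => - f y) x (fun i => - df i).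
Proof.
move=> [fd fE]; split=> [|i]; first exact: differentiableN.
by rewrite /pd deriveN; [rewrite -fE|exact: diff_derivable].
Qed.

Lemma has_gradientM n (f g : 'cV[R]_n -> R) x df dg :
  has_gradient f x df -> has_gradient g x dg ->
  has_gradient (fun y => f y * g y) x (fun i => df i * g x + f x * dg i).
Proof.
move=> [fd fE] [gd gE]; split=> [|i]; first exact: differentiableM.
rewrite /pd deriveM; try exact: diff_derivable.
by rewrite -/(pd i f x) -/(pd i g x) fE gE /GRing.scale /= addrC [X in X + _]mulrC.
Qed.

Lemma has_gradient_coord n (k : 'I_n) (x : 'cV[R]_n) :
  has_gradient (fun y => y k 0) x (fun i => (i == k)%:R).
Proof.
split=> [|i]; first exact: differentiable_coord.
have := @derive_mx R _ n 1 id x (delta_mx i 0) (@derivable_id _ _ _ _).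
rewrite derive_id => /matrixP /(_ k 0); rewrite !mxE /pd => <-.
by rewrite eqxx andbT eq_sym.
Qed.

Lemma has_gradient_comp n (h : R -> R) (f : 'cV[R]_n -> R) x df (dh : R) :
  is_derive (f x) 1 h dh -> has_gradient f x df ->
  has_gradient (h \o f) x (fun i => dh * df i).
Proof.
move=> [/derivable1_diffP hd hE] [fd fE].
split=> [|i]; first exact: differentiable_comp.
rewrite /pd deriveE; last exact: differentiable_comp.
rewrite diff_comp //=.
have -> : 'd f x (delta_mx i 0) = df i by rewrite -deriveE //; exact: fE.
rewrite -[X in 'd h _ X]mulr1 -[_ * 1]/(_ *: _) linearZ /= -deriveE // hE.
by rewrite mulrC.
Qed.

End Jets.

Section JetsOfF.
Context {R : realType} (I : set R) (F : R -> R).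
Hypotheses (I_open : open I) (F_smooth : smooth_on I F)
  (F2_neq0 : forall q, I q -> F^`(2) q != 0).
Local Notation U := (amb_dom (M_F I)).
Local Notation val := (jet_val F).

Lemma is_derive_derive1n n q : I q -> is_derive q 1 (F^`(n)) (F^`(n.+1) q).
Proof. by move=> Iq; rewrite derive1nS derive1E; apply: derivableP; exact: F_smooth. Qed.

Lemma has_gradient_entry k (hk : (k < 1 + (5 + 1))%N) (f : 'cV[R]_(1 + (5 + 1)) -> R) p :
  (forall y, f y = y (Ordinal hk) 0) -> has_gradient f p (fun i => (i == k)%:R).
Proof. by move=> /funext ->; exact: (has_gradient_coord (Ordinal hk)). Qed.

Lemma has_gradient_amb_t p : has_gradient (@amb_t R 5) p (fun i => (i == 0)%:R).
Proof.
apply: (@has_gradient_entry 0 isT) => y; rewrite /amb_t mxE.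
by congr (y _ _); exact: val_inj.
Qed.

Lemma has_gradient_amb_rho p : has_gradient (@amb_rho R 5) p (fun i => (i == 6)%:R).
Proof.
apply: (@has_gradient_entry 6 isT) => y; rewrite /amb_rho !mxE.
by congr (y _ _); exact: val_inj.
Qed.

Lemma has_gradient_amb_u (k : 'I_5) p :
  has_gradient (fun y => @amb_u R 5 y k 0) p (fun i => (i == k.+1)%:R).
Proof.
have hk : (k.+1 < 1 + (5 + 1))%N := (leq_ltn_trans (ltn_ord k) (isT : (5 < 1 + (5 + 1))%N)).
apply: (@has_gradient_entry k.+1 hk) => y; rewrite /amb_u !mxE.
by congr (y _ _); exact: val_inj.
Qed.

Lemma has_gradient_jetF n p : U p ->
  has_gradient (fun y => F^`(n) (amb_u y iq 0)) p
    (fun i => derive1n n.+1 F (amb_u p iq 0) * (i == 4)%:R).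
Proof.
move=> [_ Ip].
exact: (has_gradient_comp (is_derive_derive1n n Ip) (has_gradient_amb_u iq p)).
Qed.

Lemma has_gradient_jet_var v p : U p ->
  has_gradient (fun y => val y v) p (fun i => jet_eval (val p) (jet_dvar i v)).
Proof.
move=> Up.
have ht := has_gradient_amb_t p; have hr := has_gradient_amb_rho p.
have hx := has_gradient_amb_u ix p; have hy := has_gradient_amb_u iy p.
have hp := has_gradient_amb_u ip p; have hq := has_gradient_amb_u iq p.
have hz := has_gradient_amb_u iz p.
have hF n := has_gradient_jetF n Up.
have hc (c : R) := has_gradient_cst c p.
case: v => [||||||||n].
- by apply: has_gradient_eq ht _ => i _; case: i => [|i] //=; case: i => [|[|[|[|[|[|]]]]]].
- by apply: has_gradient_eq hx _ => i _; case: i => [|[|i]] //=; case: i => [|[|[|[|[|]]]]].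
- by apply: has_gradient_eq hp _ => i _; case: i => [|[|[|[|[|[|[|]]]]]]].
- by apply: has_gradient_eq hq _ => i _; case: i => [|[|[|[|[|[|[|]]]]]]].
- by apply: has_gradient_eq hr _ => i _; case: i => [|[|[|[|[|[|[|]]]]]]].
- apply: has_gradient_eq; first exact: (has_gradientD (has_gradientD hz
    (has_gradientM (has_gradientN (hF 1)) hp)) (has_gradientM
    (has_gradientD (has_gradientM hq (hF 1)) (has_gradientN (hF 0))) hx)).
  by move=> i; case: i => [|[|[|[|[|[|[|//]]]]]]] _ /=; ring.
- apply: has_gradient_eq; first exact: (has_gradientD (has_gradientD hy
    (has_gradientM (has_gradientN hp) hx)) (has_gradientM hq
    (has_gradientM (hc 2^-1) (has_gradientM hx hx)))).
  by move=> i; case: i => [|[|[|[|[|[|[|//]]]]]]] _ /=; field.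
- have U0 : F^`(2) (amb_u p iq 0) != 0 by apply: F2_neq0; case: Up.
  have hV : is_derive (F^`(2) (amb_u p iq 0)) 1 (fun y : R => y^-1)
      (- derive1n 2 F (amb_u p iq 0) ^- 2).
    rewrite -[- _]mulr1; exact: (is_deriveV (f := id)).
  apply: has_gradient_eq; first exact: (has_gradient_comp hV (hF 2)).
  move=> i; case: i => [|[|[|[|[|[|[|//]]]]]]] _ /=; rewrite ?mulr0 // mulr1.
  by rewrite mulN1r mulNr -exprVn expr2 mulrC.
- apply: has_gradient_eq; first exact: (hF n).
  by move=> i; case: i => [|[|[|[|[|[|[|//]]]]]]] _ /=; rewrite ?mulr0 ?mulr1.
Qed.

Lemma has_gradient_jet f p : U p ->
  has_gradient (fun y => jet_eval (val y) f) p (fun i => jet_eval (val p) (jet_der i f)).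
Proof.
move=> Up; elim: f => [c|v|f1 IH1 f2 IH2|f1 IH1 f2 IH2] /=.
- exact: has_gradient_cst.
- exact: has_gradient_jet_var.
- exact: has_gradientD.
- exact: has_gradientM.
Qed.

End JetsOfF.

(** * The coframe and its structure equations *)

Section Coframe.
Context {R : realType}.
Local Open Scope jet_scope.
Local Notation c a := (JCst (a%R : R)).
Local Notation t := (JVar Jt).
Local Notation x := (JVar Jx).
Local Notation P := (JVar JP).
Local Notation r := (JVar Jinv).
Local Notation U := (JVar (JF 2)).
Local Notation U1 := (JVar (JF 3)).
Local Notation U2 := (JVar (JF 4)).
Local Notation U3 := (JVar (JF 5)).
Local Notation U4 := (JVar (JF 6)).

Definition jet_w : jet R := JVar Jp + c (-1) * (JVar Jq * x).
Local Notation w := jet_w.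

Definition jet_A : jet R :=
  c 2^-1 * (U * U * x) + c 2^-1 * (U * U1 * w)
  + (c (2 / 5) * (U1 * U1 * r) + c (- 20^-1) * U2) * P.
Definition jet_B : jet R := U * U * w + U1 * P.
Definition jet_C : jet R := c 3 * (U * P).

(** The coefficient of the equation tau'' = - k tau that governs the parallel frame. *)
Definition jet_k : jet R := c (3 / 10) * (U2 * r) + c (- (2 / 5)) * (U1 * U1 * (r * r)).

(** Determined by requiring that the square of Phi for coframe_gram be 2 t^2 rho,
    the square of the Euler field t d/dt. *)
Definition jet_v : jet R :=
  t * JVar Jrho + c 10 * (t * (jet_B * jet_B + c (-1) * (jet_A * jet_C))).

Definition jet_Y : jet R :=
  JVar JY + c 3^-1 * (x * w) + c (- (5 / 3)) * (U1 * (r * r) * (x * P))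
  + c (7 / 6) * (U1 * r * (w * w))
  + (c 15^-1 * (U2 * (r * r)) + c (7 / 15) * (U1 * U1 * (r * (r * r)))) * (w * P)
  + (c 20^-1 * (U3 * (r * (r * r))) + c (- 12^-1) * (U1 * U2 * (r * r * (r * r)))) * (P * P).
Definition jet_Phi5 : jet R :=
  c (-2) * (U1 * (r * (r * r)) * jet_v) + c 15 * (t * (U * U) * jet_Y).
Definition jet_Psi : jet R :=
  c 10 * (U4 * (U * (U * U))) + c (-80) * (U3 * U1 * (U * U))
  + c (-51) * (U2 * U2 * (U * U)) + c 336 * (U2 * (U1 * U1) * U)
  + c (-224) * (U1 * U1 * (U1 * U1)).
Definition jet_res : jet R :=
  c (- (3 / 40)) * (t * (P * P) * (jet_Psi * (r * r * (r * r)))).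

(** A map Phi into R^7 whose restriction to each slice q = const is an isometric
    immersion into a null hyperplane of the flat space with Gram matrix
    coframe_gram.  The slices are thus flat, and all the curvature comes from
    their dependence on q. *)
Definition jet_Phi : seq (jet R) :=
  [:: t * (U * U); c 0; t * jet_A; t * jet_B; t * jet_C; jet_Phi5; r * r * jet_v].

(** The component along dq that must be added to d Phi: the q-dependent part of the
    connection form applied to Phi, corrected by a multiple of Psi in the sixth
    entry. *)
Definition jet_chi : seq (jet R) :=
  [:: c 0; t * (U * U); c (-2) * (jet_k * (t * jet_B));
      t * jet_A + c (-1) * (jet_k * (t * jet_C)); c 2 * (t * jet_B);
      jet_k * (r * r * jet_v) + jet_res; c (-1) * jet_Phi5].

Definition jet_coframe (a j : nat) : jet R :=
  let d := jet_der j (nth (c 0) jet_Phi a) in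
  if j == 4 then d + nth (c 0) jet_chi a else d.

Local Open Scope ring_scope.

(** The value on d/dq of the connection form, which vanishes on the other coordinate
    fields.  The integers and the multiples of k form a curve in sl_2, acting on
    R^2, on binary quadratic forms and on R^2 again, that depends on q alone;
    the other entries form a nilpotent matrix and are proportional to Psi. *)
Definition coframe_om_rows (e : jet_var -> R) : seq (seq R) :=
  let k := jet_eval e jet_k in
  let beta := - (jet_eval e jet_Psi * e JP * e Jinv ^+ 5) / 20 in
  let gamma := 3 / 40 * (jet_eval e jet_Psi * e JP ^+ 2 * e Jinv ^+ 6) in
  [:: [:: 0; - k]; [:: 1]; [:: 0; - beta / 10; 0; - 2 * k]; [:: 0; 0; 1; 0; - k];
     [:: 0; 0; 0; 2]; [:: gamma; 0; 0; 0; beta; 0; k]; [:: 0; - gamma; 0; 0; 0; - 1]].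

Definition coframe_gram : 'M[R]_(1 + (5 + 1)) :=
  list_mx [:: [:: 0; 0; 0; 0; 0; 0; 1]; [:: 0; 0; 0; 0; 0; 1];
     [:: 0; 0; 0; 0; 10]; [:: 0; 0; 0; - 20]; [:: 0; 0; 10]; [:: 0; 1]; [:: 1]].

Definition nat_mx (T : nat -> nat -> R) : 'M[R]_(1 + (5 + 1)) := \matrix_(i, j) T i j.

Lemma list_nat_mxM L T i j : (list_mx L *m nat_mx T) i j =
  sum7 (fun k => nth 0 (nth [::] L i) k * T k j).
Proof.
apply: etrans (sum_ord7 (fun k => nth 0 (nth [::] L i) k * T k j)).
by rewrite mxE; apply: eq_bigr => k _; rewrite !mxE.
Qed.

Lemma coframe_gram_entry T i j : ((nat_mx T)^T *m coframe_gram *m nat_mx T) i j =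
  T 0%N i * T 6%N j + T 6%N i * T 0%N j + T 1%N i * T 5%N j + T 5%N i * T 1%N j
  - 20 * (T 3%N i * T 3%N j) + 10 * (T 2%N i * T 4%N j + T 4%N i * T 2%N j).
Proof.
rewrite -mulmxA mxE; pose L := [:: [:: 0; 0; 0; 0; 0; 0; 1]; [:: 0; 0; 0; 0; 0; 1];
     [:: 0; 0; 0; 0; 10]; [:: 0; 0; 0; - 20]; [:: 0; 0; 10]; [:: 0; 1]; [:: 1]] : seq (seq R).
pose F k := T k i * sum7 (fun l => nth 0 (nth [::] L k) l * T l j).
rewrite (eq_bigr (fun k : 'I_(1 + (5 + 1)) => F k)); last first.
  by move=> k _; rewrite /coframe_gram list_nat_mxM !mxE.
by rewrite (sum_ord7 F) /F /sum7 /=; ring.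
Qed.

Lemma jet_k_der (e : jet_var -> R) j : j != 4 -> jet_eval e (jet_der j jet_k) = 0.
Proof. by case: j => [|[|[|[|[|j]]]]] //= _; ring. Qed.

Lemma jet_res_der (e : jet_var -> R) j : (j < 7)%N -> j != 4 -> e (JF 2) != 0 ->
  e Jinv = (e (JF 2))^-1 ->
  jet_eval e (jet_der j jet_res) =
  3 / 40 * (jet_eval e jet_Psi * e JP ^+ 2 * e Jinv ^+ 6) *
    jet_eval e (jet_der j (JMul (JVar Jt) (JMul (JVar (JF 2)) (JVar (JF 2)))))
  - (jet_eval e jet_Psi * e JP * e Jinv ^+ 5) / 20 *
    jet_eval e (jet_der j (JMul (JVar Jt) jet_C)).
Proof.
move=> j7 j4 U0 inv.
have Psi0 : jet_eval e (jet_der j jet_Psi) = 0.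
  by move: j4; case: j j7 => [|[|[|[|[|[|[|//]]]]]]] _ //= _; ring.
rewrite /jet_res /jet_C; cbn [jet_eval jet_der]; rewrite Psi0 inv.
move: (jet_eval e jet_Psi) => psi; move: j4.
by case: j j7 {Psi0} => [|[|[|[|[|[|[|//]]]]]]] _ //= _; field.
Qed.

(** This is the structure equation of the coframe: the coframe is d Phi + chi dq,
    so its torsion only involves the derivatives of chi transverse to q. *)
Lemma jet_chi_der (e : jet_var -> R) a j : (a < 7)%N -> (j < 7)%N -> j != 4 ->
  e (JF 2) != 0 -> e Jinv = (e (JF 2))^-1 ->
  jet_eval e (jet_der j (nth (JCst 0) jet_chi a)) =
  sum7 (fun b => nth 0 (nth [::] (coframe_om_rows e) a) b
    * jet_eval e (jet_der j (nth (JCst 0) jet_Phi b))).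
Proof.
move=> a7 j7 j4 U0 inv.
have k0 := jet_k_der e j4; have resE := jet_res_der j7 j4 U0 inv.
have U20 : jet_eval e (jet_dvar j (JF 2)) = 0 by move: j4; case: j {j7 k0 resE} => [|[|[|[|[|]]]]].
have r0 : jet_eval e (jet_dvar j Jinv) = 0 by move: j4; case: j {j7 k0 resE U20} => [|[|[|[|[|]]]]].
case: a a7 => [|[|[|[|[|[|[|//]]]]]]] _; rewrite /sum7;
  cbn [jet_eval jet_der jet_chi jet_Phi coframe_om_rows nth]; rewrite ?k0 ?resE;
  cbn [jet_eval jet_der]; rewrite ?U20 ?r0; by field.
Qed.

Lemma jet_coframe_torsion (e : jet_var -> R) a i j :
  (a < 7)%N -> (i < 7)%N -> (j < 7)%N -> e (JF 2) != 0 -> e Jinv = (e (JF 2))^-1 ->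
  let N i j := if i == 4 then
    sum7 (fun b => nth 0 (nth [::] (coframe_om_rows e) a) b * jet_eval e (jet_coframe b j))
    else 0 in
  jet_eval e (jet_der i (jet_coframe a j)) + N i j =
  jet_eval e (jet_der j (jet_coframe a i)) + N j i.
Proof.
move=> a7 i7 j7 U0 inv N; rewrite /N /jet_coframe.
have derD k (f g : jet R) : jet_eval e (jet_der k (JAdd f g)) =
  jet_eval e (jet_der k f) + jet_eval e (jet_der k g) by [].
have [->|i4] := eqVneq i 4; have [->|j4] := eqVneq j 4; rewrite ?derD //.
- by rewrite (jet_derC e _ _ j7) // (jet_chi_der a7 j7 j4 U0 inv) addr0.
- by rewrite (jet_derC e _ i7) // (jet_chi_der a7 i7 i4 U0 inv) addr0.
- by rewrite jet_derC.
Qed.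

End Coframe.

(** * The ambient metric in the coframe *)

Section AmbientMetric.
Context {R : realType}.

Lemma sprod_entry n (a b : 'rV[R]_n) i j :
  sprod a b i j = 2^-1 * (a 0 i * b 0 j + b 0 i * a 0 j).
Proof. by rewrite /sprod !mxE !big_ord1 !mxE. Qed.

Lemma pullback_sprod n (a b : 'rV[R]_n) :
  pullback (sprod a b) = sprod (a *m amb_du) (b *m amb_du).
Proof.
rewrite /pullback /sprod -scalemxAr -scalemxAl mulmxDr mulmxDl !trmx_mul.
by rewrite !mulmxA.
Qed.

Lemma pullbackD n (B C : 'M[R]_n) : pullback (B + C) = pullback B + pullback C.
Proof. by rewrite /pullback mulmxDr mulmxDl. Qed.

Lemma pullbackZ n (c : R) (B : 'M[R]_n) : pullback (c *: B) = c *: pullback B.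
Proof. by rewrite /pullback -scalemxAr -scalemxAl. Qed.

Lemma pullbackN n (B : 'M[R]_n) : pullback (- B) = - pullback B.
Proof. by rewrite -scaleN1r pullbackZ scaleN1r. Qed.

Lemma mul_amb_du (a : 'rV[R]_5) (j : 'I_(1 + (5 + 1))) : (a *m amb_du) 0 j =
  nth 0 [:: 0; a 0 ix; a 0 iy; a 0 ip; a 0 iq; a 0 iz; 0] j.
Proof.
rewrite /amb_du mul_mx_row mulmx0 mul_mx_row mulmx1 mulmx0.
rewrite mxE; case: splitP => k jk; rewrite jk.
  by rewrite (ord1 k) mxE.
rewrite mxE; case: splitP => l kl; rewrite kl /=.
  by case: l kl => -[|[|[|[|[|//]]]]] hl _; congr (a 0 _); exact: val_inj.
by rewrite (ord1 l) mxE.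
Qed.

Lemma dt_form_entry (j : 'I_(1 + (5 + 1))) : @dt_form R 5 0 j = nth 0 [:: 1] j.
Proof.
rewrite mxE; case: splitP => k jk; rewrite jk.
  by rewrite (ord1 k) mxE.
by rewrite mxE /= nth_nil.
Qed.

Lemma drho_form_entry (j : 'I_(1 + (5 + 1))) :
  @drho_form R 5 0 j = nth 0 [:: 0; 0; 0; 0; 0; 0; 1] j.
Proof.
rewrite mxE; case: splitP => k jk; rewrite jk.
  by rewrite (ord1 k) mxE.
rewrite mxE; case: splitP => l kl; rewrite kl /=.
  by rewrite mxE; case: l kl => -[|[|[|[|[|//]]]]].
by rewrite (ord1 l) mxE.
Qed.

Variables (I : set R) (F : R -> R).
Hypothesis (F2_neq0 : forall q, I q -> F^`(2) q != 0).

Definition coframe (p : 'cV[R]_(1 + (5 + 1))) :=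
  nat_mx (fun a j => jet_eval (jet_val F p) (jet_coframe a j)).

(** Both sides are matrices of rational functions of the coordinates and of the
    derivatives of F at q, compared entry by entry; the derivatives of order
    5 and 6 cancel. *)
Lemma amb_metric_coframe p : amb_dom (M_F I) p ->
  amb_g_F F p = (coframe p)^T *m coframe_gram *m coframe p.
Proof.
move=> [_ Ip]; have U0 : jet_val F p (JF 2) != 0 by exact: F2_neq0.
have inv : jet_val F p Jinv = (jet_val F p (JF 2))^-1 by [].
rewrite /amb_g_F /g_F; cbv zeta.
rewrite !(pullbackD, pullbackN, pullbackZ, pullback_sprod).
apply/matrixP => i j; rewrite [RHS]coframe_gram_entry.
set u := amb_u p.
have tE : amb_t p = jet_val F p Jt := erefl.
have rhoE : amb_rho p = jet_val F p Jrho := erefl.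
have pE : u ip 0 = jet_val F p Jp := erefl.
have qE : u iq 0 = jet_val F p Jq := erefl.
have F0E : F (u iq 0) = jet_val F p (JF 0) := erefl.
have F1E : F^`() (u iq 0) = jet_val F p (JF 1) := erefl.
have F2E : F^`(2) (u iq 0) = jet_val F p (JF 2) := erefl.
have F3E : F^`(3) (u iq 0) = jet_val F p (JF 3) := erefl.
have F4E : F^`(4) (u iq 0) = jet_val F p (JF 4) := erefl.
rewrite tE rhoE F2E F3E F4E.
move: (jet_val F p) U0 inv tE rhoE pE qE F0E F1E F2E F3E F4E => e U0 inv tE rhoE pE qE F0E F1E _ _ _.
have w1E k : (omega1 u *m amb_du) 0 k =
    nth 0 [:: 0; - e Jp; 1; 0; 0; 0; 0] (k : 'I_(1 + (5 + 1))).
  rewrite mul_amb_du /omega1 pE; case: k => -[|[|[|[|[|[|[|//]]]]]]] hk;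
    by rewrite /= ?mxE //= ?mxE //= ?mxE /=; ring.
have w3E k : (omega3 u *m amb_du) 0 k =
    nth 0 [:: 0; - e Jq; 0; 1; 0; 0; 0] (k : 'I_(1 + (5 + 1))).
  rewrite mul_amb_du /omega3 qE; case: k => -[|[|[|[|[|[|[|//]]]]]]] hk;
    by rewrite /= ?mxE //= ?mxE //= ?mxE /=; ring.
have w2E k : (omega2 F u *m amb_du) 0 k =
    nth 0 [:: 0; - e (JF 0) + e (JF 1) * e Jq; 0; - e (JF 1); 0; 1; 0] (k : 'I_(1 + (5 + 1))).
  rewrite mul_amb_du /omega2 /omega3 F0E F1E qE; case: k => -[|[|[|[|[|[|[|//]]]]]]] hk;
    by rewrite /= ?mxE //=; ring.
have w4E k : (omega4 *m amb_du) 0 k =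
    nth 0 [:: 0; 0; 0; 0; 1; 0; 0] (k : 'I_(1 + (5 + 1))) :> R.
  by rewrite mul_amb_du; case: k => -[|[|[|[|[|[|[|//]]]]]]] hk; rewrite /= ?mxE.
have w5E k : (omega5 *m amb_du) 0 k =
    nth 0 [:: 0; 1; 0; 0; 0; 0; 0] (k : 'I_(1 + (5 + 1))) :> R.
  by rewrite mul_amb_du; case: k => -[|[|[|[|[|[|[|//]]]]]]] hk; rewrite /= ?mxE.
have addE (M N : 'M[R]_(1 + (5 + 1))) : (M + N) i j = M i j + N i j by rewrite mxE.
have oppE (M : 'M[R]_(1 + (5 + 1))) : (- M) i j = - M i j by rewrite mxE.
have scaleE (a : R) (M : 'M[R]_(1 + (5 + 1))) : (a *: M) i j = a * M i j by rewrite mxE.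
rewrite !(addE, oppE, scaleE, sprod_entry, w1E, w2E, w3E, w4E, w5E).
rewrite !(dt_form_entry, drho_form_entry).
clear - U0 inv i j; wlog ij : i j / (i <= j)%N => [hw|].
  have [/hw //|/ltnW /hw H] := leqP i j.
  by apply: etrans (etrans _ H) _; ring.
move: ij; case: i => -[|[|[|[|[|[|[|//]]]]]]] hi; case: j => -[|[|[|[|[|[|[|//]]]]]]] hj //= _;
rewrite inv {hi hj}; move: U0;
move: (e (JF 0)) (e (JF 1)) (e (JF 2)) (e (JF 3)) (e (JF 4)) (e (JF 5)) (e (JF 6))
  (e Jt) (e Jx) (e Jp) (e Jq) (e Jrho) (e JP) (e JY) => *; by field.
Qed.

End AmbientMetric.

(** * The connection form of the ambient metric *)

Section AmbientConnection.
Context {R : realType}.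

Lemma unitmx_inj_col n (M : 'M[R]_n) :
  (forall v : 'cV[R]_n, M *m v = 0 -> v = 0) -> M \in unitmx.
Proof.
move=> Minj; rewrite -unitmx_tr -row_free_unit -kermx_eq0; apply/eqP/row_matrixP => i.
rewrite row0; apply: trmx_inj; rewrite trmx0; apply: Minj.
by apply: trmx_inj; rewrite trmx_mul trmxK -row_mul mulmx_ker row0 trmx0.
Qed.

Lemma coframe_gram_tr : (@coframe_gram R)^T = coframe_gram.
Proof.
by apply/matrixP => -[i hi] [j hj]; rewrite !mxE /=;
  case: i hi => [|[|[|[|[|[|[|//]]]]]]] _; case: j hj => [|[|[|[|[|[|[|//]]]]]]] _.
Qed.

Lemma coframe_gram_unit : @coframe_gram R \in unitmx.
Proof.
apply: (@mulmx1_unit _ _ _ (list_mx [:: [:: 0; 0; 0; 0; 0; 0; 1]; [:: 0; 0; 0; 0; 0; 1];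
     [:: 0; 0; 0; 0; 10^-1]; [:: 0; 0; 0; - 20^-1]; [:: 0; 0; 10^-1]; [:: 0; 1]; [:: 1]]) _).1.
apply/matrixP => -[i hi] [j hj]; rewrite list_mxM /sum7 mxE /=.
by case: i hi => [|[|[|[|[|[|[|//]]]]]]] hi; case: j hj => [|[|[|[|[|[|[|//]]]]]]] hj /=;
  field.
Qed.

(** The connection form takes its values in the orthogonal algebra of coframe_gram. *)
Lemma coframe_om_skew (e : jet_var -> R) :
  (coframe_gram *m list_mx (coframe_om_rows e))^T =
  - (coframe_gram *m list_mx (coframe_om_rows e)).
Proof.
apply/matrixP => i j; rewrite [LHS]mxE [RHS]mxE !list_mxM /sum7 /coframe_om_rows.
move: (jet_eval e jet_k) (jet_eval e jet_Psi) => k psi.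
case: i => -[|[|[|[|[|[|[|//]]]]]]] hi; case: j => -[|[|[|[|[|[|[|//]]]]]]] hj /=;
  by field.
Qed.

Variables (I : set R) (F : R -> R).
Hypotheses (I_open : open I) (F_smooth : smooth_on I F)
  (F2_neq0 : forall q, I q -> F^`(2) q != 0).
Local Notation U := (amb_dom (M_F I)).

Lemma amb_dom_open : open U.
Proof.
have contf (f : 'cV[R]_(1 + (5 + 1)) -> R) df :
    (forall p, has_gradient f p df) -> continuous f.
  by move=> fg p; apply: differentiable_continuous; case: (fg p).
apply: openI.
  apply: (@open_comp _ _ _ [set s : R | 0 < s]); last exact: open_gt.
  by move=> p _; apply: contf; exact: has_gradient_amb_t.
apply: (@open_comp _ _ (fun p => amb_u p iq 0) I) => // p _.
by apply: (contf (fun p => amb_u p iq 0)) => q; exact: has_gradient_amb_u.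
Qed.

Lemma coframe_differentiable p : U p -> mx_differentiable (coframe F) p.
Proof.
move=> Up a b.
have [fd _] := has_gradient_jet F_smooth F2_neq0 (jet_coframe a b) Up.
by rewrite (_ : (fun _ => _) = (fun y => jet_eval (jet_val F y) (jet_coframe a b))) //;
  apply/funext => y; rewrite mxE.
Qed.

Lemma coframe_pd p i : U p -> mx_pd i (coframe F) p =
  nat_mx (fun a j => jet_eval (jet_val F p) (jet_der i (jet_coframe a j))).
Proof.
move=> Up; apply/matrixP => a b; rewrite !mxE.
have [_ <-] := has_gradient_jet F_smooth F2_neq0 (jet_coframe a b) Up.
by congr (pd i _ p); apply/funext => y; rewrite mxE.
Qed.

(** The linear system is triangular when it is solved for dq, dt, dP, d(p - q x), dx,
    drho and dy in this order. *)
Lemma coframe_unit p : U p -> coframe F p \in unitmx.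
Proof.
move=> [t0 Ip]; have U0 : jet_val F p (JF 2) != 0 by exact: F2_neq0.
have inv : jet_val F p Jinv = (jet_val F p (JF 2))^-1 by [].
have {}t0 : jet_val F p Jt != 0 by rewrite gt_eqF.
apply: unitmx_inj_col => v; rewrite /coframe.
move: (jet_val F p) U0 inv t0 => e U0 inv t0 Mv.
have r0 : e Jinv != 0 by rewrite inv invr_neq0.
pose V k := v (inord k) 0.
have eqn (a : 'I_(1 + (5 + 1))) : sum7 (fun k => jet_eval e (jet_coframe a k) * V k) = 0.
  have := congr1 (fun M : 'cV_(1 + (5 + 1)) => M a 0) Mv; rewrite !mxE => <-.
  rewrite -(sum_ord7 (fun k => jet_eval e (jet_coframe a k) * V k)).
  apply: eq_bigr => k _; rewrite mxE /V; congr (_ * v _ 0).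
  by apply: val_inj; rewrite /= inordK.
have {}eqn a (ha : (a < 1 + (5 + 1))%N) := eqn (Ordinal ha).
have V4 : V 4%N = 0.
  have := eqn 1%N isT; rewrite /sum7 /= => H.
  apply: (@mulfI _ (e Jt * (e (JF 2) * e (JF 2)))); first by rewrite !mulf_neq0.
  by rewrite mulr0 -[RHS]H; ring.
have V0 : V 0%N = 0.
  have := eqn 0%N isT; rewrite /sum7 V4 /= => H.
  apply: (@mulfI _ (e (JF 2) * e (JF 2))); first by rewrite !mulf_neq0.
  by rewrite mulr0 -[RHS]H; ring.
pose dP := (e Jq * e (JF 1) - e (JF 0)) * V 1%N - e (JF 1) * V 3%N + V 5%N.
have dP0 : dP = 0.
  have := eqn 4%N isT; rewrite /sum7 V4 V0 /= => H.
  apply: (@mulfI _ (3 * e Jt * e (JF 2))); first by rewrite !mulf_neq0 // pnatr_eq0.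
  by rewrite mulr0 -[RHS]H /dP; ring.
have dw0 : V 3%N - e Jq * V 1%N = 0.
  have := eqn 3%N isT; rewrite /sum7 V4 V0 /=; set E := (X in X = 0 -> _) => H.
  apply: (@mulfI _ (e Jt * (e (JF 2) * e (JF 2)))); first by rewrite !mulf_neq0.
  suff -> : e Jt * (e (JF 2) * e (JF 2)) * (V 3%N - e Jq * V 1%N) =
      E - e Jt * e (JF 3) * dP by rewrite H dP0 !mulr0 subrr.
  by rewrite /E /dP; ring.
have V1 : V 1%N = 0.
  have := eqn 2%N isT; rewrite /sum7 V4 V0 /=; set E := (X in X = 0 -> _) => H.
  apply: (@mulfI _ (2^-1 * e Jt * (e (JF 2) * e (JF 2)))).
    by rewrite !mulf_neq0 // invr_neq0 // pnatr_eq0.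
  suff -> : 2^-1 * e Jt * (e (JF 2) * e (JF 2)) * V 1%N = E
      - e Jt * (2 / 5 * (e (JF 3) * e (JF 3) * e Jinv) - 20^-1 * e (JF 4)) * dP
      - 2^-1 * e Jt * e (JF 2) * e (JF 3) * (V 3%N - e Jq * V 1%N).
    by rewrite H dP0 dw0 !mulr0 !subr0.
  by rewrite /E /dP; field.
have V3 : V 3%N = 0 by move: dw0; rewrite V1 mulr0 subr0.
have V5 : V 5%N = 0 by move: dP0; rewrite /dP V1 V3 !mulr0 subr0 add0r.
have V6 : V 6%N = 0.
  have := eqn 6%N isT; rewrite /sum7 V4 V0 V1 V3 V5 /= => H.
  apply: (@mulfI _ (e Jinv * e Jinv * e Jt)); first by rewrite !mulf_neq0.
  by rewrite mulr0 -[RHS]H; ring.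
have V2 : V 2%N = 0.
  have := eqn 5%N isT; rewrite /sum7 V4 V0 V1 V3 V5 V6 /= => H.
  apply: (@mulfI _ (15 * (e Jt * (e (JF 2) * e (JF 2))))).
    by rewrite !mulf_neq0 // pnatr_eq0.
  by rewrite mulr0 -[RHS]H; ring.
apply/colP => k; rewrite mxE -[k]inord_val.
by case: k => -[|[|[|[|[|[|[|//]]]]]]] hk; [exact: V0|exact: V1|exact: V2|exact: V3
  |exact: V4|exact: V5|exact: V6].
Qed.

Lemma levi_civita_amb p i : U p ->
  coframe F p *m levi_civita (amb_g_F F) p i = mx_pd i (coframe F) p +
    ((i == 4 :> nat)%:R *: list_mx (coframe_om_rows (jet_val F p))) *m coframe F p.
Proof.
move=> Up; have [_ Ip] := Up; have U0 : jet_val F p (JF 2) != 0 by exact: F2_neq0.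
have inv : jet_val F p Jinv = (jet_val F p (JF 2))^-1 by [].
pose om (i : 'I_(1 + (5 + 1))) :=
  (i == 4 :> nat)%:R *: list_mx (coframe_om_rows (jet_val F p)).
apply: (@levi_civita_coframe R _ U _ _ coframe_gram om) => //.
- exact: amb_dom_open.
- exact: amb_metric_coframe.
- exact: coframe_differentiable.
- exact: coframe_unit.
- exact: coframe_gram_unit.
- exact: coframe_gram_tr.
- by move=> k; rewrite /om -scalemxAr linearZ /= coframe_om_skew scalerN.
- move=> k l; apply/colP => a; rewrite 2!mxE [RHS]mxE [RHS]mxE !coframe_pd //.
  rewrite -!scalemxAl [X in _ + X = _]mxE [X in _ = _ + X]mxE !list_nat_mxM.
  rewrite [X in X + _ = _]mxE [X in _ = X + _]mxE.
  have := jet_coframe_torsion (ltn_ord a) (ltn_ord k) (ltn_ord l) U0 inv.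
  cbv zeta.
  have ifE (b : bool) (x : R) : (if b then x else 0) = b%:R * x by case: b; rewrite ?mul1r ?mul0r.
  by rewrite !ifE.
Qed.

End AmbientConnection.

(** * Reduction of the connection to the Heisenberg algebra *)

Section ParallelFrame.
Context {R : realType}.

Definition h5_vec (a1 a2 b1 b2 c : R) : 'cV[R]_5 :=
  \col_i nth 0 [:: a1; a2; b1; b2; c] i.

(** The blocks are M = ((a, b), (c, d)), its symmetric square and M diag(1, -1): when
    b = a' and d = c' for two solutions a, c of tau'' = - k tau, this is the
    frame that is parallel for the sl_2 part of the connection form. *)
Definition sl2_blocks (a b c d : R) : 'M[R]_(1 + (5 + 1)) :=
  list_mx [:: [:: a; b]; [:: c; d];
    [:: 0; 0; a ^+ 2; 2 * a * b; b ^+ 2];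
    [:: 0; 0; a * c; a * d + b * c; b * d];
    [:: 0; 0; c ^+ 2; 2 * c * d; d ^+ 2];
    [:: 0; 0; 0; 0; 0; a; - b]; [:: 0; 0; 0; 0; 0; c; - d]].

(** The derivative of sl2_blocks along a path that satisfies a' = b, c' = d, b' = - k a
    and d' = - k c. *)
Definition sl2_blocks_dq (k a b c d : R) : 'M[R]_(1 + (5 + 1)) :=
  list_mx [:: [:: b; - k * a]; [:: d; - k * c];
    [:: 0; 0; 2 * a * b; 2 * b ^+ 2 - 2 * k * a ^+ 2; - 2 * k * a * b];
    [:: 0; 0; a * d + b * c; 2 * b * d - 2 * k * a * c; - k * (a * d + b * c)];
    [:: 0; 0; 2 * c * d; 2 * d ^+ 2 - 2 * k * c ^+ 2; - 2 * k * c * d];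
    [:: 0; 0; 0; 0; 0; b; k * a]; [:: 0; 0; 0; 0; 0; d; k * c]].

Lemma sl2_blocks_unit a b c d : a * d - b * c = 1 -> sl2_blocks a b c d \in unitmx.
Proof.
move=> det1; apply: (@mulmx1_unit _ _ _ (list_mx [:: [:: d; - b]; [:: - c; a];
    [:: 0; 0; d ^+ 2; - 2 * b * d; b ^+ 2];
    [:: 0; 0; - c * d; a * d + b * c; - a * b];
    [:: 0; 0; c ^+ 2; - 2 * a * c; a ^+ 2];
    [:: 0; 0; 0; 0; 0; d; - b]; [:: 0; 0; 0; 0; 0; c; - a]]) _).1.
have ad : a * d = 1 + b * c by rewrite -det1; ring.
apply/matrixP => -[i hi] [j hj]; rewrite list_mxM /sum7 mxE /=.
by case: i hi => [|[|[|[|[|[|[|//]]]]]]] hi; case: j hj => [|[|[|[|[|[|[|//]]]]]]] hj /=;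
  rewrite ?mulr1n ?mulr0n; ring: ad.
Qed.

(** The frame S = sl2_blocks satisfies S' = S N for the part N of the connection form
    that depends on q alone.  Conjugation by S turns the nilpotent part
    into the point of the twisted cubic with parameters a, c and a central term. *)
Lemma sl2_blocks_om (e : jet_var -> R) (a b c d : R) : a * d - b * c = 1 ->
  let beta := - (jet_eval e jet_Psi * e JP * e Jinv ^+ 5) / 20 in
  let gamma := 3 / 40 * (jet_eval e jet_Psi * e JP ^+ 2 * e Jinv ^+ 6) in
  sl2_blocks a b c d *m list_mx (coframe_om_rows e) =
  sl2_blocks_dq (jet_eval e jet_k) a b c d +
  h5_rep (h5_vec (beta * a ^+ 3) (beta * a ^+ 2 * c) (beta * c ^+ 3 / 10)
    (- (3 / 10) * beta * a * c ^+ 2) gamma) *m sl2_blocks a b c d.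
Proof.
move=> det1; rewrite /coframe_om_rows; cbv zeta.
move: (- _ / 20) (3 / 40 * _) (jet_eval e jet_k) => beta gamma k.
have ad : a * d = 1 + b * c by rewrite -det1; ring.
apply/matrixP => -[i hi] [j hj].
rewrite [RHS]mxE !list_mxM [X in _ = X + _]mxE /sum7 !mxE /=.
case: i hi => [|[|[|[|[|[|[|//]]]]]]] hi; case: j hj => [|[|[|[|[|[|[|//]]]]]]] hj /=;
  by field: ad.
Qed.

End ParallelFrame.

Section AmbientGauge.
Context {R : realType}.
Variables (I : set R) (F : R -> R).
Hypotheses (I_open : open I) (F_smooth : smooth_on I F)
  (F2_neq0 : forall q, I q -> F^`(2) q != 0).
Local Notation U := (amb_dom (M_F I)).

Definition ode_k (q : R) : R :=
  let D n := F^`(n) q in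
  3 / 10 * (D 4%N * (D 2%N)^-1) + - (2 / 5) * (D 3%N * D 3%N * ((D 2%N)^-1 * (D 2%N)^-1)).

Lemma jet_k_ode p : jet_eval (jet_val F p) jet_k = ode_k (amb_u p iq 0).
Proof. by []. Qed.

Lemma jet_Psi_Psi p : jet_eval (jet_val F p) jet_Psi = Psi (F^`(2)) (amb_u p iq 0).
Proof.
rewrite /Psi; cbn [jet_eval jet_Psi].
have E' n : F^`(n.+2) = (F^`(2))^`(n).
  by elim: n => // n IH; rewrite derive1nS IH derive1nS.
have E n : jet_val F p (JF n.+2) = (F^`(2))^`(n) (amb_u p iq 0) by rewrite -E'.
rewrite (E 4%N) (E 3%N) (E 2%N) (E 1%N) (E 0%N) derive1n0.
by move: (_^`(4) _) (_^`(3) _) (_^`(2) _) (_^`(1) _) (_^`(2) _) => *; ring.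
Qed.

Variables (tau1 tau2 sig1 sig2 : R -> R).
Hypotheses (tau1_der : forall q, I q -> is_derive q 1 tau1 (sig1 q))
  (tau2_der : forall q, I q -> is_derive q 1 tau2 (sig2 q))
  (sig1_der : forall q, I q -> is_derive q 1 sig1 (- ode_k q * tau1 q))
  (sig2_der : forall q, I q -> is_derive q 1 sig2 (- ode_k q * tau2 q))
  (wronskian1 : forall q, I q -> tau1 q * sig2 q - sig1 q * tau2 q = 1).

Definition sl2_frame (q : R) := sl2_blocks (tau1 q) (sig1 q) (tau2 q) (sig2 q).

(** The coframe rotated by the parallel SL_2 frame; in it the connection form takes
    its values in the Heisenberg algebra. *)
Definition gauge (p : 'cV[R]_(1 + (5 + 1))) := sl2_frame (amb_u p iq 0) *m coframe F p.

(** The adjugate, unlike invmx, is visibly differentiable in p. *)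
Definition gauge_inv p := (\det (gauge p))^-1 *: \adj (gauge p).

Definition twisted_cubic (q : R) : 'cV[R]_5 :=
  h5_vec (tau1 q ^+ 3) (tau1 q ^+ 2 * tau2 q) (tau2 q ^+ 3 / 10)
    (- (3 / 10) * tau1 q * tau2 q ^+ 2) 0.

Definition cubic_coef (q : R) : R := - (Psi (derive1n 2 F) q * (derive1n 2 F q)^-1 ^+ 5) / 20.

Definition central_coef (q : R) : R := 3 / 40 * (Psi (derive1n 2 F) q * (derive1n 2 F q)^-1 ^+ 6).

(** The connection form on d/dq, in the gauge: linear in P outside of the centre,
    quadratic in P on it. *)
Definition gauge_field (P q : R) : 'cV[R]_5 :=
  (P * cubic_coef q) *: twisted_cubic q + (P ^+ 2 * central_coef q) *: delta_mx ic 0.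

Definition amb_P (p : 'cV[R]_(1 + (5 + 1))) : R := jet_val F p JP.

Definition amb_om p (i : 'I_(1 + (5 + 1))) :=
  (i == 4 :> nat)%:R *: h5_rep (gauge_field (amb_P p) (amb_u p iq 0)).

Lemma sl2_frame_der q : I q ->
  mx_is_derive q sl2_frame
    (sl2_blocks_dq (ode_k q) (tau1 q) (sig1 q) (tau2 q) (sig2 q)).
Proof.
move=> Iq [i hi] [j hj].
have t1 := tau1_der Iq; have t2 := tau2_der Iq.
have s1 := sig1_der Iq; have s2 := sig2_der Iq.
apply: (@is_derive_ext _ (fun u => nth 0 (nth [::]
  [:: [:: tau1 u; sig1 u]; [:: tau2 u; sig2 u];
    [:: 0; 0; tau1 u * tau1 u; 2 * tau1 u * sig1 u; sig1 u * sig1 u];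
    [:: 0; 0; tau1 u * tau2 u; tau1 u * sig2 u + sig1 u * tau2 u; sig1 u * sig2 u];
    [:: 0; 0; tau2 u * tau2 u; 2 * tau2 u * sig2 u; sig2 u * sig2 u];
    [:: 0; 0; 0; 0; 0; tau1 u; - sig1 u]; [:: 0; 0; 0; 0; 0; tau2 u; - sig2 u]] i) j)).
  by move=> u; rewrite mxE -!expr2.
rewrite mxE.
have dM (f g : R -> R) (df dg : R) : is_derive q 1 f df -> is_derive q 1 g dg ->
    is_derive q 1 (fun u => f u * g u) (df * g q + f q * dg).
  move=> fd gd; apply: is_derive_eq (is_deriveM fd gd) _.
  by rewrite /GRing.scale /= addrC [X in X + _]mulrC.
have dD (f g : R -> R) (df dg : R) : is_derive q 1 f df -> is_derive q 1 g dg ->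
    is_derive q 1 (fun u => f u + g u) (df + dg) by exact: is_deriveD.
have dN (f : R -> R) (df : R) : is_derive q 1 f df ->
    is_derive q 1 (fun u => - f u) (- df) by exact: is_deriveN.
have dC (c : R) : is_derive q 1 (fun=> c) 0 by exact: is_derive_cst.
have dE (f : R -> R) (df df' : R) : is_derive q 1 f df -> df = df' ->
    is_derive q 1 f df' by move=> ? <-.
case: i hi => [|[|[|[|[|[|[|//]]]]]]] hi; case: j hj => [|[|[|[|[|[|[|//]]]]]]] hj;
rewrite /= {hi hj}; (eapply dE; [do ![exact: t1|exact: t2|exact: s1|exact: s2
  |apply: dC|apply: dD|apply: dN|apply: dM]|by rewrite /= /GRing.scale /=; ring]).
Qed.

Lemma has_gradient_of_q (f : R -> R) (df : R) p : U p ->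
  is_derive (amb_u p iq 0) 1 f df ->
  has_gradient (fun y => f (amb_u y iq 0)) p (fun i => df * (i == 4)%:R).
Proof. by move=> Up fd; exact: (has_gradient_comp fd (has_gradient_amb_u iq p)). Qed.

Lemma sl2_frame_differentiable p : U p ->
  mx_differentiable (fun y => sl2_frame (amb_u y iq 0)) p.
Proof.
by move=> Up a b; have [] := has_gradient_of_q Up (sl2_frame_der Up.2 a b).
Qed.

Lemma sl2_frame_pd p i : U p -> mx_pd i (fun y => sl2_frame (amb_u y iq 0)) p =
  (i == 4 :> nat)%:R *: sl2_blocks_dq (ode_k (amb_u p iq 0)) (tau1 (amb_u p iq 0))
    (sig1 (amb_u p iq 0)) (tau2 (amb_u p iq 0)) (sig2 (amb_u p iq 0)).
Proof.
move=> Up; apply/matrixP => a b; rewrite mxE [RHS]mxE mulrC.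
by have [_ ->] := has_gradient_of_q Up (sl2_frame_der Up.2 a b).
Qed.

Lemma gauge_differentiable p : U p -> mx_differentiable gauge p.
Proof.
move=> Up; apply: mx_differentiable_mul; first exact: sl2_frame_differentiable.
exact: (coframe_differentiable F_smooth F2_neq0 Up).
Qed.

Lemma gauge_unit p : U p -> gauge p \in unitmx.
Proof.
move=> Up; rewrite unitmx_mul (coframe_unit F2_neq0 Up) andbT.
by apply: sl2_blocks_unit; apply: wronskian1; case: Up.
Qed.

Lemma gaugeK p : U p -> gauge p *m gauge_inv p = 1%:M.
Proof.
move=> /gauge_unit Gu; rewrite -(mulmxV Gu) /gauge_inv.
by rewrite [in RHS]/invmx Gu.
Qed.

Lemma gauge_inv_differentiable p : U p -> mx_differentiable gauge_inv p.
Proof.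
by move=> Up; apply: mx_differentiable_adj_inv; [exact: gauge_unit|exact: gauge_differentiable].
Qed.

Lemma gauge_levi_civita p i : U p ->
  gauge p *m levi_civita (amb_g_F F) p i = mx_pd i gauge p + amb_om p i *m gauge p.
Proof.
move=> Up; rewrite /gauge mx_pd_mul; last 2 first.
- exact: sl2_frame_differentiable.
- exact: (coframe_differentiable F_smooth F2_neq0 Up).
rewrite -mulmxA (levi_civita_amb I_open F_smooth F2_neq0 i Up) mulmxDr.
rewrite (sl2_frame_pd i Up) /sl2_frame /amb_om -!scalemxAl -scalemxAr.
rewrite [in LHS]mulmxA sl2_blocks_om; last by apply: wronskian1; case: Up.
rewrite mulmxDl scalerDr jet_k_ode addrCA addrA; congr (_ + _ + _ *: _).
rewrite -mulmxA; congr (h5_rep _ *m _).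
rewrite jet_Psi_Psi /gauge_field /twisted_cubic /cubic_coef /central_coef /amb_P.
have -> : jet_val F p Jinv = (derive1n 2 F (amb_u p iq 0))^-1 by [].
move: (amb_u p iq 0) (jet_val F p JP) => q P.
move: (Psi _ q) (derive1n 2 F q)^-1 => psi r.
apply/matrixP => a b; rewrite !mxE (ord1 b) /=.
by case: a => -[|[|[|[|[|//]]]]] ha /=; field.
Qed.

End AmbientGauge.

(** * Transport along curves and segments of the ambient space *)

Section Segments.
Context {R : realType}.

Definition segment n (a b : 'cV[R]_n) (s : R) : 'cV[R]_n := a + s *: (b - a).

Lemma segment0 n (a b : 'cV[R]_n) : segment a b 0 = a.
Proof. by rewrite /segment scale0r addr0. Qed.

Lemma segment1 n (a b : 'cV[R]_n) : segment a b 1 = b.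
Proof. by rewrite /segment scale1r addrC subrK. Qed.

Lemma segment_entry n (a b : 'cV[R]_n) s i :
  segment a b s i 0 = a i 0 + s * (b i 0 - a i 0).
Proof. by rewrite !mxE. Qed.

Lemma is_derive_affine (c d s : R) : is_derive s 1 (fun u => c + u * d) d.
Proof.
have h := is_deriveD (is_derive_cst c s (1 : R)) (is_deriveZ d (is_derive_id s (1 : R))).
have hE : 0 + d *: (1 : R) = d by rewrite add0r [LHS]mulr1.
move: h; rewrite hE; apply: is_derive_ext => u.
by rewrite !fctE [u * d]mulrC.
Qed.

Lemma mx_is_derive_segment n (a b : 'cV[R]_n) s : mx_is_derive s (segment a b) (b - a).
Proof.
move=> i j; rewrite ord1.
apply: (@is_derive_ext _ (fun u => a i 0 + u * (b i 0 - a i 0))).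
  by move=> u; rewrite segment_entry.
by rewrite !mxE; exact: is_derive_affine.
Qed.

Lemma derive1_segment n (a b : 'cV[R]_n) : derive1 (segment a b) = cst (b - a).
Proof. by apply/funext => s; have /mx_is_deriveP[_ ->] := mx_is_derive_segment a b s. Qed.

Lemma segment_smooth n (a b : 'cV[R]_n) : smooth_curve (segment a b).
Proof.
have cstn (c : 'cV[R]_n) k : exists d, (cst c : R -> 'cV[R]_n)^`(k) = cst d.
  elim: k => [|k [d E]]; first by exists c.
  exists 0; rewrite derive1nS E; apply/funext => s; rewrite derive1E.
  exact: derive_cst.
case=> [|k] s.
  by have /mx_is_deriveP[] := mx_is_derive_segment a b s.
rewrite derive1Sn derive1_segment; have [d ->] := cstn (b - a) k.
exact: derivable_cst.
Qed.

End Segments.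

Section AmbientTransport.
Context {R : realType}.
Variables (I : set R) (F : R -> R).
Hypotheses (I_open : open I) (F_smooth : smooth_on I F)
  (F2_neq0 : forall q, I q -> F^`(2) q != 0).
Local Notation U := (amb_dom (M_F I)).
Variables (tau1 tau2 sig1 sig2 : R -> R).
Hypotheses (tau1_der : forall q, I q -> is_derive q 1 tau1 (sig1 q))
  (tau2_der : forall q, I q -> is_derive q 1 tau2 (sig2 q))
  (sig1_der : forall q, I q -> is_derive q 1 sig1 (- ode_k F q * tau1 q))
  (sig2_der : forall q, I q -> is_derive q 1 sig2 (- ode_k F q * tau2 q))
  (wronskian1 : forall q, I q -> tau1 q * sig2 q - sig1 q * tau2 q = 1).

Local Notation gauge := (gauge F tau1 tau2 sig1 sig2).
Local Notation gauge_inv := (gauge_inv F tau1 tau2 sig1 sig2).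
Local Notation gauge_field := (gauge_field F tau1 tau2).
Local Notation amb_om := (amb_om F tau1 tau2).
Local Notation twisted_cubic := (twisted_cubic tau1 tau2).
Local Notation cubic_coef := (cubic_coef F).
Local Notation central_coef := (central_coef F).

Let U_open : open U := amb_dom_open I_open.
Let GK p : U p -> gauge p *m gauge_inv p = 1%:M :=
  gaugeK F2_neq0 wronskian1 (p := p).
Let Gd p : U p -> mx_differentiable gauge p :=
  gauge_differentiable F_smooth F2_neq0 tau1_der tau2_der sig1_der sig2_der (p := p).
Let Gid p : U p -> mx_differentiable gauge_inv p :=
  gauge_inv_differentiable F_smooth F2_neq0 tau1_der tau2_der sig1_der sig2_der wronskian1 (p := p).
Let GA p i : U p -> gauge p *m levi_civita (amb_g_F F) p i =
    mx_pd i gauge p + amb_om p i *m gauge p :=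
  gauge_levi_civita I_open F_smooth F2_neq0 tau1_der tau2_der sig1_der sig2_der
    wronskian1 i (p := p).

Definition amb_iq : 'I_(1 + (5 + 1)) := @Ordinal (1 + (5 + 1)) 4 isT.

Lemma amb_u_iq (p : 'cV[R]_(1 + (5 + 1))) : amb_u p iq 0 = p amb_iq 0.
Proof. by rewrite /amb_u !mxE; congr (p _ _); exact: val_inj. Qed.

Lemma gauge_speed_amb (gam : R -> 'cV[R]_(1 + (5 + 1))) s :
  gauge_speed amb_om gam s = h5_rep
    (derive1 gam s amb_iq 0 *: gauge_field (amb_P F (gam s)) (amb_u (gam s) iq 0)).
Proof.
rewrite /gauge_speed (bigD1 amb_iq) //= big1 => [|i].
  by rewrite addr0 /amb_om scale1r h5_repZ.
rewrite -val_eqE /= => /negbTE i4.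
by rewrite /amb_om i4 scale0r scaler0.
Qed.

Lemma gauge_field_continuous p i : U p ->
  {for p, continuous (fun y => gauge_field (amb_P F y) (amb_u y iq 0) i 0)}.
Proof.
move=> Up; have jc f := (has_gradient_jet F_smooth F2_neq0 f Up).1.
have qc := (has_gradient_amb_u iq p).1.
have t1c : differentiable (fun y => tau1 (amb_u y iq 0)) p.
  by have [] := has_gradient_of_q Up (tau1_der Up.2).
have t2c : differentiable (fun y => tau2 (amb_u y iq 0)) p.
  by have [] := has_gradient_of_q Up (tau2_der Up.2).
have Pc := jc (JVar JP); have Psic := jc jet_Psi; have rc := jc (JVar Jinv).
have coefE y : (cubic_coef (amb_u y iq 0) = - (jet_eval (jet_val F y) jet_Psi *
    jet_eval (jet_val F y) (JVar Jinv) ^+ 5) / 20) /\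
   (central_coef (amb_u y iq 0) = 3 / 40 * (jet_eval (jet_val F y) jet_Psi *
    jet_eval (jet_val F y) (JVar Jinv) ^+ 6)) by rewrite jet_Psi_Psi.
apply: differentiable_continuous.
have -> : (fun y => gauge_field (amb_P F y) (amb_u y iq 0) i 0) = fun y =>
   jet_eval (jet_val F y) (JVar JP) * (- (jet_eval (jet_val F y) jet_Psi *
    jet_eval (jet_val F y) (JVar Jinv) ^+ 5) / 20) * nth 0 [::
     tau1 (amb_u y iq 0) ^+ 3; tau1 (amb_u y iq 0) ^+ 2 * tau2 (amb_u y iq 0);
     tau2 (amb_u y iq 0) ^+ 3 / 10; - (3 / 10) * tau1 (amb_u y iq 0) * tau2 (amb_u y iq 0) ^+ 2; 0] i
   + jet_eval (jet_val F y) (JVar JP) ^+ 2 * (3 / 40 * (jet_eval (jet_val F y) jet_Psi *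
    jet_eval (jet_val F y) (JVar Jinv) ^+ 6)) * (i == ic)%:R.
  apply/funext => y; have [E1 E2] := coefE y; rewrite -E1 -E2.
  by rewrite /gauge_field !mxE eqxx andbT.
have dX (f : 'cV[R]_(1 + (5 + 1)) -> R) k : differentiable f p ->
    differentiable (fun y => f y ^+ k) p.
  move=> fd; elim: k => [|k IH]; first exact: differentiable_cst.
  rewrite (_ : (fun y => f y ^+ k.+1) = fun y => f y * f y ^+ k).
    exact: differentiableM.
  by apply/funext => y; rewrite exprS.
have dC (c : R) := differentiable_cst c p.
have dbeta := differentiableM Pc
  (differentiableM (differentiableN (differentiableM Psic (dX _ 5 rc))) (dC 20^-1)).
have dgamma := differentiableM (dX _ 2 Pc)
  (differentiableM (dC (3 / 40)) (differentiableM Psic (dX _ 6 rc))).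
have dcubic (f : 'cV[R]_(1 + (5 + 1)) -> R) (c : R) : differentiable f p ->
  differentiable (fun y => jet_eval (jet_val F y) (JVar JP) *
    (- (jet_eval (jet_val F y) jet_Psi * jet_eval (jet_val F y) (JVar Jinv) ^+ 5) / 20) * f y +
    jet_eval (jet_val F y) (JVar JP) ^+ 2 * (3 / 40 * (jet_eval (jet_val F y) jet_Psi *
    jet_eval (jet_val F y) (JVar Jinv) ^+ 6)) * c) p.
  move=> fd; exact: (differentiableD (differentiableM dbeta fd) (differentiableM dgamma (dC c))).
case: i => -[|[|[|[|[|//]]]]] hi; cbn [nth nat_of_ord]; apply: dcubic.
- exact: (dX _ 3 t1c).
- exact: (differentiableM (dX _ 2 t1c) t2c).
- exact: (differentiableM (dX _ 3 t2c) (dC 10^-1)).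
- exact: (differentiableM (differentiableM (dC (- (3 / 10))) t1c) (dX _ 2 t2c)).
- exact: (dC 0).
Qed.

(** In the gauge the transport equation is E' = - h5_rep X E, with X proportional to
    Psi, and h5_development integrates it inside the group. *)
Lemma amb_transport_h5 (gam : R -> 'cV[R]_(1 + (5 + 1))) Q :
  (forall s, 0 <= s <= 1 -> derivable gam s 1) ->
  (forall s, 0 <= s <= 1 -> {for s, continuous (fun u => derive1 gam u amb_iq 0)}) ->
  (forall s, 0 <= s <= 1 -> U (gam s)) ->
  transport (levi_civita (amb_g_F F)) gam Q ->
  exists2 v, Q = gauge_inv (gam 1) *m h5_exp v *m gauge (gam 0) &
    (forall q, I q -> Psi (F^`(2)) q = 0) -> v = 0.
Proof.
move=> gd gc gU gQ.
have [E [E0 Ed E1]] := transport_in_gauge U_open GK Gd Gid GA gd gU gQ.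
have U0 : U (gam 0) by apply: gU; rewrite lexx ler01.
have U1 : U (gam 1) by apply: gU; rewrite lexx ler01.
have QE : Q = gauge_inv (gam 1) *m E 1 *m gauge (gam 0).
  have cancel4 (a b c d : 'M[R]_(1 + (5 + 1))) : a *m b = 1%:M -> c *m d = 1%:M ->
      a *m (b *m Q *m c) *m d = Q.
    by move=> ab cd; rewrite !mulmxA ab mul1mx -mulmxA cd mulmx1.
  by rewrite E1 cancel4 //; apply: mulmx1C; exact: GK.
pose X s := derive1 gam s amb_iq 0 *: gauge_field (amb_P F (gam s)) (amb_u (gam s) iq 0).
have {}Ed s : 0 <= s <= 1 -> mx_is_derive s E (- h5_rep (X s) *m E s).
  by move=> s01; have := Ed s s01; rewrite gauge_speed_amb.
have [Psi0|nPsi0] := pselect (forall q, I q -> Psi (F^`(2)) q = 0).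
  exists 0 => //; rewrite QE; congr (_ *m _ *m _); rewrite h5_exp0 -E0.
  apply: mx_zero_derive_const => s s01; have := Ed s s01.
  have -> : X s = 0.
    have [_ Iq] := gU s s01.
    rewrite /X /gauge_field /Defs.Psi /cubic_coef /central_coef.
    by rewrite (Psi0 _ Iq) !mul0r oppr0 mul0r !mulr0 !scale0r addr0 scaler0.
  by rewrite h5_rep0 oppr0 mul0mx.
have [s i s01|v vE] := @h5_development R X E _ E0 Ed; last by exists v; rewrite ?QE ?vE.
rewrite (_ : (fun u => X u i 0) = fun u => derive1 gam u amb_iq 0 *
    gauge_field (amb_P F (gam u)) (amb_u (gam u) iq 0) i 0); last first.
  by apply/funext => u; rewrite [LHS]mxE.
apply: continuousM; first exact: gc.
apply: (@continuous_comp _ _ _ gam (fun y => gauge_field (amb_P F y) (amb_u y iq 0) i 0)).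
  by apply: differentiable_continuous; apply/derivable1_diffP/gd.
by apply: gauge_field_continuous; exact: gU.
Qed.

(** The connection form in the gauge is a multiple of dq. *)
Lemma amb_segment_const_q a b : (forall s, 0 <= s <= 1 -> U (segment a b s)) ->
  amb_u a iq 0 = amb_u b iq 0 ->
  transport (levi_civita (amb_g_F F)) (segment a b) (gauge_inv b *m h5_exp 0 *m gauge a).
Proof.
move=> sU abq.
have := @gauge_transport _ _ _ _ _ _ _ amb_om U_open GK Gd Gid GA (segment a b) (cst 1%:M).
rewrite segment0 segment1 h5_exp0; apply=> // s s01.
  by have /mx_is_deriveP[] := mx_is_derive_segment a b s.
rewrite gauge_speed_amb derive1_segment !mxE -!amb_u_iq abq subrr scale0r h5_rep0.
by rewrite oppr0 mul0mx; exact: mx_is_derive_cst.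
Qed.

(** On these points P = z, so moving z or q alone controls the coefficients of gauge_field. *)
Definition base_u (z q : R) : 'cV[R]_5 := \col_i nth 0 [:: 0; 0; 0; q; z] i.

Definition base_pt (z q : R) := amb_pt 1 (base_u z q) 0.

Lemma amb_P_base z q : amb_P F (base_pt z q) = z.
Proof.
rewrite /amb_P /jet_val /base_pt; have [_ -> _] := amb_ptK 1 (base_u z q) 0.
by rewrite !mxE /=; ring.
Qed.

Lemma amb_q_base z q : amb_u (base_pt z q) iq 0 = q.
Proof. by rewrite /base_pt; have [_ -> _] := amb_ptK 1 (base_u z q) 0; rewrite mxE. Qed.

Lemma base_pt_dom z q : I q -> U (base_pt z q).
Proof.
move=> Iq; have [t1 u1 _] := amb_ptK 1 (base_u z q) 0.
by split; rewrite ?t1 ?u1 ?ltr01 // /M_F /= mxE.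
Qed.

Lemma segment_base z q1 q2 s :
  segment (base_pt z q1) (base_pt z q2) s = base_pt z (q1 + s * (q2 - q1)).
Proof.
apply/colP => i; rewrite segment_entry /base_pt /amb_pt.
rewrite !mxE; case: splitP => j _; rewrite !mxE.
  by rewrite subrr mulr0 addr0.
case: splitP => k _; rewrite !mxE; last by rewrite subrr mulr0 addr0.
by case: k => -[|[|[|[|[|//]]]]] hk /=; ring.
Qed.

Variables (Av : R -> 'cV[R]_5) (Cv : R -> R).
Hypotheses (Av_der : forall q, I q ->
    mx_is_derive q Av (- cubic_coef q *: twisted_cubic q))
  (Av_central : forall q, Av q ic 0 = 0)
  (Cv_der : forall q, I q -> is_derive q 1 Cv (- central_coef q -
     2^-1 * h5_bracket (Av q) (- cubic_coef q *: twisted_cubic q) ic 0)).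

(** The canonical coordinates of the transport along a segment on which z is
    constant and q varies.  Since gauge_field is linear plus quadratic in P, they
    are obtained from the quadratures Av and Cv, which do not involve z. *)
Definition develop (z q : R) : 'cV[R]_5 := z *: Av q + (z ^+ 2 * Cv q) *: delta_mx ic 0.

(** The equation v' + [v, v'] / 2 = - X for the canonical coordinates. *)
Lemma develop_der z q : I q ->
  let dw := z *: (- cubic_coef q *: twisted_cubic q) + (z ^+ 2 * (- central_coef q -
     2^-1 * h5_bracket (Av q) (- cubic_coef q *: twisted_cubic q) ic 0)) *: delta_mx ic 0 in
  mx_is_derive q (develop z) dw /\
  dw + 2^-1 *: h5_bracket (develop z q) dw = - gauge_field z q.
Proof.
move=> Iq dw; split.
  apply: mx_is_deriveD; first exact: mx_is_deriveZ (Av_der Iq).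
  move=> i j; rewrite mxE mulrC mulrA.
  apply: (@is_derive_ext _ (((delta_mx ic 0 : 'cV[R]_5) i j * z ^+ 2) *: Cv)).
    by move=> u; rewrite fctE !mxE /GRing.scale /=; ring.
  by apply: is_deriveZ; exact: Cv_der.
have cub0 : twisted_cubic q ic 0 = 0 by rewrite mxE.
have A0 := Av_central q.
apply/colP => i; rewrite /dw /develop /gauge_field /h5_bracket !mxE ?A0 ?cub0 /=.
by case: i => -[|[|[|[|[|//]]]]] hi /=; rewrite ?mulr0n ?mulr1n; field.
Qed.

Lemma amb_segment_develop z q1 q2 : is_interval I -> I q1 -> I q2 ->
  transport (levi_civita (amb_g_F F)) (segment (base_pt z q1) (base_pt z q2))
    (gauge_inv (base_pt z q2) *m h5_exp (H5_mul (develop z q2) (- develop z q1))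
      *m gauge (base_pt z q1)).
Proof.
move=> I_itv I1 I2; pose q s := q1 + s * (q2 - q1).
have Iq s : 0 <= s <= 1 -> I (q s).
  move=> /andP[s0 s1]; rewrite /q; have [q12|/ltW q21] := leP q1 q2.
    by apply: (I_itv q1 q2) => //; apply/andP; split; nra.
  by apply: (I_itv q2 q1) => //; apply/andP; split; nra.
have q0E : q 0 = q1 by rewrite /q mul0r addr0.
have q1E : q 1 = q2 by rewrite /q mul1r addrC subrK.
pose E s := h5_exp (develop z (q s)) *m h5_exp (- develop z q1).
have := @gauge_transport _ _ _ _ _ _ _ amb_om U_open GK Gd Gid GA
  (segment (base_pt z q1) (base_pt z q2)) E.
have E1 : E 1 = h5_exp (develop z q2) *m h5_exp (- develop z q1) by rewrite /E q1E.
rewrite segment0 segment1 E1 -h5_exp_mul; apply => [s s01|s s01||s s01].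
- by have [] := (mx_is_deriveP _ _ _).1 (mx_is_derive_segment (base_pt z q1) (base_pt z q2) s).
- by rewrite segment_base; exact/base_pt_dom/Iq.
- by rewrite /E q0E -{1}[develop z q1]opprK h5_expN.
- have [dw [dd ddE]] : exists dw, mx_is_derive (q s) (develop z) dw /\
      dw + 2^-1 *: h5_bracket (develop z (q s)) dw = - gauge_field z (q s).
    by have dev := develop_der z (Iq s s01); eexists; exact: dev.
  rewrite gauge_speed_amb derive1_segment segment_base -/(q s) amb_P_base amb_q_base.
  have qd : is_derive s 1 q (q2 - q1) by exact: is_derive_affine.
  have wd : mx_is_derive s (fun u => develop z (q u)) ((q2 - q1) *: dw).
    move=> i j; rewrite mxE mulrC.
    exact: (@is_derive1_comp _ (fun u => develop z u i j) q).
  have := mx_is_derive_mul (is_derive_h5_exp wd) (mx_is_derive_cst s (h5_exp (- develop z q1))).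
  rewrite mulmx0 addr0 h5_exp_left_derive.
  have -> : (q2 - q1) *: dw + 2^-1 *: h5_bracket (develop z (q s)) ((q2 - q1) *: dw) =
      - ((q2 - q1) *: gauge_field z (q s)).
    rewrite -scalerN -ddE [RHS]scalerDr; congr (_ + _).
    by apply/colP => i; rewrite /h5_bracket !mxE; ring.
  have -> : (base_pt z q2 - base_pt z q1) amb_iq 0 = q2 - q1.
    have subE (a b : 'cV[R]_(1 + (5 + 1))) i : (a - b) i 0 = a i 0 - b i 0 by rewrite !mxE.
    by rewrite subE -!amb_u_iq !amb_q_base.
  have assoc (v : 'cV[R]_5) (a b : 'M[R]_(1 + (5 + 1))) :
      h5_rep (- v) *m a *m b = - h5_rep v *m (a *m b) by rewrite h5_repN mulmxA.
  rewrite assoc; exact.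
Qed.

End AmbientTransport.

(** * Generating the Heisenberg group *)

Section HeisenbergGeneration.
Context {R : realType}.

(** A matrix with rows in W whose rank is maximal has rank n: otherwise some column l
    is killed by it, and a row of W with a *m l nonzero increases the rank. *)
Lemma subspace_full n (W : set 'rV[R]_n) : W 0 ->
  (forall a b, W a -> W b -> W (a + b)) -> (forall s a, W a -> W (s *: a)) ->
  (forall l : 'cV[R]_n, (forall a, W a -> a *m l = 0) -> l = 0) ->
  forall a, W a.
Proof.
move=> W0 WD WZ Wann.
have Wmul m (u : 'rV[R]_m) (M : 'M[R]_(m, n)) : (forall i, W (row i M)) -> W (u *m M).
  move=> WM; rewrite mulmx_sum_row; elim/big_ind: _ => // i _.
  exact: WZ.
suff rk k : (k <= n)%N -> exists M : 'M[R]_n, (forall i, W (row i M)) /\ (k <= \rank M)%N.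
  have [M [WM nM]] := rk n (leqnn n); move=> a.
  have /submxP[u ->] : (a <= M)%MS by rewrite submx_full // /row_full eqn_leq rank_leq_col.
  exact: Wmul.
elim: k => [_|k IH kn].
  by exists 0; split=> // i; rewrite row0.
have [M [WM kM]] := IH (ltnW kn).
have [kM'|Mk] := ltnP k (\rank M); first by exists M.
have cM : cokermx M != 0.
  rewrite cokermx_eq0 /row_full neq_ltn.
  by rewrite (leq_ltn_trans Mk kn).
have [l Ml l0] : exists2 l : 'cV[R]_n, M *m l = 0 & l != 0.
  apply: contrapT => nl; move/negP: cM; apply; apply/eqP/matrixP => i j.
  apply: contrapT => cij; apply: nl; exists (col j (cokermx M)).
    by rewrite colE mulmxA mulmx_coker mul0mx.
  by apply/eqP => /colP /(_ i); rewrite mxE [RHS]mxE => E; apply: cij; rewrite E mxE.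
have [a Wa al] : exists2 a, W a & a *m l != 0.
  apply: contrapT => na; move/negP: l0; apply; apply/eqP/Wann => a Wa.
  by apply: contrapT => al; apply: na; exists a => //; apply/eqP.
exists (M + a)%MS; split=> [i|].
  have /sub_addsmxP[[u v] /= ->] := row_sub i (M + a)%MS.
  apply: WD; first exact: Wmul.
  by rewrite [v]mx11_scalar mul_scalar_mx; exact: WZ.
apply: leq_ltn_trans kM _; apply: rank_ltmx.
rewrite ltmxE addsmxSl /=; apply/negP => sM.
have /submxP[u aE] : (a <= M)%MS by apply: submx_trans sM; exact: addsmxSr.
by move/eqP: al; apply; rewrite aE -mulmxA Ml mulmx0.
Qed.

Definition h5_center (s : R) : 'cV[R]_5 := s *: delta_mx ic 0.

Lemma h5_bracketE (v w : 'cV[R]_5) : h5_bracket v w =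
  h5_center (v ia1 0 * w ib1 0 - v ib1 0 * w ia1 0 + (v ia2 0 * w ib2 0 - v ib2 0 * w ia2 0)).
Proof. by []. Qed.

(** Modulo the centre, the elements v such that K contains a lift of s v and its
    inverse for all s form a subspace, which is full because nothing
    annihilates it; the commutators of these lifts then fill the centre. *)
Lemma h5_generated (T : Type) (S : set T) (f : T -> 'cV[R]_5) (K : set 'cV[R]_5) :
  (forall v w, K v -> K w -> K (H5_mul v w)) -> K 0 ->
  (forall t s, S t -> exists c, K (s *: f t + h5_center c) /\ K (- (s *: f t + h5_center c))) ->
  (forall l : 'cV[R]_5, l ic 0 = 0 ->
    (forall t, S t -> (f t)^T *m l = 0) -> l = 0) ->
  forall v, K v.
Proof.
move=> KM K0 Kf fann.
pose K2 v := K v /\ K (- v).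
have K2M v w : K2 v -> K2 w -> K2 (H5_mul v w).
  move=> [Kv Kv'] [Kw Kw']; split; first exact: KM.
  have -> : - H5_mul v w = H5_mul (- w) (- v); last exact: KM.
  by apply/colP => i; rewrite /H5_mul !h5_bracketE !mxE; field.
pose W : set 'rV[R]_5 := [set a | forall s, exists c, K2 (s *: a^T + h5_center c)].
have WT a : W a.
  apply: subspace_full => {a} [s|a b Wa Wb s|r a Wa s|l Wl].
  - exists 0; rewrite trmx0 scaler0 /h5_center scale0r addr0.
    by split; rewrite ?oppr0.
  - have [c1 K1] := Wa s; have [c2 K2b] := Wb s.
    have := K2M _ _ K1 K2b.
    set x := s *: a^T + _; set y := s *: b^T + _.
    exists (c1 + c2 + 2^-1 * (x ia1 0 * y ib1 0 - x ib1 0 * y ia1 0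
      + (x ia2 0 * y ib2 0 - x ib2 0 * y ia2 0))).
    suff -> : s *: (a + b)^T + h5_center (c1 + c2 + 2^-1 * (x ia1 0 * y ib1 0 - x ib1 0 * y ia1 0
      + (x ia2 0 * y ib2 0 - x ib2 0 * y ia2 0))) = H5_mul x y by [].
    rewrite /H5_mul h5_bracketE.
    move: (_ - _ + _) => d; rewrite /x /y.
    by apply/colP => i; rewrite !mxE; ring.
  - by have [c Kc] := Wa (s * r); exists c; rewrite linearZ /= scalerA.
  - have lc : l ic 0 = 0.
      have Wc : W (delta_mx 0 ic).
        move=> s; exists (- s); rewrite trmx_delta /h5_center -scalerDl subrr scale0r.
        by split; rewrite ?oppr0.
      have /matrixP /(_ 0 0) := Wl _ Wc.
      by rewrite -rowE !mxE.
    apply: fann => // t St; apply: Wl => s.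
    by have [c Kc] := Kf t s St; exists c; rewrite trmxK.
have Kmod v : exists c, K2 (v + h5_center c).
  by have [c] := WT v^T 1; rewrite trmxK scale1r => Kc; exists c.
have Kc s : K (h5_center s).
  have [c1 [Kx Kx']] := Kmod (s *: delta_mx ia1 0).
  have [c2 [Ky Ky']] := Kmod (delta_mx ib1 0).
  have := KM _ _ (KM _ _ Kx Ky) (KM _ _ Kx' Ky').
  set x := _ + h5_center c1; set y := _ + h5_center c2.
  suff -> : H5_mul (H5_mul x y) (H5_mul (- x) (- y)) = h5_center s by [].
  have -> : H5_mul (H5_mul x y) (H5_mul (- x) (- y)) = h5_bracket x y.
    by apply/colP => i; rewrite /H5_mul !h5_bracketE !mxE /=; field.
  by rewrite h5_bracketE /x /y !mxE /=; congr h5_center; ring.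
move=> v; have [c [Kv _]] := Kmod v.
have := KM _ _ Kv (Kc (- c)).
suff -> : H5_mul (v + h5_center c) (h5_center (- c)) = v by [].
by apply/colP => i; rewrite /H5_mul !h5_bracketE !mxE /=; field.
Qed.

End HeisenbergGeneration.

(** * The holonomy group in the moving frame *)

Section HolonomyInGauge.
Context {R : realType}.
Variables (I : set R) (F : R -> R).
Hypothesis I_itv : is_interval I.
Local Notation U := (amb_dom (M_F I)).
Local Notation LC := (levi_civita (amb_g_F F)).
Variables (G Gi : 'cV[R]_(1 + (5 + 1)) -> 'M[R]_(1 + (5 + 1)))
  (dev : R -> R -> 'cV[R]_5) (q0 : R).
Hypotheses (I_q0 : I q0) (dev_z0 : forall q, dev 0 q = 0) (dev_q0 : forall z, dev z q0 = 0)
  (GK : forall p, U p -> G p *m Gi p = 1%:M)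
  (LC_h5 : forall (gam : R -> 'cV[R]_(1 + (5 + 1))) Q,
    (forall s, 0 <= s <= 1 -> derivable gam s 1) ->
    (forall s, 0 <= s <= 1 -> {for s, continuous (fun u => derive1 gam u amb_iq 0)}) ->
    (forall s, 0 <= s <= 1 -> U (gam s)) -> transport LC gam Q ->
    exists2 v, Q = Gi (gam 1) *m h5_exp v *m G (gam 0) &
      (forall q, I q -> Psi (F^`(2)) q = 0) -> v = 0)
  (LC_const_q : forall a b, (forall s, 0 <= s <= 1 -> U (segment a b s)) ->
    amb_u a iq 0 = amb_u b iq 0 ->
    transport LC (segment a b) (Gi b *m h5_exp 0 *m G a))
  (LC_develop : forall z q1 q2, I q1 -> I q2 ->
    transport LC (segment (base_pt z q1) (base_pt z q2))
      (Gi (base_pt z q2) *m h5_exp (H5_mul (dev z q2) (- dev z q1)) *m G (base_pt z q1))).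

(** The two connections of interest are pullbacks of the Levi-Civita connection
    along an affine map L: the identity, or the section t = 1, rho = 0. *)
Variables (n : nat) (V : set 'cV[R]_n) (A : @conn R n (1 + (5 + 1)))
  (L : 'cV[R]_n -> 'cV[R]_(1 + (5 + 1))) (pt : R -> R -> 'cV[R]_n).
Hypotheses (L_dom : forall x, V x <-> U (L x))
  (L_segment : forall a b s, L (segment a b s) = segment (L a) (L b) s)
  (L_derivable : forall (gam : R -> 'cV[R]_n) s,
    derivable gam s 1 -> derivable (L \o gam) s 1)
  (L_derive_q : forall (gam : R -> 'cV[R]_n), (forall s, derivable gam s 1) ->
    (forall s, derivable (derive1 gam) s 1) ->
    forall s, {for s, continuous (fun u => derive1 (L \o gam) u amb_iq 0)})
  (L_transport : forall (gam : R -> 'cV[R]_n) Q,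
    (forall s, 0 <= s <= 1 -> derivable gam s 1) ->
    transport A gam Q <-> transport LC (L \o gam) Q)
  (L_pt : forall z q, L (pt z q) = base_pt z q).

Lemma pw_transport_h5 x y P : pw_transport V A x y P ->
  [/\ V x, V y & exists2 v, P = Gi (L y) *m h5_exp v *m G (L x) &
    (forall q, I q -> Psi (F^`(2)) q = 0) -> v = 0].
Proof.
elim=> [Vx|gam {}P Q _ [Vx V0 [v PE v0]] gs gV gQ].
  split=> //; exists 0 => //.
  by rewrite h5_exp0 mulmx1 (mulmx1C (GK ((L_dom x).1 Vx))).
have V1 : V (gam 1) by apply: gV; rewrite ler01 lexx.
split=> //.
have [| |s s01| |w QE w0] := @LC_h5 (L \o gam) Q.
- by move=> s _; apply: L_derivable; exact: (gs 0).
- by move=> s _; apply: L_derive_q => u; [exact: (gs 0%N)|exact: (gs 1%N)].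
- exact/L_dom/gV.
- by apply/L_transport => // s _; exact: (gs 0%N).
exists (H5_mul w v) => [|Psi0]; last first.
  by rewrite w0 // v0 // H5_mul0.
rewrite PE QE h5_exp_mul -!mulmxA; congr (_ *m (_ *m _)) => /=.
by rewrite !mulmxA GK ?mul1mx //; apply/L_dom.
Qed.

Definition reach x y v := pw_transport V A x y (Gi (L y) *m h5_exp v *m G (L x)).

Lemma reach_refl x : V x -> reach x x 0.
Proof.
move=> Vx; rewrite /reach h5_exp0 mulmx1 (mulmx1C (GK ((L_dom x).1 Vx))).
exact: pw_transport_nil.
Qed.

Lemma pw_transport_trans x y z P Q : pw_transport V A x y P ->
  pw_transport V A y z Q -> pw_transport V A x z (Q *m P).
Proof.
move=> xy; elim=> [_|gam {}Q S _ IH gs gV gS]; first by rewrite mul1mx.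
by rewrite -mulmxA; exact: pw_transport_cons.
Qed.

Lemma reach_trans x y z v w : reach x y v -> reach y z w -> reach x z (H5_mul w v).
Proof.
move=> xy yz; have := pw_transport_trans xy yz; rewrite /reach h5_exp_mul.
have [_ Vy _] := pw_transport_h5 xy.
congr pw_transport; rewrite -!mulmxA; congr (_ *m (_ *m _)).
by rewrite !mulmxA GK ?mul1mx //; apply/L_dom.
Qed.

Lemma reach_segment a b v : (forall s, 0 <= s <= 1 -> V (segment a b s)) ->
  transport LC (segment (L a) (L b)) (Gi (L b) *m h5_exp v *m G (L a)) -> reach a b v.
Proof.
move=> sV st; have Va : V a by rewrite -(segment0 a b); apply: sV; rewrite lexx ler01.
rewrite /reach -[X in pw_transport V A a X _](segment1 a b) -[X in pw_transport _ _ _ _ X]mulmx1.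
apply: pw_transport_cons.
- by rewrite segment0; exact: pw_transport_nil.
- exact: segment_smooth.
- exact: sV.
- apply/L_transport => [s _|]; first by have /mx_is_deriveP[] := mx_is_derive_segment a b s.
  by rewrite (_ : L \o segment a b = segment (L a) (L b)) //; apply/funext => s; exact: L_segment.
Qed.

Lemma segment_dom a b s : V a -> V b -> 0 <= s <= 1 -> V (segment a b s).
Proof.
move=> /L_dom [ta Ia] /L_dom [tb Ib] /andP[s0 s1]; apply/L_dom.
rewrite L_segment; split.
  have tE p : @amb_t R 5 p = p (lshift (5 + 1) 0) 0 by rewrite /amb_t mxE.
  move: ta tb; rewrite !tE segment_entry => ta tb; nra.
rewrite /M_F /= amb_u_iq segment_entry -!amb_u_iq.
move: Ia Ib; rewrite /M_F /=; move: (amb_u (L a) _ _) (amb_u (L b) _ _) => qa qb Ia Ib.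
have [ab|/ltW ba] := leP qa qb.
  have := mulr_ge0 s0 (_ : 0 <= qb - qa); have := mulr_ge0 (_ : 0 <= 1 - s) (_ : 0 <= qb - qa).
  rewrite !subr_ge0 => /(_ s1 ab) H1 /(_ ab) H2.
  by apply: (I_itv Ia Ib); apply/andP; split; lra.
have := mulr_ge0 s0 (_ : 0 <= qa - qb); have := mulr_ge0 (_ : 0 <= 1 - s) (_ : 0 <= qa - qb).
rewrite !subr_ge0 => /(_ s1 ba) H1 /(_ ba) H2.
by apply: (I_itv Ib Ia); apply/andP; split; lra.
Qed.

Lemma pt_dom z q : I q -> V (pt z q).
Proof. by move=> Iq; apply/L_dom; rewrite L_pt; exact: base_pt_dom. Qed.

Lemma reach_const_q a b : V a -> V b -> amb_u (L a) iq 0 = amb_u (L b) iq 0 -> reach a b 0.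
Proof.
move=> Va Vb abq; apply: reach_segment => [s s01|]; first exact: segment_dom.
by apply: LC_const_q => // s s01; rewrite -L_segment; apply/L_dom; exact: segment_dom.
Qed.

Lemma reach_develop z q1 q2 : I q1 -> I q2 ->
  reach (pt z q1) (pt z q2) (H5_mul (dev z q2) (- dev z q1)).
Proof.
move=> I1 I2; apply: reach_segment => [s s01|].
  by apply: segment_dom => //; exact: pt_dom.
by rewrite !L_pt; exact: LC_develop.
Qed.

Local Notation o := (pt 0 q0).

Let H5_mulx0 (v : 'cV[R]_5) : H5_mul v 0 = v.
Proof.
by apply/colP => i; rewrite /H5_mul h5_bracketE !mxE; ring.
Qed.

Let reach_eq x y v w : reach x y v -> v = w -> reach x y w.
Proof. by move=> xy <-. Qed.

(** Along z = 0 the development is trivial, and so is the transport along q = const. *)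
Lemma reach_base_in x : V x -> reach x o 0 /\ reach o x 0.
Proof.
move=> Vx; have [_ Iq] := (L_dom x).1 Vx; set q := amb_u (L x) iq 0 in Iq.
have xq : amb_u (L x) iq 0 = amb_u (L (pt 0 q)) iq 0 by rewrite L_pt amb_q_base.
have dev0 q1 q2 : H5_mul (dev 0 q2) (- dev 0 q1) = 0.
  by rewrite !dev_z0 oppr0 H5_mulx0.
have Vq := pt_dom 0 Iq; split.
  apply: reach_eq (reach_trans (reach_const_q Vx Vq xq) (reach_develop 0 Iq I_q0)) _.
  by rewrite dev0 H5_mulx0.
apply: reach_eq (reach_trans (reach_develop 0 I_q0 Iq) (reach_const_q Vq Vx (esym xq))) _.
by rewrite dev0 H5_mulx0.
Qed.

(** The holonomy of the rectangle with sides z = 0, z = const, q = const and q = q0;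
    of its four sides only the one with z = const contributes, and the two
    orientations give inverse elements. *)
Lemma reach_loop z q : I q -> reach o o (dev z q) /\ reach o o (- dev z q).
Proof.
move=> Iq; have Vo := pt_dom 0 I_q0; have Vz := pt_dom z I_q0.
have Vq := pt_dom 0 Iq; have Vzq := pt_dom z Iq.
have up q1 : I q1 -> reach (pt 0 q1) (pt z q1) 0.
  by move=> I1; apply: reach_const_q; rewrite ?L_pt ?amb_q_base //; exact: pt_dom.
have down q1 : I q1 -> reach (pt z q1) (pt 0 q1) 0.
  by move=> I1; apply: reach_const_q; rewrite ?L_pt ?amb_q_base //; exact: pt_dom.
have [_ oq] := reach_base_in Vq; have [qo _] := reach_base_in Vq.
split.
  apply: reach_eq (reach_trans (reach_trans (reach_trans (up _ I_q0)
    (reach_develop z I_q0 Iq)) (down _ Iq)) qo) _.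
  by rewrite dev_q0 oppr0 !H5_mulx0 !H5_mul0.
apply: reach_eq (reach_trans (reach_trans (reach_trans oq (up _ Iq))
  (reach_develop z Iq I_q0)) (down _ I_q0)) _.
by rewrite dev_q0 !H5_mul0 !H5_mulx0.
Qed.

Variables (Av : R -> 'cV[R]_5) (Cv : R -> R).
Hypotheses (devE : forall z q, dev z q = z *: Av q + (z ^+ 2 * Cv q) *: delta_mx ic 0)
  (Av_span : forall l : 'cV[R]_5, l ic 0 = 0 ->
    (forall q, I q -> (Av q)^T *m l = 0) -> l = 0).

Lemma reach_all v : reach o o v.
Proof.
apply: (@h5_generated _ R I Av (reach o o)) => //.
- by move=> v1 v2 r1 r2; exact: reach_trans r2 r1.
- exact/reach_refl/pt_dom.
- move=> q s Iq; exists (s ^+ 2 * Cv q); rewrite /h5_center -devE.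
  exact: reach_loop.
Qed.

Lemma holonomy_h5 x : V x -> hol V A x = range (fun v => Gi (L x) *m h5_exp v *m G (L x)).
Proof.
move=> Vx; apply/seteqP; split=> [P /pw_transport_h5 [_ _ [v -> _]]|P [v _ <-]].
  by exists v.
have [xo ox] := reach_base_in Vx.
have := reach_trans (reach_trans xo (reach_all v)) ox.
by rewrite H5_mulx0 H5_mul0.
Qed.

End HolonomyInGauge.

(** * Existence of the frame and of the quadratures *)

Section FrameExistence.
Context {R : realType}.
Variables (I : set R) (F : R -> R) (q0 : R).
Hypotheses (I_open : open I) (I_itv : is_interval I) (I_q0 : I q0)
  (F_smooth : smooth_on I F) (F2_neq0 : forall q, I q -> F^`(2) q != 0).

Lemma continuous_for_ext (f g : R -> R) q : f =1 g ->
  {for q, continuous f} -> {for q, continuous g}.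
Proof. by move=> /funext ->. Qed.

Lemma jet_continuous_q f q : I q ->
  {for q, continuous (fun s => jet_eval (jet_val F (base_pt 0 s)) f)}.
Proof.
move=> Iq; have [fd _] := has_gradient_jet F_smooth F2_neq0 f (base_pt_dom 0 Iq).
have segE s : base_pt 0 s = segment (base_pt 0 0) (base_pt 0 1) s :> 'cV[R]_(1 + (5 + 1)).
  by rewrite segment_base add0r subr0 mulr1.
rewrite segE in fd.
have := is_derive_along fd (mx_is_derive_segment (base_pt 0 0) (base_pt 0 1) q).
move=> /is_derive_continuous; apply: continuous_for_ext => s /=.
by rewrite -segE.
Qed.

Lemma ode_k_continuous q : I q -> {for q, continuous (ode_k F)}.
Proof.
move=> Iq; have := jet_continuous_q (f := jet_k) Iq; apply: continuous_for_ext => s.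
by rewrite jet_k_ode amb_q_base.
Qed.

Lemma cubic_coef_continuous q : I q -> {for q, continuous (cubic_coef F)}.
Proof.
move=> Iq; have := jet_continuous_q (f := JMul (JCst (- 20^-1)) (JMul jet_Psi (JMul (JVar Jinv)
  (JMul (JMul (JVar Jinv) (JVar Jinv)) (JMul (JVar Jinv) (JVar Jinv)))))) Iq.
apply: continuous_for_ext => s; cbn [jet_eval].
rewrite jet_Psi_Psi amb_q_base /cubic_coef.
have -> : jet_val F (base_pt 0 s) Jinv = (derive1n 2 F s)^-1.
  by rewrite /jet_val amb_q_base.
by move: (Psi _ s) (derive1n 2 F s)^-1 => psi r; field.
Qed.

Lemma central_coef_continuous q : I q -> {for q, continuous (central_coef F)}.
Proof.
move=> Iq; have := jet_continuous_q (f := JMul (JCst (3 / 40)) (JMul jet_Psi (JMul (JMul (JVar Jinv)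
  (JVar Jinv)) (JMul (JMul (JVar Jinv) (JVar Jinv)) (JMul (JVar Jinv) (JVar Jinv)))))) Iq.
apply: continuous_for_ext => s; cbn [jet_eval].
rewrite jet_Psi_Psi amb_q_base /central_coef.
have -> : jet_val F (base_pt 0 s) Jinv = (derive1n 2 F s)^-1.
  by rewrite /jet_val amb_q_base.
by move: (Psi _ s) (derive1n 2 F s)^-1 => psi r; ring.
Qed.

(** The second order equation tau'' = - k tau, as a first order system. *)
Lemma oscillator_exists (a b : R) : exists tau sig : R -> R,
  [/\ tau q0 = a, sig q0 = b, forall q, I q -> is_derive q 1 tau (sig q)
    & forall q, I q -> is_derive q 1 sig (- ode_k F q * tau q)].
Proof.
pose N q : 'M[R]_2 := \matrix_(i, j)
  nth 0 (nth [::] [:: [:: 0; 1]; [:: - ode_k F q; 0]] i) j.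
have Nc q i j : I q -> {for q, continuous (fun s => N s i j)}.
  move=> Iq; rewrite (_ : (fun _ => _) = fun s =>
    nth 0 (nth [::] [:: [:: 0; 1]; [:: - ode_k F s; 0]] i) j); last first.
    by apply/funext => s; rewrite mxE.
  case: i => -[|[|//]] hi; case: j => -[|[|//]] hj; cbn [nth nat_of_ord].
  - exact: cst_continuous.
  - exact: cst_continuous.
  - by apply: continuousN; exact: ode_k_continuous.
  - exact: cst_continuous.
have [y [yi yd]] := linear_ode_exists (\col_i nth 0 [:: a; b] i) I_open I_itv I_q0 Nc.
exists (y ord0), (y ord_max); split.
- by rewrite yi mxE.
- by rewrite yi mxE.
- move=> q Iq; have := yd q ord0 Iq; rewrite big_ord_recr big_ord1 /= !mxE /=.
  by rewrite mul0r add0r mul1r.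
- move=> q Iq; have := yd q ord_max Iq; rewrite big_ord_recr big_ord1 /= !mxE /=.
  rewrite mul0r addr0 (_ : widen_ord _ _ = ord0) //; exact: val_inj.
Qed.

Lemma parallel_frame_exists : exists tau1 tau2 sig1 sig2 : R -> R,
  [/\ [/\ tau1 q0 = 1, tau2 q0 = 0, sig1 q0 = 0 & sig2 q0 = 1],
    (forall q, I q -> is_derive q 1 tau1 (sig1 q)) /\
    (forall q, I q -> is_derive q 1 tau2 (sig2 q)),
    (forall q, I q -> is_derive q 1 sig1 (- ode_k F q * tau1 q)) /\
    (forall q, I q -> is_derive q 1 sig2 (- ode_k F q * tau2 q))
    & forall q, I q -> tau1 q * sig2 q - sig1 q * tau2 q = 1].
Proof.
have [tau1 [sig1 [t1 s1 dt1 ds1]]] := oscillator_exists 1 0.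
have [tau2 [sig2 [t2 s2 dt2 ds2]]] := oscillator_exists 0 1.
exists tau1, tau2, sig1, sig2; split=> // q Iq.
pose W := tau1 * sig2 - sig1 * tau2.
have Wd s : I s -> is_derive s 1 W 0.
  move=> Is; have := is_deriveB (is_deriveM (dt1 s Is) (ds2 s Is))
    (is_deriveM (ds1 s Is) (dt2 s Is)).
  set d := (X in is_derive s _ _ X); have -> // : d = 0.
  by rewrite /d /GRing.scale /=; ring.
have := zero_derive_const_itv I_itv Iq I_q0 Wd.
by rewrite /W !fctE t1 t2 s1 s2 => ->; ring.
Qed.

Variables (tau1 tau2 sig1 sig2 : R -> R).
Hypotheses (tau1_der : forall q, I q -> is_derive q 1 tau1 (sig1 q))
  (tau2_der : forall q, I q -> is_derive q 1 tau2 (sig2 q))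
  (sig1_der : forall q, I q -> is_derive q 1 sig1 (- ode_k F q * tau1 q))
  (sig2_der : forall q, I q -> is_derive q 1 sig2 (- ode_k F q * tau2 q)).
Local Notation cubic := (twisted_cubic tau1 tau2).

Lemma twisted_cubic_continuous q i : I q -> {for q, continuous (fun s => cubic s i 0)}.
Proof.
move=> Iq; have t1 := is_derive_continuous (tau1_der Iq).
have t2 := is_derive_continuous (tau2_der Iq).
rewrite (_ : (fun _ => _) = fun s => nth 0 [:: tau1 s * tau1 s * tau1 s;
  tau1 s * tau1 s * tau2 s; tau2 s * tau2 s * tau2 s * 10^-1;
  - (3 / 10) * tau1 s * tau2 s * tau2 s; 0] i); last first.
  apply/funext => s; rewrite mxE.
  by case: i => -[|[|[|[|[|//]]]]] hi /=; rewrite ?exprS ?expr0; ring.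
by case: i => -[|[|[|[|[|//]]]]] hi /=;
  do ?[exact: t1|exact: t2|exact: cst_continuous|apply: continuousM].
Qed.

(** The noncentral coordinates of the development are primitives of a
    multiple of the twisted cubic; the equation of the central one contains their bracket. *)
Lemma quadratures_exist : exists (Av : R -> 'cV[R]_5) (Cv : R -> R),
  [/\ Av q0 = 0, Cv q0 = 0,
    (forall q, I q -> mx_is_derive q Av (- cubic_coef F q *: cubic q)),
    (forall q, Av q ic 0 = 0)
    & forall q, I q -> is_derive q 1 Cv (- central_coef F q -
     2^-1 * h5_bracket (Av q) (- cubic_coef F q *: cubic q) ic 0)].
Proof.
have cc i q : I q -> {for q, continuous (fun s => - cubic_coef F s * cubic s i 0)}.
  move=> Iq; apply: continuousM; last exact: twisted_cubic_continuous.
  by apply: continuousN; exact: cubic_coef_continuous.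
have /choice[G GE] (i : 'I_5) : exists G : R -> R, G q0 = 0 /\
    forall q, I q -> is_derive q 1 G (- cubic_coef F q * cubic q i 0).
  by have [G G0 Gd] := primitive_exists I_open I_itv I_q0 (cc i); exists G.
pose Av q : 'cV[R]_5 := \col_i if i == ic then 0 else G i q.
have Avd q : I q -> mx_is_derive q Av (- cubic_coef F q *: cubic q).
  move=> Iq i j; rewrite ord1.
  have -> : (fun s => Av s i 0) = fun s => if i == ic then 0 else G i s.
    by apply/funext => s; rewrite mxE.
  rewrite [X in is_derive _ _ _ X]mxE; case: eqP => [->|_]; last by have [_] := GE i; apply.
  by rewrite [cubic q ic 0]mxE mulr0; exact: is_derive_cst.
have Avc q i : I q -> {for q, continuous (fun s => Av s i 0)}.
  by move=> Iq; apply: is_derive_continuous (Avd q Iq i 0).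
have brc q : I q -> {for q, continuous (fun s => - central_coef F s -
     2^-1 * h5_bracket (Av s) (- cubic_coef F s *: cubic s) ic 0)}.
  move=> Iq; rewrite (_ : (fun _ => _) = fun s => - central_coef F s - 2^-1 *
    (Av s ia1 0 * (- cubic_coef F s * cubic s ib1 0)
     - Av s ib1 0 * (- cubic_coef F s * cubic s ia1 0)
     + (Av s ia2 0 * (- cubic_coef F s * cubic s ib2 0)
     - Av s ib2 0 * (- cubic_coef F s * cubic s ia2 0)))); last first.
    apply/funext => s; rewrite h5_bracketE.
    have scE i : (- cubic_coef F s *: cubic s) i 0 = - cubic_coef F s * cubic s i 0.
      by rewrite mxE.
    rewrite !scE; move: (- cubic_coef F s * _) (- cubic_coef F s * _) (- cubic_coef F s * _)
      (- cubic_coef F s * _) => c1 c2 c3 c4.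
    by rewrite [h5_center _ _ _]mxE [delta_mx _ _ _ _]mxE /= mulr1.
  have AX i j : {for q, continuous (fun s => Av s i 0 * (- cubic_coef F s * cubic s j 0))}.
    by apply: continuousM; [exact: Avc|exact: cc].
  apply: continuousB; first by apply: continuousN; exact: central_coef_continuous.
  apply: continuousM; first exact: cst_continuous.
  by apply: continuousD; apply: continuousB; exact: AX.
have [C C0 Cd] := primitive_exists I_open I_itv I_q0 brc.
exists Av, C; split => //.
- by apply/colP => i; rewrite !mxE; case: eqP => // _; have [] := GE i.
- by move=> q; rewrite mxE.
Qed.

End FrameExistence.

(** * Nondegeneracy of the twisted cubic *)

Lemma continuous_neq0_near (R : realType) (f : R -> R) q :
  {for q, continuous f} -> f q != 0 -> \forall s \near q, f s != 0.
Proof. exact: cvgr_neq0. Qed.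

Lemma near_zero_derive (R : realType) (h : R -> R) q d :
  (\forall s \near q, h s = 0) -> is_derive q 1 h d -> d = 0.
Proof.
move=> h0 hd; have : is_derive q 1 (cst 0) d.
  by apply: near_eq_is_derive hd; apply: filterS h0 => s ->.
by move=> /(@derive_val _ _ _ _ _ _ _) <-; exact: derive_cst.
Qed.

Section CubicSpan.
Context {R : realType}.
Variables (I : set R) (q0 : R) (k f : R -> R).
Hypotheses (I_open : open I) (I_q0 : I q0) (f_cont : forall q : R, I q -> {for q, continuous f})
  (f_q0 : f q0 != 0).
Variables (tau1 tau2 sig1 sig2 : R -> R).
Hypotheses (tau1_q0 : tau1 q0 = 1) (tau2_q0 : tau2 q0 = 0)
  (sig1_q0 : sig1 q0 = 0) (sig2_q0 : sig2 q0 = 1)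
  (tau1_der : forall q : R, I q -> is_derive q 1 tau1 (sig1 q))
  (tau2_der : forall q : R, I q -> is_derive q 1 tau2 (sig2 q))
  (sig1_der : forall q : R, I q -> is_derive q 1 sig1 (- k q * tau1 q))
  (sig2_der : forall q : R, I q -> is_derive q 1 sig2 (- k q * tau2 q)).
Variable (Av : R -> 'cV[R]_5).
Hypothesis (Av_der : forall q : R, I q ->
    mx_is_derive q Av (- f q *: twisted_cubic tau1 tau2 q)).

Let J : set R := [set q | I q /\ f q != 0].

Let J_near q : J q -> \forall s \near q, J s.
Proof.
move=> [Iq Pq]; have Pc := f_cont Iq.
have nI : \forall s \near q, I s by apply: open_nbhs_nbhs.
have nP := continuous_neq0_near Pc Pq.
by apply: filterS2 nI nP => s Is Ps; split.
Qed.

Let vanish_der (h dh : R -> R) : (forall q, J q -> h q = 0) ->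
  (forall q : R, J q -> is_derive q 1 h (dh q)) -> forall q, J q -> dh q = 0.
Proof.
move=> f0 fd q Jq.
apply: near_zero_derive (fd q Jq).
by apply: filterS (J_near Jq) => s Js; rewrite f0.
Qed.

(** Near q0, where f does not vanish, a linear relation between the components of
    Av gives one between those of the twisted cubic.  It says that a binary
    cubic vanishes on (tau1, tau2); differentiating three times, with
    tau'' = - k tau, shows that all its polarizations in (tau1, tau2) and
    (sig1, sig2) vanish, and at q0 these are its four coefficients. *)
Lemma twisted_cubic_span (l : 'cV[R]_5) : l ic 0 = 0 ->
  (forall q, I q -> (Av q)^T *m l = 0) -> l = 0.
Proof.
move=> lc Al.
(* The coefficients of the binary cubic defined by l. *)
pose L0 := l ia1 0; pose L1 := l ia2 0.
pose L2 := - (3 / 10) * l ib2 0; pose L3 := l ib1 0 / 10.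
have Jq0 : J q0 := conj I_q0 f_q0.
pose p0 q := L0 * (tau1 q * (tau1 q * tau1 q)) + L1 * (tau1 q * (tau1 q * tau2 q))
  + L2 * (tau1 q * (tau2 q * tau2 q)) + L3 * (tau2 q * (tau2 q * tau2 q)).
pose p1 q := 3 * L0 * (tau1 q * (tau1 q * sig1 q))
  + L1 * (2 * (tau1 q * (sig1 q * tau2 q)) + tau1 q * (tau1 q * sig2 q))
  + L2 * (2 * (tau1 q * (tau2 q * sig2 q)) + sig1 q * (tau2 q * tau2 q))
  + 3 * L3 * (tau2 q * (tau2 q * sig2 q)).
pose p2 q := 6 * L0 * (tau1 q * (sig1 q * sig1 q))
  + L1 * (2 * (sig1 q * (sig1 q * tau2 q)) + 4 * (tau1 q * (sig1 q * sig2 q)))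
  + L2 * (4 * (sig1 q * (tau2 q * sig2 q)) + 2 * (tau1 q * (sig2 q * sig2 q)))
  + 6 * L3 * (tau2 q * (sig2 q * sig2 q)).
pose p3 q := 6 * L0 * (sig1 q * (sig1 q * sig1 q)) + 6 * L1 * (sig1 q * (sig1 q * sig2 q))
  + 6 * L2 * (sig1 q * (sig2 q * sig2 q)) + 6 * L3 * (sig2 q * (sig2 q * sig2 q)).
have dM (q : R) (h g : R -> R) (df dg : R) : is_derive q 1 h df -> is_derive q 1 g dg ->
    is_derive q 1 (fun u => h u * g u) (df * g q + h q * dg).
  move=> fd gd; apply: is_derive_eq (is_deriveM fd gd) _.
  by rewrite /GRing.scale /= addrC [X in X + _]mulrC.
have dD (q : R) (h g : R -> R) (df dg : R) : is_derive q 1 h df -> is_derive q 1 g dg ->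
    is_derive q 1 (fun u => h u + g u) (df + dg) by exact: is_deriveD.
have dC (q : R) (c : R) : is_derive q 1 (fun=> c) 0 by exact: is_derive_cst.
have dE (q : R) (h : R -> R) (df df' : R) : is_derive q 1 h df -> df = df' ->
    is_derive q 1 h df' by move=> ? <-.
have p0J q : J q -> p0 q = 0.
  move=> [Iq Pq].
  have dAT : mx_is_derive q (fun s => (Av s)^T) (- f q *: twisted_cubic tau1 tau2 q)^T.
    move=> i j; rewrite mxE; apply: is_derive_ext (Av_der Iq j i) => s.
    by rewrite mxE.
  have := mx_is_derive_mul dAT (mx_is_derive_cst q l) 0 0.
  rewrite mulmx0 addr0 => dAl.
  have : ((- f q *: twisted_cubic tau1 tau2 q)^T *m l) 0 0 = 0.
    apply: near_zero_derive dAl.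
    have := open_nbhs_nbhs (conj I_open Iq).
    by apply: filterS => s Is; rewrite /cst Al // mxE.
  have -> : ((- f q *: twisted_cubic tau1 tau2 q)^T *m l) 0 0 = - f q * p0 q.
    rewrite mxE !big_ord_recr big_ord0 /= !mxE /= /p0 /L0 /L1 /L2 /L3.
    have e1 : widen_ord (leqnSn 4) (widen_ord (leqnSn 3) (widen_ord (leqnSn 2)
      (widen_ord (leqnSn 1) ord_max))) = ia1 by exact: val_inj.
    have e2 : widen_ord (leqnSn 4) (widen_ord (leqnSn 3) (widen_ord (leqnSn 2)
      ord_max)) = ia2 by exact: val_inj.
    have e3 : widen_ord (leqnSn 4) (widen_ord (leqnSn 3) ord_max) = ib1 by exact: val_inj.
    have e4 : widen_ord (leqnSn 4) ord_max = ib2 by exact: val_inj.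
    have e5 : (ord_max : 'I_5) = ic by exact: val_inj.
    by rewrite e1 e2 e3 e4 e5; field.
  by move/eqP; rewrite mulf_eq0 oppr_eq0 (negbTE Pq) => /eqP.
have p0d (q : R) : J q -> is_derive q 1 p0 (p1 q).
  move=> [Iq _]; have t1 := tau1_der Iq; have t2 := tau2_der Iq.
  eapply dE; [do ![exact: t1|exact: t2|apply: dC|apply: dD|apply: dM]|].
  by rewrite /p1 /= /GRing.scale /=; ring.
have p1J := vanish_der p0J p0d.
have p1d (q : R) : J q -> is_derive q 1 p1 (p2 q - 3 * k q * p0 q).
  move=> [Iq _]; have t1 := tau1_der Iq; have t2 := tau2_der Iq.
  have s1 := sig1_der Iq; have s2 := sig2_der Iq.
  eapply dE; [do ![exact: t1|exact: t2|exact: s1|exact: s2|apply: dC|apply: dD|apply: dM]|].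
  by rewrite /p2 /p0 /= /GRing.scale /=; ring.
have p2J q : J q -> p2 q = 0.
  by move=> Jq; have := vanish_der p1J p1d Jq; rewrite p0J // mulr0 subr0.
have p2d (q : R) : J q -> is_derive q 1 p2 (p3 q - 4 * k q * p1 q).
  move=> [Iq _]; have t1 := tau1_der Iq; have t2 := tau2_der Iq.
  have s1 := sig1_der Iq; have s2 := sig2_der Iq.
  eapply dE; [do ![exact: t1|exact: t2|exact: s1|exact: s2|apply: dC|apply: dD|apply: dM]|].
  by rewrite /p3 /p1 /= /GRing.scale /=; ring.
have p3J q : J q -> p3 q = 0.
  by move=> Jq; have := vanish_der p2J p2d Jq; rewrite p1J // mulr0 subr0.
have E0 := p0J q0 Jq0; have E1 := p1J q0 Jq0; have E2 := p2J q0 Jq0; have E3 := p3J q0 Jq0.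
move: E0 E1 E2 E3; rewrite /p0 /p1 /p2 /p3 tau1_q0 tau2_q0 sig1_q0 sig2_q0.
rewrite /L0 /L1 /L2 /L3 => E0 E1 E2 E3.
have la1 : l ia1 0 = 0 by lra.
have la2 : l ia2 0 = 0 by lra.
have lb2 : l ib2 0 = 0 by lra.
have lb1 : l ib1 0 = 0 by lra.
apply/colP => i; rewrite [RHS]mxE.
case: i => -[|[|[|[|[|//]]]]] hi.
- by rewrite (_ : Ordinal hi = ia1) //; exact: val_inj.
- by rewrite (_ : Ordinal hi = ia2) //; exact: val_inj.
- by rewrite (_ : Ordinal hi = ib1) //; exact: val_inj.
- by rewrite (_ : Ordinal hi = ib2) //; exact: val_inj.
- by rewrite (_ : Ordinal hi = ic) //; exact: val_inj.
Qed.

End CubicSpan.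

(** * Smoothness of polynomial maps *)

Section SmoothFunctions.
Context {R : realType} {n : nat}.
Implicit Types (f g : 'cV[R]_n -> R) (k : nat).

Let Ck_le k f : Ck k.+1 f -> Ck k f.
Proof.
elim: k f => [|k IH] f [fc fd]; first exact: fc.
by split=> // i; have [fi fk] := fd i; split=> //; exact: IH.
Qed.

Let Ck_cst k (c : R) : Ck k (fun=> c : R) (n := n).
Proof.
elim: k c => [|k IH] c; first exact: cst_continuous.
split=> [|i]; first exact: cst_continuous.
split=> [x|]; first exact: derivable_cst.
have -> : pd i (fun=> c) = (fun=> 0) :> ('cV[R]_n -> R).
  by apply/funext => x; exact: derive_cst.
exact: IH.
Qed.

Let CkD k f g : Ck k f -> Ck k g -> Ck k (fun x => f x + g x).
Proof.
elim: k f g => [|k IH] f g; first by move=> fc gc x; exact: continuousD (fc x) (gc x).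
move=> [fc fd] [gc gd]; split=> [x|i]; first exact: continuousD (fc x) (gc x).
have [fi fk] := fd i; have [gi gk] := gd i; split=> [x|]; first exact: derivableD.
have -> : pd i (fun x => f x + g x) = (fun x => pd i f x + pd i g x).
  by apply/funext => x; exact: deriveD.
exact: IH.
Qed.

Let CkM k f g : Ck k f -> Ck k g -> Ck k (fun x => f x * g x).
Proof.
elim: k f g => [|k IH] f g; first by move=> fc gc x; exact: continuousM (fc x) (gc x).
move=> fk1 gk1; have [fc fd] := fk1; have [gc gd] := gk1.
split=> [x|i]; first exact: continuousM (fc x) (gc x).
have [fi fk] := fd i; have [gi gk] := gd i; split=> [x|]; first exact: derivableM.
have -> : pd i (fun x => f x * g x) = (fun x => f x * pd i g x + g x * pd i f x).
  by apply/funext => x; exact: deriveM.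
by apply: CkD; apply: IH => //; exact: Ck_le.
Qed.

Lemma smooth_cst (c : R) : smooth (fun _ : 'cV[R]_n => c).
Proof. by move=> k; exact: Ck_cst. Qed.

Lemma smoothD f g : smooth f -> smooth g -> smooth (fun x => f x + g x).
Proof. by move=> fs gs k; exact: CkD. Qed.

Lemma smoothM f g : smooth f -> smooth g -> smooth (fun x => f x * g x).
Proof. by move=> fs gs k; exact: CkM. Qed.

Lemma smooth_sum m (f : 'I_m -> 'cV[R]_n -> R) :
  (forall i, smooth (f i)) -> smooth (fun x => \sum_i f i x).
Proof.
elim: m f => [|m IH] f fs.
  by rewrite (_ : (fun x => _) = fun=> 0); [exact: smooth_cst|apply/funext => x; rewrite big_ord0].
rewrite (_ : (fun x => _) = fun x => \sum_(i < m) f (widen_ord (leqnSn m) i) x + f ord_max x).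
  by apply: smoothD => //; apply: IH.
by apply/funext => x; rewrite big_ord_recr.
Qed.

Lemma smooth_coord (i : 'I_n) : smooth (fun x : 'cV[R]_n => x i 0).
Proof.
have dcoord (x v : 'cV[R]_n) : derivable (fun x : 'cV[R]_n => x i 0) x v /\
    'D_v (fun x : 'cV[R]_n => x i 0) x = v i 0.
  have idd : derivable (@idfun 'cV[R]_n) x v by exact: derivable_id.
  split; first exact: (derivable_mxP _ _ _).1 idd i 0.
  by have := derive_mx idd; rewrite derive_id => /(congr1 (fun M : 'cV[R]_n => M i 0)) ->; rewrite mxE.
case=> [|k]; first by move=> x; exact: coord_continuous.
split=> [x|j]; first exact: coord_continuous.
split=> [x|]; first by have [] := dcoord x (delta_mx j 0).
have -> : pd j (fun x : 'cV[R]_n => x i 0) = fun=> (delta_mx j 0 : 'cV[R]_n) i 0.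
  by apply/funext => x; have [] := dcoord x (delta_mx j 0).
exact: Ck_cst.
Qed.

Definition mx_smooth m p (M : 'cV[R]_n -> 'M[R]_(m, p)) := forall i j, smooth (fun x => M x i j).

Lemma mx_smooth_cst m p (M : 'M[R]_(m, p)) : mx_smooth (fun=> M).
Proof. by move=> i j; exact: smooth_cst. Qed.

Lemma mx_smoothD m p (M N : 'cV[R]_n -> 'M[R]_(m, p)) :
  mx_smooth M -> mx_smooth N -> mx_smooth (fun x => M x + N x).
Proof.
move=> Ms Ns i j; rewrite (_ : (fun x => _) = fun x => M x i j + N x i j); first exact: smoothD.
by apply/funext => x; rewrite mxE.
Qed.

Lemma mx_smoothZ m p (c : R) (M : 'cV[R]_n -> 'M[R]_(m, p)) :
  mx_smooth M -> mx_smooth (fun x => c *: M x).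
Proof.
move=> Ms i j; rewrite (_ : (fun x => _) = fun x => c * M x i j).
  by apply: smoothM => //; exact: smooth_cst.
by apply/funext => x; rewrite mxE.
Qed.

Lemma mx_smooth_mul m p r (M : 'cV[R]_n -> 'M[R]_(m, p)) (N : 'cV[R]_n -> 'M[R]_(p, r)) :
  mx_smooth M -> mx_smooth N -> mx_smooth (fun x => M x *m N x).
Proof.
move=> Ms Ns i j; rewrite (_ : (fun x => _) = fun x => \sum_k M x i k * N x k j).
  by apply: smooth_sum => k; exact: smoothM.
by apply/funext => x; rewrite mxE.
Qed.

End SmoothFunctions.

Section HeisenbergConjugate.
Context {R : realType}.

Lemma mx_smooth_h5_rep : mx_smooth (@h5_rep R).
Proof.
move=> a b; rewrite (_ : (fun v => _) = fun v : 'cV[R]_5 =>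
    \sum_i v i 0 * h5_rep (delta_mx i 0) a b).
  by apply: smooth_sum => i; apply: smoothM; [exact: smooth_coord|exact: smooth_cst].
apply/funext => v; rewrite h5_rep_sum summxE; apply: eq_bigr => i _.
by rewrite mxE.
Qed.

(** A polynomial group isomorphism onto its image, conjugated by a constant matrix. *)
Lemma isom_H5_conjugate (G Gi : 'M[R]_(1 + (5 + 1))) : G *m Gi = 1%:M ->
  isom_H5 (range (fun v => Gi *m h5_exp v *m G)).
Proof.
move=> GGi; have GiG := mulmx1C GGi.
exists (fun v => Gi *m h5_exp v *m G); split=> //.
- apply: mx_smooth_mul; last exact: mx_smooth_cst.
  apply: mx_smooth_mul; first exact: mx_smooth_cst.
  apply: mx_smoothD; first by apply: mx_smoothD; [exact: mx_smooth_cst|exact: mx_smooth_h5_rep].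
  by apply: mx_smoothZ; apply: mx_smooth_mul; exact: mx_smooth_h5_rep.
- by rewrite h5_exp0 mulmx1.
- by move=> v w; rewrite h5_exp_mul -!mulmxA (mulmxA G) GGi mul1mx.
- move=> v w /(congr1 (fun M => G *m M *m Gi)).
  by rewrite !mulmxA GGi !mul1mx -!mulmxA GGi !mulmx1 => /h5_exp_inj.
Qed.

End HeisenbergConjugate.

(** * The tractor connection as a pullback *)

Section Lifts.
Context {R : realType}.
Implicit Types (gam : R -> 'cV[R]_5).

Definition tractor_lift (u : 'cV[R]_5) : 'cV[R]_(1 + (5 + 1)) := amb_pt 1 u 0.

Lemma amb_pt_lift (t : R) (u : 'cV[R]_5) (rho : R) :
  [/\ amb_pt t u rho (lshift (5 + 1) 0) 0 = t,
      forall i, amb_pt t u rho (rshift 1 (lshift 1 i)) 0 = u i 0 &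
      amb_pt t u rho (rshift 1 (rshift 5 0)) 0 = rho].
Proof.
split=> [|i|]; rewrite /amb_pt ?col_mxEd ?col_mxEu ?col_mxEd ?col_mxEu ?mxE //;
  by rewrite eqxx mulr1n.
Qed.

Lemma amb_index_ind (P : 'I_(1 + (5 + 1)) -> Prop) : P (lshift (5 + 1) 0) ->
  (forall i, P (rshift 1 (lshift 1 i))) -> P (rshift 1 (rshift 5 0)) -> forall i, P i.
Proof.
move=> Pt Pu Pr i; case: (split_ordP i) => j ->; first by rewrite ord1.
by case: (split_ordP j) => k -> //; rewrite ord1.
Qed.

Lemma mx_is_derive_tractor_lift gam s dgam : mx_is_derive s gam dgam ->
  mx_is_derive s (tractor_lift \o gam) (amb_pt 0 dgam 0).
Proof.
move=> gd i j; rewrite ord1 /= /tractor_lift; move: i; apply: amb_index_ind => [|i|].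
- have [-> _ _] := amb_pt_lift 0 dgam 0.
  rewrite (_ : (fun u => _) = cst 1); first exact: is_derive_cst.
  by apply/funext => u; have [] := amb_pt_lift 1 (gam u) 0.
- have [_ -> _] := amb_pt_lift 0 dgam 0.
  rewrite (_ : (fun u => _) = fun u => gam u i 0); first exact: gd.
  by apply/funext => u; have [] := amb_pt_lift 1 (gam u) 0.
- have [_ _ ->] := amb_pt_lift 0 dgam 0.
  rewrite (_ : (fun u => _) = cst 0); first exact: is_derive_cst.
  by apply/funext => u; have [] := amb_pt_lift 1 (gam u) 0.
Qed.

Lemma derive_constant_along (n : nat) (W : normedModType R) (f : 'cV[R]_n -> W) x v :
  (forall h : R, f (h *: v + x) = f x) -> 'D_v f x = 0.
Proof.
move=> fx; rewrite /derive (_ : (fun h => _) = cst 0); first exact: lim_cst.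
by apply/funext => h /=; rewrite fx subrr scaler0.
Qed.

(** Homogeneous extensions of constant sections do not vary at t = 1 in the directions
    of M, which leaves the Christoffel term. *)
Lemma tractor_conn_levi_civita (gt : 'cV[R]_(1 + (5 + 1)) -> 'M[R]_(1 + (5 + 1))) u i :
  tractor_conn gt u i = levi_civita gt (tractor_lift u) (rshift 1 (lshift 1 i)).
Proof.
have lift_delta : amb_pt 0 (delta_mx i 0) 0 = delta_mx (rshift 1 (lshift 1 i)) 0
    :> 'cV[R]_(1 + (5 + 1)).
  apply/colP; apply: amb_index_ind => [|j|].
  - by have [-> _ _] := amb_pt_lift 0 (delta_mx i 0) 0; rewrite mxE.
  - have [_ -> _] := amb_pt_lift 0 (delta_mx i 0) 0; rewrite !mxE.
    by rewrite (inj_eq (@rshift_inj _ _)) (inj_eq (@lshift_inj _ _)).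
  - have [_ _ ->] := amb_pt_lift 0 (delta_mx i 0) 0; rewrite mxE.
    by rewrite (inj_eq (@rshift_inj _ _)) eq_rlshift.
apply/matrixP => k j; rewrite mxE /tractor_deriv /cov_deriv lift_delta.
rewrite derive_constant_along => [|h].
  rewrite add0r (bigD1 (rshift 1 (lshift 1 i))) //= big1 => [|l li].
    by rewrite addr0 [delta_mx _ _ _ _]mxE !eqxx scale1r tractor_field1 -colE mxE.
  by rewrite mxE (negbTE li) scale0r.
rewrite -lift_delta /tractor_field; congr (col_mx _ (_^-1 *: _)).
have tE (p : 'cV[R]_(1 + (5 + 1))) : amb_t p = p (lshift (5 + 1) 0) 0 by rewrite /amb_t mxE.
have addE (a b : 'cV[R]_(1 + (5 + 1))) c : (h *: a + b) c 0 = h * a c 0 + b c 0 by rewrite !mxE.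
rewrite !tE addE; have [-> _ _] := amb_pt_lift 0 (delta_mx i 0) 0.
by rewrite mulr0 add0r.
Qed.

(** The lift of a curve has no component along t and rho, so the two transport
    equations have the same coefficients. *)
Lemma tractor_transport (gt : 'cV[R]_(1 + (5 + 1)) -> 'M[R]_(1 + (5 + 1))) gam Q :
  (forall s, 0 <= s <= 1 -> derivable gam s 1) ->
  transport (tractor_conn gt) gam Q <-> transport (levi_civita gt) (tractor_lift \o gam) Q.
Proof.
move=> gd.
have parE W : parallel (tractor_conn gt) gam W <-> parallel (levi_civita gt) (tractor_lift \o gam) W.
  suff sumE s : 0 <= s <= 1 ->
      \sum_i derive1 gam s i 0 *: (tractor_conn gt (gam s) i *m W s) =
      \sum_i derive1 (tractor_lift \o gam) s i 0 *: (levi_civita gt ((tractor_lift \o gam) s) i *m W s).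
    by split=> H s s01; have [Wd WE] := H s s01; split=> //; rewrite ?sumE // -?sumE.
  move=> s01; have gd' := (mx_is_deriveP _ _ _).2 (conj (gd s s01) erefl).
  have [_ ->] := (mx_is_deriveP _ _ _).1 (mx_is_derive_tractor_lift gd').
  have [a0 au ar] := amb_pt_lift 0 (derive1 gam s) 0.
  rewrite [RHS]big_split_ord /= big_ord1 a0 scale0r add0r.
  rewrite [RHS]big_split_ord /= big_ord1 ar scale0r addr0.
  by apply: eq_bigr => i _; rewrite au tractor_conn_levi_civita.
by split=> H v; have [W [WP W0 W1]] := H v; exists W; split=> //; apply/parE.
Qed.

Lemma tractor_lift_segment a b s :
  tractor_lift (segment a b s) = segment (tractor_lift a) (tractor_lift b) s.
Proof.
apply/colP; rewrite /tractor_lift; apply: amb_index_ind => [|i|]; rewrite segment_entry.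
- have [-> _ _] := amb_pt_lift 1 (segment a b s) 0; have [-> _ _] := amb_pt_lift 1 a 0.
  by have [-> _ _] := amb_pt_lift 1 b 0; rewrite subrr mulr0 addr0.
- have [_ -> _] := amb_pt_lift 1 (segment a b s) 0; have [_ -> _] := amb_pt_lift 1 a 0.
  by have [_ -> _] := amb_pt_lift 1 b 0; rewrite segment_entry.
- have [_ _ ->] := amb_pt_lift 1 (segment a b s) 0; have [_ _ ->] := amb_pt_lift 1 a 0.
  by have [_ _ ->] := amb_pt_lift 1 b 0; rewrite subrr mulr0 addr0.
Qed.

Lemma derive1_entry_continuous n (gam : R -> 'cV[R]_n) i s :
  derivable (derive1 gam) s 1 -> {for s, continuous (fun u => derive1 gam u i 0)}.
Proof.
move=> gdd; have dd := (mx_is_deriveP _ _ _).2 (conj gdd erefl).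
exact: is_derive_continuous (dd i 0).
Qed.

Lemma tractor_lift_derive_q gam : (forall s, derivable gam s 1) ->
  (forall s, derivable (derive1 gam) s 1) ->
  forall s, {for s, continuous (fun u => derive1 (tractor_lift \o gam) u amb_iq 0)}.
Proof.
move=> gd gdd s.
rewrite (_ : (fun u => _) = fun u => derive1 gam u iq 0); first exact: derive1_entry_continuous.
apply/funext => u; have gd' := (mx_is_deriveP _ _ _).2 (conj (gd u) erefl).
have [_ ->] := (mx_is_deriveP _ _ _).1 (mx_is_derive_tractor_lift gd').
have [_ <- _] := amb_pt_lift 0 (derive1 gam u) 0.
by congr (amb_pt _ _ _ _ _); exact: val_inj.
Qed.

End Lifts.

(** * The two cases *)

Section Dichotomy.
Context {R : realType}.
Variables (I : set R) (F : R -> R).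
Hypotheses (I_open : open I) (I_itv : is_interval I)
  (F_smooth : smooth_on I F) (F2_neq0 : forall q, I q -> F^`(2) q != 0).

(** The field d/dq lies in D_F, and A is F''^-4 Psi on four copies of it. *)
Lemma cartan_curv_vanishesE :
  cartan_curv_vanishes I F <-> forall q, I q -> Psi (F^`(2)) q = 0.
Proof.
split=> [C q Iq|Psi0 u Iu X _]; last by rewrite /cartan_curv (Psi0 _ Iu) mulr0 mul0r.
have uq : base_u 0 q iq 0 = q by rewrite mxE.
have MFu : M_F I (base_u 0 q) by rewrite /M_F /= uq.
have Dq : D_F F (base_u 0 q) (delta_mx iq 0).
  have om0 (a b c d : R) : (a *: dform iy + b *: dform ix + c *: dform ip + d *: dform iz)
      *m (delta_mx iq 0 : 'cV[R]_5) = 0.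
    by rewrite -colE; apply/matrixP => i j; rewrite !mxE /= !andbF !mulr0 !addr0.
  split.
  - have := om0 1 (- base_u 0 q ip 0) 0 0.
    by rewrite !scale0r !addr0 scale1r scaleNr.
  - have := om0 0 (- F (base_u 0 q iq 0) + derive1 F (base_u 0 q iq 0) * base_u 0 q iq 0)
      (- derive1 F (base_u 0 q iq 0)) 1.
    congr (_ *m _ = 0); apply/matrixP => i j; rewrite /omega2 /omega3 !mxE; ring.
  - have := om0 0 (- base_u 0 q iq 0) 1 0.
    by rewrite !scale0r !addr0 add0r scale1r scaleNr addrC.
have := C _ MFu (fun=> delta_mx iq 0) (fun=> Dq).
rewrite /cartan_curv uq big1 => [|k _]; last first.
  by rewrite /dform mul_delta_mx mxE !eqxx.
move/eqP; rewrite mulr1 mulf_eq0 invr_eq0 expf_eq0 (negbTE (F2_neq0 Iq)) /=.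
by move/eqP.
Qed.

Variables (n : nat) (V : set 'cV[R]_n) (A : @conn R n (1 + (5 + 1)))
  (L : 'cV[R]_n -> 'cV[R]_(1 + (5 + 1))) (pt : R -> R -> 'cV[R]_n).
Hypotheses (L_dom : forall x, V x <-> amb_dom (M_F I) (L x))
  (L_segment : forall a b s, L (segment a b s) = segment (L a) (L b) s)
  (L_derivable : forall (gam : R -> 'cV[R]_n) s,
    derivable gam s 1 -> derivable (L \o gam) s 1)
  (L_derive_q : forall (gam : R -> 'cV[R]_n), (forall s, derivable gam s 1) ->
    (forall s, derivable (derive1 gam) s 1) ->
    forall s, {for s, continuous (fun u => derive1 (L \o gam) u amb_iq 0)})
  (L_transport : forall (gam : R -> 'cV[R]_n) Q,
    (forall s, 0 <= s <= 1 -> derivable gam s 1) ->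
    transport A gam Q <-> transport (levi_civita (amb_g_F F)) (L \o gam) Q)
  (L_pt : forall z q, L (pt z q) = base_pt z q).

(** When Psi vanishes the gauge is a parallel frame. *)
Lemma holonomy_flat x : (forall q, I q -> Psi (F^`(2)) q = 0) -> V x ->
  isom_trivial (hol V A x).
Proof.
move=> Psi0 Vx; have [_ Iq0] := (L_dom x).1 Vx.
have [tau1 [tau2 [sig1 [sig2 [_ [dt1 dt2] [ds1 ds2] wr]]]]] :=
  parallel_frame_exists I_open I_itv Iq0 F_smooth F2_neq0.
have GK p := gaugeK F2_neq0 wr (p := p).
have LC_h5 gam Q := amb_transport_h5 I_open F_smooth F2_neq0 dt1 dt2 ds1 ds2 wr
  (gam := gam) (Q := Q).
apply/seteqP; split=> [P|_ ->]; last exact: pw_transport_nil.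
move=> /(pw_transport_h5 GK LC_h5 L_dom L_derivable L_derive_q L_transport).
move=> [_ _ [v PE v0]]; rewrite /= PE (v0 Psi0) h5_exp0 mulmx1.
exact: mulmx1C (GK _ ((L_dom x).1 Vx)).
Qed.

(** The base point q0 is taken where Psi does not vanish, which makes the twisted
    cubic, and hence the loops through q0, span the algebra modulo its centre. *)
Lemma holonomy_curved x : ~ (forall q, I q -> Psi (F^`(2)) q = 0) -> V x ->
  isom_H5 (hol V A x).
Proof.
move=> nPsi0 Vx.
have [q0 Iq0 Psi_q0] : exists2 q0, I q0 & Psi (F^`(2)) q0 != 0.
  apply: contrapT => nex; apply: nPsi0 => q Iq.
  by apply: contrapT => Psi_q; apply: nex; exists q => //; apply/eqP.
have f_q0 : cubic_coef F q0 != 0.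
  rewrite /cubic_coef mulf_neq0 ?invr_neq0 ?oppr_eq0 //.
  by rewrite mulf_neq0 // expf_neq0 // invr_neq0 // F2_neq0.
have [tau1 [tau2 [sig1 [sig2 [[t1 t2 s1 s2] [dt1 dt2] [ds1 ds2] wr]]]]] :=
  parallel_frame_exists I_open I_itv Iq0 F_smooth F2_neq0.
have [Av [Cv [Av0 Cv0 Avd Avc Cvd]]] :=
  quadratures_exist I_open I_itv Iq0 F_smooth F2_neq0 dt1 dt2.
have GK p := gaugeK F2_neq0 wr (p := p).
have LC_h5 gam Q := amb_transport_h5 I_open F_smooth F2_neq0 dt1 dt2 ds1 ds2 wr
  (gam := gam) (Q := Q).
have LC_q a b := amb_segment_const_q I_open F_smooth F2_neq0 dt1 dt2 ds1 ds2 wr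
  (a := a) (b := b).
have LC_dev z q1 q2 := amb_segment_develop I_open F_smooth F2_neq0 dt1 dt2 ds1 ds2 wr
  Avd Avc Cvd z (q1 := q1) (q2 := q2) I_itv.
have dev_z0 q : develop Av Cv 0 q = 0 by rewrite /develop scale0r expr0n mul0r scale0r addr0.
have dev_q0 z : develop Av Cv z q0 = 0 by rewrite /develop Av0 Cv0 mulr0 scaler0 scale0r addr0.
have Av_span := twisted_cubic_span I_open Iq0
  (cubic_coef_continuous F_smooth F2_neq0) f_q0 t1 t2 s1 s2 dt1 dt2 ds1 ds2 Avd.
rewrite (holonomy_h5 I_itv Iq0 dev_z0 dev_q0 GK LC_h5 LC_q LC_dev L_dom L_segment
  L_derivable L_derive_q L_transport L_pt (fun z q => erefl) Av_span Vx).
by apply: isom_H5_conjugate; apply: GK; apply/L_dom.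
Qed.

End Dichotomy.

Theorem theorem36 (R : realType) (I : set R) (F : R -> R)
    (I_open : open I) (I_itv : is_interval I)
    (F_smooth : smooth_on I F) (F2_neq0 : forall q, I q -> F^`(2) q != 0) :
  (cartan_curv_vanishes I F ->
     (forall u, M_F I u -> isom_trivial (tractor_hol I F u)) /\
     (forall p, amb_dom (M_F I) p -> isom_trivial (amb_hol I F p))) /\
  (~ cartan_curv_vanishes I F ->
     (forall u, M_F I u -> isom_H5 (tractor_hol I F u)) /\
     (forall p, amb_dom (M_F I) p -> isom_H5 (amb_hol I F p))).
Proof.
rewrite (cartan_curv_vanishesE F2_neq0).
have id_derivable (gam : R -> 'cV[R]_(1 + (5 + 1))) s :
  derivable gam s 1 -> derivable (id \o gam) s 1 by exact.
have id_derive_q (gam : R -> 'cV[R]_(1 + (5 + 1))) : (forall s, derivable gam s 1) ->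
    (forall s, derivable (derive1 gam) s 1) ->
    forall s, {for s, continuous (fun u => derive1 (id \o gam) u amb_iq 0)}.
  by move=> _ gdd s; exact: derive1_entry_continuous.
have lift_dom u : M_F I u <-> amb_dom (M_F I) (tractor_lift u).
  rewrite /amb_dom /= /tractor_lift; have [-> -> _] := amb_ptK 1 u 0.
  by split=> [|[]].
have lift_derivable (gam : R -> 'cV[R]_5) s :
    derivable gam s 1 -> derivable (tractor_lift \o gam) s 1.
  move=> gd; have gd' := (mx_is_deriveP _ _ _).2 (conj gd erefl).
  by have [] := (mx_is_deriveP _ _ _).1 (mx_is_derive_tractor_lift gd').
split=> [Psi0|nPsi0]; split=> x Vx.
- exact: (holonomy_flat I_open I_itv F_smooth F2_neq0 lift_dom lift_derivable
    (@tractor_lift_derive_q R) (@tractor_transport R _) Psi0 Vx).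
- exact: (holonomy_flat I_open I_itv F_smooth F2_neq0 (fun=> iff_refl _) id_derivable
    id_derive_q (fun _ _ _ => iff_refl _) Psi0 Vx).
- exact: (holonomy_curved I_open I_itv F_smooth F2_neq0 lift_dom tractor_lift_segment
    lift_derivable (@tractor_lift_derive_q R) (@tractor_transport R _)
    (fun _ _ => erefl) nPsi0 Vx).
- exact: (holonomy_curved I_open I_itv F_smooth F2_neq0 (fun=> iff_refl _) (fun _ _ _ => erefl)
    id_derivable id_derive_q (fun _ _ _ => iff_refl _) (fun _ _ => erefl) nPsi0 Vx).
Qed.
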